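(* For all integers $m,r\ge1$, $$(-1)^{r+1}\Delta^rM_m>0.$$
   Context: Let $\mathbb D=\{z\in\mathbb C:|z|<1\}$, $\mathrm dA$ planar Lebesgue measure. For a nonzero polynomial $F\in\mathbb C[z_1,\ldots,z_n]$, the areal Mahler measure is $\mathrm m_{\mathbb D}(F)=\pi^{-n}\int_{\mathbb D^n}\log|F(z_1,\ldots,z_n)|\,\mathrm dA(z_1)\cdots\mathrm dA(z_n)$. For $m\ge1$, $$P_m(x_1,\ldots,x_m,u)=\prod_{j=1}^m(1+x_j)+u\prod_{j=1}^m(1-x_j),\qquad M_m:=\mathrm m_{\mathbb D}(P_m).$$ For a sequence $(a_m)_{m\ge1}$, $\Delta a_m:=a_{m+1}-a_m$ and $\Delta^ra_m:=\Delta(\Delta^{r-1}a_m)$ (with $\Delta^1=\Delta$). *)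

(* Defs.v *)
From HB Require Import structures.
From mathcomp Require Import all_boot all_order all_algebra.
From mathcomp Require Import all_classical all_reals all_analysis.
From mathcomp Require Import complex.
(* Only the canonical structures of [mpoly] are imported: its notations clash
   with those of [all_analysis]. *)
From mathcomp Require Import (canonicals) mpoly.

Set Implicit Arguments.
Unset Strict Implicit.
Unset Printing Implicit Defensive.

Import Order.TTheory GRing.Theory Num.Theory.
Import numFieldNormedType.Exports.

Local Open Scope classical_set_scope.
Local Open Scope ring_scope.

(* [product_measure1] has no usable canonical sigma-finite structure beyond
   subprobabilities, hence this lemma and the instances below. *)
Lemma sigma_finite_product_measure1 d1 d2 (T1 : measurableType d1)
    (T2 : measurableType d2) (R : realType)
    (m1 : {sigma_finite_measure set T1 -> \bar R})
    (m2 : {sigma_finite_measure set T2 -> \bar R}) :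
  sigma_finite setT (m1 \x m2)%E.
Proof.
have /sigma_finiteP[F [TF ndF Foo]] := sigma_finiteT m1.
have /sigma_finiteP[G [TG ndG Goo]] := sigma_finiteT m2.
exists (fun n => F n `*` G n).
  rewrite -setXTT TF TG predeqE => -[x y]; split.
    move=> [/= [n _ Fnx] [k _ Gky]]; exists (maxn n k) => //; split.
      by move: x Fnx; exact/subsetPset/ndF/leq_maxl.
    by move: y Gky; exact/subsetPset/ndG/leq_maxr.
  by move=> [n _ []/= ? ?]; split; exists n.
move=> k; have [? ?] := Foo k; have [? ?] := Goo k.
split; first exact: measurableX.
by rewrite product_measure1E// lte_mul_pinfty// ge0_fin_numE.
Qed.

Section tuple_measure.
Context d (T : measurableType d) (R : realType).
Variable mu : set T -> \bar R.

Definition tuple_cons n (p : T * n.-tuple T) : n.+1.-tuple T :=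
  [tuple of p.1 :: p.2].

(* The n-fold product measure on [n.-tuple T], obtained by transporting the
   binary product along (x, t) |-> x :: t. *)
Fixpoint tuple_measure (n : nat) : set (n.-tuple T) -> \bar R :=
  match n with
  | 0 => \d_([tuple] : 0.-tuple T)
  | n'.+1 => pushforward (mu \x @tuple_measure n')%E (@tuple_cons n')
  end.

Lemma measurable_tuple_cons n : measurable_fun setT (@tuple_cons n).
Proof. by apply: measurable_cons. Qed.

End tuple_measure.
Arguments tuple_measure {d T R} mu n _.

Section tuple_measure_step.
Local Open Scope ereal_scope.
Context d (T : measurableType d) (R : realType).
Variables (mu : {sigma_finite_measure set T -> \bar R}) (n : nat).
Variable nu : {sigma_finite_measure set (n.-tuple T) -> \bar R}.

Let step := pushforward (mu \x nu) (@tuple_cons _ T n).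

Let mpre (A : set (n.+1.-tuple T)) :
  measurable A -> measurable (@tuple_cons _ T n @^-1` A).
Proof.
by move=> mA; rewrite -[X in measurable X]setTI; exact: measurable_tuple_cons.
Qed.

Let step0 : step set0 = 0.
Proof. by rewrite /step /pushforward preimage_set0 measure0. Qed.

Let step_ge0 A : 0 <= step A.
Proof. exact: (measure_ge0 (mu \x nu)). Qed.

Let step_semi_sigma_additive : semi_sigma_additive step.
Proof.
move=> F mF tF mUF; rewrite /step /pushforward preimage_bigcup.
apply: measure_semi_sigma_additive.
- by move=> k; exact: mpre.
- apply/trivIsetP => /= i j _ _ ij; rewrite -preimage_setI.
  by move/trivIsetP : tF => /(_ _ _ _ _ ij) ->//; rewrite preimage_set0.
- by rewrite -preimage_bigcup; exact: mpre.
Qed.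

HB.instance Definition _ := isMeasure.Build _ _ _ step
  step0 step_ge0 step_semi_sigma_additive.

Let step_sigma_finite : sigma_finite setT step.
Proof.
have [F TF mF] := sigma_finite_product_measure1 mu nu.
pose g (t : n.+1.-tuple T) : T * n.-tuple T := (thead t, [tuple of behead t]).
have gK : cancel (@tuple_cons _ T n) g.
  by move=> -[x t]; congr pair; exact: val_inj.
have mg : measurable_fun setT g.
  apply: measurable_fun_pair; first exact: (@measurable_tnth _ T n.+1 ord0).
  exact: measurable_behead.
exists (fun k => g @^-1` F k).
  by rewrite -preimage_bigcup -TF preimage_setT.
move=> k; have [mFk Fkoo] := mF k; split.
  by rewrite -[X in measurable X]setTI; exact: mg.
rewrite /step /pushforward -comp_preimage (_ : g \o _ = id)//.
exact/funext.
Qed.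

HB.instance Definition _ := Measure_isSigmaFinite.Build _ _ _ step
  step_sigma_finite.

Lemma tuple_measure_step :
  {m : {sigma_finite_measure set (n.+1.-tuple T) -> \bar R} |
    step = m :> (set (n.+1.-tuple T) -> \bar R)}.
Proof. by exists step. Qed.

End tuple_measure_step.

Section tuple_measure_instance.
Local Open Scope ereal_scope.
Context d (T : measurableType d) (R : realType).
Variables (mu : {sigma_finite_measure set T -> \bar R}) (n : nat).

Let tuple_measure_sig :
  {m : {sigma_finite_measure set (n.-tuple T) -> \bar R} |
    tuple_measure mu n = m :> (set (n.-tuple T) -> \bar R)}.
Proof.
elim: n => [|k [m mE]]; first by exists (\d_([tuple] : 0.-tuple T)).
by have [m' m'E] := tuple_measure_step mu m; exists m'; rewrite /= mE.
Qed.

Let tuple_measure0 : tuple_measure mu n set0 = 0.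
Proof. by have [m ->] := tuple_measure_sig; rewrite measure0. Qed.

Let tuple_measure_ge0 A : 0 <= tuple_measure mu n A.
Proof. by have [m ->] := tuple_measure_sig; exact: measure_ge0. Qed.

Let tuple_measure_semi_sigma_additive :
  semi_sigma_additive (tuple_measure mu n).
Proof.
by have [m ->] := tuple_measure_sig; exact: measure_semi_sigma_additive.
Qed.

HB.instance Definition _ := isMeasure.Build _ _ _ (tuple_measure mu n)
  tuple_measure0 tuple_measure_ge0 tuple_measure_semi_sigma_additive.

Let tuple_measure_sigma_finite : sigma_finite setT (tuple_measure mu n).
Proof. by have [m ->] := tuple_measure_sig; exact: sigma_finiteT. Qed.

HB.instance Definition _ := Measure_isSigmaFinite.Build _ _ _
  (tuple_measure mu n) tuple_measure_sigma_finite.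

End tuple_measure_instance.

(* On measurable boxes [tuple_measure] is the product of the measures. *)
Lemma tuple_measureE d (T : measurableType d) (R : realType)
    (mu : {sigma_finite_measure set T -> \bar R}) (n : nat)
    (A : 'I_n -> set T) : (forall i, measurable (A i)) ->
  tuple_measure mu n [set t | forall i, A i (tnth t i)] =
  (\prod_(i < n) mu (A i))%E.
Proof.
elim: n A => [|n IHn] A mA.
  rewrite big_ord0 /= diracE mem_set// => -[]//.
rewrite big_ord_recl -IHn; last by move=> i; exact: mA.
rewrite /= /pushforward -product_measure1E//.
  congr (_ _); apply/seteqP; split=> [[x t] /= Axt|[x t] /= [A0 At] i].
    split; first exact: (Axt ord0).
    by move=> i; have := Axt (lift ord0 i); rewrite tnthS.
  case: (unliftP ord0 i) => [j ->|->//]; rewrite tnthS; exact: At.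
rewrite [X in measurable X](_ : _ =
    \bigcap_(i in setT) ((@tnth _ T ^~ i) @^-1` A (lift ord0 i))).
  apply: fin_bigcap_measurable => // i _.
  rewrite -[X in measurable X]setTI; exact: measurable_tnth.
by apply/seteqP; split=> t /= At i; [move=> _|]; exact: At.
Qed.

Section areal_mahler.
Variable R : realType.

(* C as R * R with planar Lebesgue measure; complex numbers carry no
   measurable structure in the library. *)
Definition plane : Type := (measurableTypeR R * measurableTypeR R)%type.
HB.instance Definition _ := Measurable.on plane.

Definition planar_measure : set plane -> \bar R :=
  (@lebesgue_measure R \x @lebesgue_measure R)%E.
HB.instance Definition _ := Measure.on planar_measure.
HB.instance Definition _ := Measure_isSigmaFinite.Build _ _ _ planar_measure
  (sigma_finite_product_measure1 (@lebesgue_measure R) (@lebesgue_measure R)).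

Definition complex_of_plane (p : plane) : R[i] := Complex p.1 p.2.

Definition modulus (z : R[i]) : R := ComplexField.Normc.normc z.

Definition unit_disc : set plane :=
  [set p | modulus (complex_of_plane p) < 1].

Definition polydisc (n : nat) : set (n.-tuple plane) :=
  [set z | forall i, unit_disc (tnth z i)].

(* The logarithm is [lne], with value -oo at 0. The integral is finite for
   every nonzero F, so that [fine] only matters for the junk value at F = 0. *)
Definition areal_mahler (n : nat) (F : mpoly.mpoly n R[i]) : R :=
  pi ^- n * fine (\int[tuple_measure planar_measure n]_(z in @polydisc n)
    lne (modulus
      (mpoly.meval (fun i => complex_of_plane (tnth z i)) F))%:E)%E.

Definition mvar (n : nat) (i : 'I_n) : mpoly.mpoly n R[i] :=
  mpoly.mpolyX R[i] (mpoly.mnm1 i).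

(* The variables are x_1, ..., x_m, u in this order: x_j has index j - 1 and
   u is the last one. *)
Definition xvar (m : nat) (j : 'I_m) : mpoly.mpoly m.+1 R[i] :=
  mvar (widen_ord (leqnSn m) j).
Definition uvar (m : nat) : mpoly.mpoly m.+1 R[i] := mvar ord_max.

Definition P_poly (m : nat) : mpoly.mpoly m.+1 R[i] :=
  \prod_(j < m) (1 + xvar j) + uvar m * \prod_(j < m) (1 - xvar j).

Definition M_seq (m : nat) : R := areal_mahler (P_poly m).

Definition Delta (a : nat -> R) (m : nat) : R := a m.+1 - a m.

End areal_mahler.

(* Main.v *)
(* Let [x_1], ..., [x_m], [u] be independent uniform points of the disc and put
   Y_j = log |(1 - x_j) / (1 + x_j)|. Averaging over the argument of [u] gives
   E log |a + u b| = (log |a| + log |b| + E log |u|) / 2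
                     + E |log |b| - log |a| + log |u|| / 2,
   and E log |1 + x| = E log |1 - x| = 0, so M_m is a constant plus
   E |Y_1 + ... + Y_m + log |u|| / 2. Since |v| is proportional to the integral
   over t > 0 of (1 - cos (t v)) / t^2, this makes M_m a constant plus a positive
   multiple of the integral of (1 - psi(t)^m chi(t)) / t^2, where psi(t) = E cos (t Y)
   (the law of Y is symmetric) and chi(t) = E cos (t log |u|) = 4 / (4 + t^2).
   Differencing in m turns psi^m into (psi - 1)^r psi^m, hence (-1)^(r+1) Delta^r M_m
   is a positive multiple of the integral of (1 - psi)^r psi^m chi / t^2.

   It remains to see that 0 <= psi <= 1, with psi < 1 near 0. The inversion w |-> 1/w
   sends the translated disc to a half-plane, and polar coordinates there exhibit
   exp Y as a mixture of densities proportional to r / (1 + 2 c r + r^2)^2 with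
   0 <= c <= 1. Each is a positive combination of the densities r^j / (1 + r)^(2j + 2)
   of ratios of two independent Gamma variables with the same parameter, whose
   logarithms have characteristic functions of the form |phi|^2. *)
From HB Require Import structures.
From mathcomp Require Import all_boot all_order all_algebra.
From mathcomp Require Import all_classical all_reals all_analysis.
From mathcomp Require Import measurable_realfun complex ring lra.
From mathcomp Require Import (canonicals) mpoly.
Require Import Defs.

Set Implicit Arguments.
Unset Strict Implicit.
Unset Printing Implicit Defensive.

Import Order.TTheory GRing.Theory Num.Theory.
Import numFieldNormedType.Exports.

Local Open Scope classical_set_scope.
Local Open Scope ring_scope.

(** * Invariance of Lebesgue measure on the line *)

(** Averaging over the argument of u turns log |a + u b| into max(log |a|, log |u b|), and max(x, y)
    = (x + y) / 2 + |x - y| / 2; this is where the absolute value comes from. The variables x_j are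
    peeled off first and u last. Each x_j multiplies the coefficients a and b by 1 + x_j and 1 -
    x_j, so v = log |b| - log |a| moves by Y_j. The induction therefore carries an arbitrary v,
    although only v = 0 is wanted at the end. The bound |psi| <= 1 would not be enough: for odd m
    the factor psi^m has the sign of psi. Once psi >= 0 is known, strictness needs 0 < psi < 1 on
    one interval only, and 1 - psi(t) <= t E |Y| supplies it near 0. Logarithms are unbounded below
    while Tonelli wants a sign, so the integrals are those of K - log with K large. For the same
    reason positivity of a cosine transform of a kernel k is expressed as int k <= int k (1 + cos).
    Every planar change of variables is assembled, through Tonelli, from translations, dilations and
    the reflection of the line. *)

Section lebesgue_line.
Variable R : realType.
Notation mu := (@lebesgue_measure R).
Local Open Scope ereal_scope.

Lemma measurable_invr : measurable_fun [set: R] (@GRing.inv R).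
Proof.
rewrite -(setvU [set 0%R]); apply/measurable_funU; [exact: measurableC|by []|split].
  apply: open_continuous_measurable_fun.
    exact/closed_openC/closed_eq.
  by move=> x /[!inE]/= /eqP x0; apply: inv_continuous.
exact: measurable_fun_set1.
Qed.

Lemma measurable_sqrtr : measurable_fun [set: R] (@Num.sqrt R).
Proof. by apply: continuous_measurable_fun; exact: sqrt_continuous. Qed.

Lemma measurable_cos : measurable_fun [set: R] (@cos R).
Proof. by apply: continuous_measurable_fun; exact: continuous_cos. Qed.

Lemma measurable_sin : measurable_fun [set: R] (@sin R).
Proof. by apply: continuous_measurable_fun; exact: continuous_sin. Qed.

Lemma measurable_lne : measurable_fun [set: R] (fun x : R => lne x%:E).
Proof.
rewrite /lne/=; apply: measurable_fun_ifT => //.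
  exact: measurable_fun_ler.
by apply/measurable_EFinP; exact: measurable_ln.
Qed.

Lemma ge0_integral_translation (a : R) (f : R -> \bar R) :
  measurable_fun [set: R] f -> (forall x, 0 <= f x) ->
  \int[mu]_x f (x + a)%R = \int[mu]_x f x.
Proof.
move=> mf f0.
have ma : measurable_fun setT ((fun x => x + a)%R : R -> measurableTypeR R).
  exact: measurable_funD.
transitivity (\int[pushforward mu ((fun x => x + a)%R : R -> measurableTypeR R)]_x f x).
  by rewrite ge0_integral_pushforward// => x _; exact: f0.
apply: eq_measure_integral => /= A mA _; apply/esym/lebesgue_measure_unique => //=.
move=> _ [[b c]] _ <-; rewrite /pushforward/= lebesgue_measure_itv/=.
rewrite (_ : _ @^-1` _ = `](b - a)%R, (c - a)%R]%classic); last first.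
  by apply/seteqP; split=> x/=; rewrite !in_itv/= ltrBlDr lerBrDr.
rewrite lebesgue_measure_itv/= !lte_fin ltrD2r; case: ifPn => // _.
by rewrite -!EFinD; congr EFin; lra.
Qed.

Lemma ge0_integral_dilation (k : R) (f : R -> \bar R) : (0 < k)%R ->
  measurable_fun [set: R] f -> (forall x, 0 <= f x) ->
  k%:E * \int[mu]_x (f (k * x)%R) = \int[mu]_x f x.
Proof.
move=> k0 mf f0.
have mk : measurable_fun setT ((fun x => k * x)%R : R -> measurableTypeR R).
  exact: measurable_funM.
have k0' : (0 <= k)%R := ltW k0.
pose m := mscale (NngNum k0') (pushforward mu ((fun x => k * x)%R : R -> measurableTypeR R)).
transitivity (\int[m mk]_x f x).
  rewrite ge0_integral_mscale//=; congr *%E.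
  by rewrite ge0_integral_pushforward// => x _; exact: f0.
apply: eq_measure_integral => /= A mA _; apply/esym/lebesgue_measure_unique => //=.
move=> _ [[b c]] _ <-; rewrite {}/m /mscale/= /pushforward/= lebesgue_measure_itv/=.
rewrite (_ : _ @^-1` _ = `](b / k)%R, (c / k)%R]%classic); last first.
  by apply/seteqP; split=> x/=; rewrite !in_itv/= ltr_pdivrMr// ler_pdivlMr// ![(x * _)%R]mulrC.
rewrite lebesgue_measure_itv/= !lte_fin ltr_pM2r ?invr_gt0//; case: ifPn => // _; last by rewrite mule0.
rewrite -!EFinD -EFinM; congr EFin; rewrite mulrBr; congr (_ - _)%R; field; exact: lt0r_neq0.
Qed.

Lemma ge0_integral_oppr (f : R -> \bar R) :
  measurable_fun [set: R] f -> (forall x, 0 <= f x) ->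
  \int[mu]_x f (- x)%R = \int[mu]_x f x.
Proof.
move=> mf f0.
transitivity (\int[pushforward mu (-%R : R -> measurableTypeR R)]_x f x).
  by rewrite ge0_integral_pushforward// => x _; exact: f0.
by apply: eq_measure_integral => /= A mA _; exact: lebesgue_measureN.
Qed.
End lebesgue_line.

(** * Measurability by structural rules *)

(* Library rules restated eta-expanded, so that the matching in [meas_step] can
   apply them without higher-order unification. *)
Section measurability_rules.
Context d (T : measurableType d) (R : realType).
Variable D : set T.
Implicit Types (f g : T -> R) (h k : T -> \bar R).

Lemma meas_add f g : measurable_fun D f -> measurable_fun D g ->
  measurable_fun D (fun x => f x + g x).
Proof. exact: measurable_funD. Qed.

Lemma meas_opp f : measurable_fun D f -> measurable_fun D (fun x => - f x).
Proof. exact: measurable_funN. Qed.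

Lemma meas_mul f g : measurable_fun D f -> measurable_fun D g ->
  measurable_fun D (fun x => f x * g x).
Proof. exact: measurable_funM. Qed.

Lemma meas_exp f n : measurable_fun D f -> measurable_fun D (fun x => f x ^+ n).
Proof. exact: measurable_funX. Qed.

Lemma meas_inv f : measurable_fun D f -> measurable_fun D (fun x => (f x)^-1).
Proof. exact: (measurableT_comp (@measurable_invr R)). Qed.

Lemma meas_sqrt f : measurable_fun D f -> measurable_fun D (fun x => Num.sqrt (f x)).
Proof. exact: (measurableT_comp (@measurable_sqrtr R)). Qed.

Lemma meas_ln f : measurable_fun D f -> measurable_fun D (fun x => ln (f x)).
Proof. exact: (measurableT_comp (@measurable_ln R)). Qed.

Lemma meas_expR f : measurable_fun D f -> measurable_fun D (fun x => expR (f x)).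
Proof. exact: (measurableT_comp (@measurable_expR R)). Qed.

Lemma meas_cos f : measurable_fun D f -> measurable_fun D (fun x => cos (f x)).
Proof. exact: (measurableT_comp (@measurable_cos R)). Qed.

Lemma meas_sin f : measurable_fun D f -> measurable_fun D (fun x => sin (f x)).
Proof. exact: (measurableT_comp (@measurable_sin R)). Qed.

Lemma meas_norm f : measurable_fun D f -> measurable_fun D (fun x => `|f x|).
Proof. exact: (measurableT_comp (@normr_measurable R setT)). Qed.

Lemma meas_max f g : measurable_fun D f -> measurable_fun D g ->
  measurable_fun D (fun x => Num.max (f x) (g x)).
Proof. exact: measurable_maxr. Qed.

Lemma meas_lne f : measurable_fun D f -> measurable_fun D (fun x => lne (f x)%:E).
Proof. exact: (measurableT_comp (@measurable_lne R)). Qed.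

Lemma meas_EFin f : measurable_fun D f -> measurable_fun D (fun x => (f x)%:E).
Proof. by move=> mf; exact/measurable_EFinP. Qed.

Lemma meas_abse h : measurable_fun D h -> measurable_fun D (fun x => `|h x|)%E.
Proof. exact: (measurableT_comp (@abse_measurable R setT)). Qed.

Lemma meas_adde h k : measurable_fun D h -> measurable_fun D k ->
  measurable_fun D (fun x => h x + k x)%E.
Proof. exact: emeasurable_funD. Qed.

Lemma meas_oppe h : measurable_fun D h -> measurable_fun D (fun x => - h x)%E.
Proof. exact: (measurableT_comp (@oppe_measurable R setT)). Qed.

Lemma meas_mule h k : measurable_fun D h -> measurable_fun D k ->
  measurable_fun D (fun x => h x * k x)%E.
Proof. exact: emeasurable_funM. Qed.

Lemma meas_cst d' (T' : measurableType d') (c : T') : measurable_fun D (fun=> c).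
Proof. exact: measurable_cst. Qed.

End measurability_rules.

Lemma meas_fst d d' (T : measurableType d) (T' : measurableType d') (D : set (T * T')) :
  measurable_fun D (fun p => p.1).
Proof. apply: measurable_funTS; exact: measurable_fst. Qed.

Lemma meas_snd d d' (T : measurableType d) (T' : measurableType d') (D : set (T * T')) :
  measurable_fun D (fun p => p.2).
Proof. apply: measurable_funTS; exact: measurable_snd. Qed.

Lemma meas_id d (T : measurableType d) (D : set T) : measurable_fun D (fun p => p).
Proof. apply: measurable_funTS; exact: measurable_id. Qed.

Lemma meas_pair d d' d'' (T : measurableType d) (T1 : measurableType d')
    (T2 : measurableType d'') (f : T -> T1) (g : T -> T2) :
  measurable_fun setT f -> measurable_fun setT g -> measurable_fun setT (fun x => (f x, g x)).
Proof. exact: measurable_fun_pair. Qed.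

Ltac meas_step := lazymatch goal with
  | |- measurable_fun _ (fun x => x) => apply: meas_id
  | |- measurable_fun _ fst => apply: meas_fst
  | |- measurable_fun _ snd => apply: meas_snd
  | |- measurable_fun _ (GRing.inv) => exact: measurable_invr
  | |- measurable_fun _ (@cos _) => exact: measurable_cos
  | |- measurable_fun _ (@sin _) => exact: measurable_sin
  | |- measurable_fun _ (@ln _) => exact: measurable_ln
  | |- measurable_fun _ (@expR _) => exact: measurable_expR
  | |- measurable_fun _ (GRing.add ?c) => apply: (@meas_add _ _ _ _ (fun=> c) (fun x => x))
  | |- measurable_fun _ (GRing.mul ?c) => apply: (@meas_mul _ _ _ _ (fun=> c) (fun x => x))
  | |- measurable_fun _ GRing.opp => exact: oppr_measurable
  | |- measurable_fun _ EFin => exact: EFin_measurable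
  | |- measurable_fun _ (fun x => x.1) => apply: meas_fst
  | |- measurable_fun _ (fun x => x.2) => apply: meas_snd
  | |- measurable_fun _ (fun x => (@?f x)%:E) => apply: meas_EFin
  | |- measurable_fun _ (fun x => lne (@?f x)%:E) => apply: meas_lne
  | |- measurable_fun _ (fun x => `|@?f x|%E) => apply: meas_abse
  | |- measurable_fun _ (fun x => (@?f x + @?g x)%E) => apply: meas_adde
  | |- measurable_fun _ (fun x => (@?f x * @?g x)%E) => apply: meas_mule
  | |- measurable_fun _ (fun x => (- @?f x)%E) => apply: meas_oppe
  | |- measurable_fun _ (fun x => (@?f x + @?g x)%R) => first [apply: meas_add | apply: meas_adde]
  | |- measurable_fun _ (fun x => (@?f x * @?g x)%R) => apply: meas_mul
  | |- measurable_fun _ (fun x => (- @?f x)%R) => apply: meas_opp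
  | |- measurable_fun _ (fun x => (@?f x ^+ _)%R) => apply: meas_exp
  | |- measurable_fun _ (fun x => ((@?f x)^-1)%R) => apply: meas_inv
  | |- measurable_fun _ (fun x => Num.sqrt (@?f x)) => apply: meas_sqrt
  | |- measurable_fun _ (fun x => ln (@?f x)) => apply: meas_ln
  | |- measurable_fun _ (fun x => expR (@?f x)) => apply: meas_expR
  | |- measurable_fun _ (fun x => cos (@?f x)) => apply: meas_cos
  | |- measurable_fun _ (fun x => sin (@?f x)) => apply: meas_sin
  | |- measurable_fun _ (fun x => `|@?f x|%R) => apply: meas_norm
  | |- measurable_fun _ (fun x => Num.max (@?f x) (@?g x)) => apply: meas_max
  | |- measurable_fun _ (fun x => (@?f x, @?g x)) => apply: meas_pair
  | H : measurable_fun _ ?h |- measurable_fun _ ?h => exact: H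
  | H : measurable_fun setT ?h |- measurable_fun _ (fun x => ?h _) =>
      apply: (measurableT_comp H)
  | |- measurable_fun _ (fun _ => _) => apply: meas_cst
  end.
Ltac meas := cbn beta; apply: measurable_funTS; repeat (cbn [fst snd]; meas_step).

(** * Tonelli on rectangles and multiplicative Haar measure *)

Section tonelli_on.
Local Open Scope ereal_scope.
Context d1 d2 (T1 : measurableType d1) (T2 : measurableType d2) (R : realType).
Variables (m1 : {sigma_finite_measure set T1 -> \bar R})
  (m2 : {sigma_finite_measure set T2 -> \bar R}).
Variables (A : set T1) (B : set T2) (f : T1 * T2 -> \bar R).
Hypotheses (mA : measurable A) (mB : measurable B)
  (mf : measurable_fun setT f)
  (f0 : forall x y, A x -> B y -> 0 <= f (x, y)).

(** Integrands such as [x^-1 * f x] are nonnegative only on the rectangle, so they are extended by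
    zero before Tonelli is applied. *)
Let g := f \_ (A `*` B).

Let mg : measurable_fun setT g.
Proof.
apply/(measurable_restrictT _ _).1; first exact: measurableX.
exact: measurable_funTS.
Qed.

Let g0 p : 0 <= g p.
Proof.
by rewrite /g patchE; case: ifPn => //; rewrite inE => -[]; case: p => x y; exact: f0.
Qed.

Let innerE x : \int[m2]_y g (x, y) = ((fun x => \int[m2]_(y in B) f (x, y)) \_ A) x.
Proof.
rewrite patchE; case: ifPn => xA; last first.
  by rewrite integral0_eq// => y _; rewrite /g patchE in_setX (negbTE xA).
rewrite [RHS]integral_mkcond; apply: eq_integral => y _.
by rewrite /g !patchE in_setX xA.
Qed.

Lemma ge0_measurable_integral_on :
  measurable_fun A (fun x => \int[m2]_(y in B) f (x, y)).
Proof.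
apply/(measurable_restrictT _ _).2 => //.
rewrite (_ : _ \_ _ = fun x => \int[m2]_y g (x, y)); last first.
  by apply/funext => x; rewrite innerE.
exact: measurable_fun_fubini_tonelli_F.
Qed.

Lemma ge0_integral_setX :
  \int[m1 \x m2]_(p in A `*` B) f p = \int[m1]_(x in A) \int[m2]_(y in B) f (x, y).
Proof.
rewrite integral_mkcond fubini_tonelli1// [RHS]integral_mkcond.
by apply: eq_integral => x _; rewrite -innerE.
Qed.

Lemma ge0_integral_exchange :
  \int[m1]_(x in A) \int[m2]_(y in B) f (x, y) =
  \int[m2]_(y in B) \int[m1]_(x in A) f (x, y).
Proof.
rewrite -ge0_integral_setX integral_mkcond fubini_tonelli2// [RHS]integral_mkcond.
apply: eq_integral => y _; rewrite patchE; case: ifPn => yB; last first.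
  by rewrite /fubini_G integral0_eq// => x _; rewrite /g patchE in_setX (negbTE yB) andbF.
rewrite [RHS]integral_mkcond; apply: eq_integral => x _.
by rewrite /g !patchE in_setX yB andbT.
Qed.
End tonelli_on.
Arguments ge0_integral_exchange {d1 d2 T1 T2 R m1 m2 A B f}.
Arguments ge0_integral_setX {d1 d2 T1 T2 R m1 m2 A B f}.
Arguments ge0_measurable_integral_on {d1 d2 T1 T2 R m2 A B f}.

Section half_line.
Variable R : realType.
Notation mu := (@lebesgue_measure R).
Notation pos := (`]0%R, +oo[%classic : set R).
Local Open Scope ereal_scope.

Lemma ge0_integral_dilation_pos (k : R) (f : R -> \bar R) : (0 < k)%R ->
  measurable_fun [set: R] f -> (forall x, (0 < x)%R -> 0 <= f x) ->
  k%:E * \int[mu]_(x in pos) (f (k * x)%R) = \int[mu]_(x in pos) f x.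
Proof.
move=> k0 mf f0; rewrite [RHS]integral_mkcond -(ge0_integral_dilation k0).
- congr *%E; rewrite integral_mkcond; apply: eq_integral => x _.
  by rewrite !patchE !mem_setE !in_itv/= !andbT pmulr_rgt0.
- by apply/(measurable_restrictT _ _).1 => //; exact: measurable_funTS.
- move=> x; rewrite patchE; case: ifPn => //; rewrite inE/= in_itv/= andbT.
  exact: f0.
Qed.

Lemma posE (x : R) : pos x = (0 < x)%R :> Prop.
Proof. by rewrite /= in_itv/= andbT. Qed.

Lemma ge0_integral_dilation_haar (k : R) (g : R -> \bar R) : (0 < k)%R ->
  measurable_fun [set: R] g -> (forall x, 0 <= g x) ->
  \int[mu]_(x in pos) (x^-1%:E * g (k * x)%R) = \int[mu]_(x in pos) (x^-1%:E * g x).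
Proof.
move=> k0 mg g0; rewrite -[RHS](ge0_integral_dilation_pos k0); last 2 first.
- by meas.
- by move=> x x0; rewrite mule_ge0// lee_fin invr_ge0 ltW.
rewrite -ge0_integralZl_EFin//; last 3 first.
- move=> x; rewrite posE => x0.
  by rewrite mule_ge0// lee_fin invr_ge0 mulr_ge0 ?ltW.
- by meas.
- exact: ltW.
apply: eq_integral => x; rewrite inE posE => x0.
by rewrite muleA -EFinM invfM mulrA divff ?lt0r_neq0// ?mul1r.
Qed.

(* Testing both sides against an auxiliary integrable function [h] reduces the
   inversion to dilations. *)
Lemma ge0_integral_inversion (f : R -> \bar R) :
  measurable_fun [set: R] f -> (forall x, 0 <= f x) ->
  \int[mu]_(x in pos) (x^-1%:E * f x^-1%R) =
  \int[mu]_(x in pos) (x^-1%:E * f x).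
Proof.
move=> mf f0.
have mpos : measurable pos by [].
(* The factor x cancels the density 1/x, so that [H] is the length of [1, 2]: positive and finite,
   hence cancellable at the end. *)
pose h (x : R) : \bar R := (x * \1_(`[1%R, 2%R]%classic) x)%:E.
have mh : measurable_fun [set: R] h.
  by apply/measurable_EFinP; apply: measurable_funM => //; exact: measurable_indic.
have h0 x : 0 <= h x.
  rewrite lee_fin indicE mem_setE in_itv/=.
  case: (boolP (1 <= x <= 2)%R) => [/andP[x1 _]|_]; last by rewrite mulr0.
  by rewrite mulr1 (le_trans _ x1).
pose H := \int[mu]_(x in pos) (x^-1%:E * h x).
have Hfin : 0 < H < +oo.
  suff -> : H = 1 by rewrite lte01 ltry.
  transitivity (\int[mu]_(x in pos) (\1_(`[1%R, 2%R]%classic : set R) x)%:E).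
    apply: eq_integral => x; rewrite inE posE => x0.
    by rewrite /h -EFinM mulrA mulVf ?mul1r// gt_eqF.
  rewrite integral_indic// (_ : _ `&` _ = `[1%R, 2%R]%classic); last first.
    apply/setIidPl => x/=; rewrite !in_itv/= andbT => /andP[x1 _].
    exact: lt_le_trans x1.
  apply: etrans (lebesgue_measure_itv _) _.
  by rewrite /= lte_fin ltr1n -EFinD; congr EFin; lra.
pose G (p : R * R) := (p.1^-1 * p.2^-1)%:E * (f (p.1 / p.2)%R * h p.2).
have mG : measurable_fun setT G by rewrite /G; meas.
have G0 x y : pos x -> pos y -> 0 <= G (x, y).
  rewrite !posE => x0 y0; rewrite mule_ge0//; last exact: mule_ge0.
  by rewrite lee_fin mulr_ge0// invr_ge0 ltW.
pose G' (p : R * R) := (p.1^-1 * p.2^-1)%:E * (f p.2^-1%R * h (p.1 * p.2)%R).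
have mG' : measurable_fun setT G' by rewrite /G'; meas.
have G'0 x y : pos x -> pos y -> 0 <= G' (x, y).
  rewrite !posE => x0 y0; rewrite mule_ge0//; last exact: mule_ge0.
  by rewrite lee_fin mulr_ge0// invr_ge0 ltW.
suff: H * \int[mu]_(x in pos) (x^-1%:E * f x^-1%R) =
      H * \int[mu]_(x in pos) (x^-1%:E * f x).
  have [r rE] : exists r, H = r%:E.
    by exists (fine H); rewrite fineK// ge0_fin_numE ?ltW//; case/andP: Hfin => // /ltW.
  have r0 : (0 < r)%R by move: Hfin; rewrite rE lte_fin => /andP[].
  move=> /(congr1 (fun z => r^-1%:E * z)).
  by rewrite !muleA rE -EFinM mulVf ?lt0r_neq0// !mul1e.
(* Against dx dy / (x y), integrating f(1/y) h(x y) in x first splits off [H]. For fixed x the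
   dilation y -> y/x turns this integrand into f(x/y) h(y), and integrating that in x first splits
   off [H] again. *)
transitivity (\int[mu]_(x in pos) \int[mu]_(y in pos) G' (x, y)).
  rewrite (ge0_integral_exchange (m1 := mu) (m2 := mu) mpos mpos mG' G'0) muleC.
  rewrite -ge0_integralZr//; last 3 first.
  - by meas.
  - by move=> x; rewrite posE => x0; rewrite mule_ge0// lee_fin invr_ge0 ltW.
  - by apply: ltW; case/andP: Hfin.
  apply: eq_integral => y; rewrite inE posE => y0.
  rewrite /H -(ge0_integral_dilation_haar y0 mh) // -ge0_integralZl//; last 3 first.
  - by meas.
  - by move=> x; rewrite posE => x0; rewrite mule_ge0// lee_fin invr_ge0 ltW.
  - by rewrite mule_ge0// lee_fin invr_ge0 ltW.
  apply: eq_integral => x _; rewrite /G'/= EFinM (mulrC y) -!muleA [RHS]muleCA.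
  by congr (_ * _); rewrite muleCA.
transitivity (\int[mu]_(x in pos) \int[mu]_(y in pos) G (x, y)).
  apply: eq_integral => x; rewrite inE posE => x0.
  have x0' : (0 < x^-1)%R by rewrite invr_gt0.
  pose g y := x^-1%:E * (f y^-1%R * h (x * y)%R).
  have mg : measurable_fun [set: R] g by rewrite /g; meas.
  have g0 y : 0 <= g y by rewrite mule_ge0// ?mule_ge0// lee_fin ltW.
  transitivity (\int[mu]_(y in pos) (y^-1%:E * g y)).
    by apply: eq_integral => y _; rewrite /G'/g/= EFinM -muleA [LHS]muleCA.
  rewrite -(ge0_integral_dilation_haar x0' mg g0).
  apply: eq_integral => y _; rewrite /G/g/= EFinM -muleA [LHS]muleCA.
  by rewrite mulrA divff ?lt0r_neq0// mul1r invfM invrK.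
rewrite (ge0_integral_exchange (m1 := mu) (m2 := mu) mpos mpos mG G0) -ge0_integralZr//; last 3 first.
- by meas.
- by move=> x; rewrite posE => x0; rewrite mule_ge0// lee_fin invr_ge0 ltW.
- by apply: integral_ge0 => x; rewrite posE => x0; rewrite mule_ge0// lee_fin invr_ge0 ltW.
apply: eq_integral => y; rewrite inE posE => y0.
have y0' : (0 < y^-1)%R by rewrite invr_gt0.
rewrite -(ge0_integral_dilation_haar y0' mf f0) -ge0_integralZl//; last 3 first.
- by meas.
- by move=> x; rewrite posE => x0; rewrite mule_ge0// lee_fin invr_ge0 ltW.
- by rewrite mule_ge0// lee_fin invr_ge0 ltW.
apply: eq_integral => x _; rewrite /G/= EFinM (mulrC x y^-1)%R.
by rewrite muleACA [LHS]muleC.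
Qed.
End half_line.

(** * Planar integrals and the law of the log-ratio *)

Section plane_integrals.
Variable R : realType.
Notation mu := (@lebesgue_measure R).
Notation pos := (`]0%R, +oo[%classic : set R).
Notation plane := (plane R).
Notation dA := (@planar_measure R).
Local Open Scope ereal_scope.

Lemma ge0_planarE (f : plane -> \bar R) :
  measurable_fun setT f -> (forall p, 0 <= f p) ->
  \int[dA]_p f p = \int[mu]_a \int[mu]_b f (a, b).
Proof. by move=> mf f0; exact: (fubini_tonelli1 f mf f0). Qed.

Lemma ge0_planarC (f : plane -> \bar R) :
  measurable_fun setT f -> (forall p, 0 <= f p) ->
  \int[dA]_p f p = \int[mu]_b \int[mu]_a f (a, b).
Proof. by move=> mf f0; exact: (fubini_tonelli2 f mf f0). Qed.

Lemma integral_preimage_restrict d (T : measurableType d)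
    (m : {measure set T -> \bar R}) (phi : T -> T) (A : set T) (f : T -> \bar R) :
  \int[m]_(x in phi @^-1` A) f (phi x) = \int[m]_x (f \_ A) (phi x).
Proof.
rewrite integral_mkcond; apply: eq_integral => x _; rewrite !patchE.
by congr (if _ then _ else _); apply/idP/idP; rewrite !inE.
Qed.

Lemma ge0_planar_translation (a : R) (A : set plane) (f : plane -> \bar R) :
  measurable A -> measurable_fun setT f -> (forall p, A p -> 0 <= f p) ->
  \int[dA]_(p in (fun p : plane => (p.1 + a, p.2)%R) @^-1` A) f (p.1 + a, p.2)%R =
  \int[dA]_(p in A) f p.
Proof.
move=> mA mf f0; rewrite (integral_preimage_restrict _ (fun p : plane => (p.1 + a, p.2)%R)).
rewrite [RHS]integral_mkcond.
have mg : measurable_fun setT (f \_ A).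
  by apply/(measurable_restrictT _ _).1 => //; exact: measurable_funTS.
have g0 p : 0 <= (f \_ A) p.
  by rewrite patchE; case: ifPn => //; rewrite inE; exact: f0.
move: (f \_ A) mg g0 => g mg g0.
rewrite !ge0_planarC//; last by meas.
apply: eq_integral => b _ /=.
by rewrite (ge0_integral_translation a (f := fun x => g (x, b)))//; meas.
Qed.

Lemma ge0_planar_dilation (k : R) (A : set plane) (f : plane -> \bar R) : (0 < k)%R ->
  measurable A -> measurable_fun setT f -> (forall p, A p -> 0 <= f p) ->
  (k ^+ 2)%:E * \int[dA]_(p in (fun p : plane => (k * p.1, k * p.2)%R) @^-1` A) f (k * p.1, k * p.2)%R =
  \int[dA]_(p in A) f p.
Proof.
move=> k0 mA mf f0; rewrite (integral_preimage_restrict _ (fun p : plane => (k * p.1, k * p.2)%R)).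
rewrite [RHS]integral_mkcond.
have mg : measurable_fun setT (f \_ A).
  by apply/(measurable_restrictT _ _).1 => //; exact: measurable_funTS.
have g0 p : 0 <= (f \_ A) p.
  by rewrite patchE; case: ifPn => //; rewrite inE; exact: f0.
move: (f \_ A) mg g0 => g mg g0.
have mgk : measurable_fun setT (fun p : plane => g (k * p.1, k * p.2)%R) by meas.
rewrite (ge0_planarE mgk (fun=> g0 _)) (ge0_planarE mg g0).
rewrite -[RHS](ge0_integral_dilation k0); last 2 first.
- exact: (measurable_fun_fubini_tonelli_F (m2 := mu) g).
- by move=> x; exact: integral_ge0.
rewrite expr2 EFinM -muleA; congr (_ * _).
rewrite -ge0_integralZl_EFin//; last 3 first.
- by move=> x _; exact: integral_ge0.
- exact: (measurable_fun_fubini_tonelli_F (m2 := mu) _ mgk).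
- exact: ltW.
apply: eq_integral => a _ /=.
by rewrite (ge0_integral_dilation k0 (f := fun x => g ((k * a)%R, x)))//; meas.
Qed.

(** The cosine of the angle arctan t of the ray of slope t. *)
Definition slope_cos (t : R) : R := (Num.sqrt (1 + t ^+ 2))^-1.

Lemma slope_cos_gt0 t : (0 < slope_cos t)%R.
Proof. by rewrite invr_gt0 sqrtr_gt0 ltr_pwDl// sqr_ge0. Qed.

Lemma slope_cos_sqr t : (slope_cos t ^+ 2 = (1 + t ^+ 2)^-1)%R.
Proof. by rewrite /slope_cos exprVn sqr_sqrtr// addr_ge0// sqr_ge0. Qed.

(* Polar coordinates on the right half-plane, with the slope [t] of the ray in
   place of its angle: the density is [dt / (1 + t^2)], and only dilations of
   the line are needed. *)
Lemma ge0_integral_polar (f : plane -> \bar R) :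
  measurable_fun setT f -> (forall p, 0 <= f p) ->
  \int[dA]_(p in pos `*` setT) f p =
  \int[mu]_t \int[mu]_(r in pos) ((r / (1 + t ^+ 2))%:E *
    f (r * slope_cos t, r * slope_cos t * t)%R).
Proof.
move=> mf f0.
have mpos : measurable pos by [].
transitivity (\int[mu]_(a in pos) \int[mu]_t (a%:E * f (a, a * t)%R)).
  rewrite (ge0_integral_setX (m1 := mu) (m2 := mu) (A := pos) (B := setT))//.
  apply: eq_integral => a; rewrite inE posE => a0.
  rewrite ge0_integralZl_EFin//; last 2 first.
    by meas.
    exact: ltW.
  by rewrite (ge0_integral_dilation a0 (f := fun x => f (a, x)))//; meas.
pose G (p : R * R) := p.1%:E * f (p.1, p.1 * p.2)%R.
have mG : measurable_fun setT G by rewrite /G; meas.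
rewrite (ge0_integral_exchange (m1 := mu) (m2 := mu) mpos measurableT mG); last first.
  by move=> x y; rewrite posE => x0 _; rewrite mule_ge0// lee_fin ltW.
apply: eq_integral => t _.
rewrite -(ge0_integral_dilation_pos (slope_cos_gt0 t) (f := fun x => G (x, t))); last 2 first.
- by rewrite /G; meas.
- by move=> x x0; rewrite mule_ge0// lee_fin ltW.
rewrite -ge0_integralZl_EFin//; last 3 first.
- move=> x; rewrite posE => x0; rewrite mule_ge0// lee_fin mulr_ge0// ltW//.
  exact: slope_cos_gt0.
- by rewrite /G; meas.
- exact/ltW/slope_cos_gt0.
apply: eq_integral => r _; rewrite /G/= muleA -EFinM mulrA -expr2.
by rewrite slope_cos_sqr (mulrC _ r) [(slope_cos t * r)%R]mulrC.
Qed.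

End plane_integrals.

Section radial_integrals.
Variable R : realType.
Notation mu := (@lebesgue_measure R).
Notation pos := (`]0%R, +oo[%classic : set R).
Notation plane := (plane R).
Notation dA := (@planar_measure R).
Notation right_half := (pos `*` setT : set plane).
Local Open Scope ereal_scope.

Definition rad (p : plane) : R := Num.sqrt (p.1 ^+ 2 + p.2 ^+ 2).

Lemma rad_ge0 p : (0 <= rad p)%R.
Proof. exact: sqrtr_ge0. Qed.

Lemma rad_sqr p : (rad p ^+ 2 = p.1 ^+ 2 + p.2 ^+ 2)%R.
Proof. by rewrite sqr_sqrtr// addr_ge0// sqr_ge0. Qed.

Lemma measurable_rad : measurable_fun setT rad.
Proof. by rewrite /rad; meas. Qed.

Lemma rad_gt0 (p : plane) : (0 < p.1)%R -> (0 < rad p)%R.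
Proof. by move=> p0; rewrite sqrtr_gt0 ltr_wpDr ?sqr_ge0// exprn_gt0. Qed.

Lemma rad_polar r t : (0 < r)%R -> rad (r * slope_cos t, r * slope_cos t * t)%R = r.
Proof.
move=> r0; rewrite /rad/= (_ : _ + _ = r ^+ 2)%R ?sqrtr_sqr ?gtr0_norm//.
rewrite !exprMn slope_cos_sqr; field.
by rewrite gt_eqF// ltr_pwDl// sqr_ge0.
Qed.

Lemma measurable_right_half : measurable right_half.
Proof. exact: measurableX. Qed.

(** On each ray the map is r -> 1/r, which preserves dr/r. The area element r dr = r^2 dr/r becomes
    r^-2 dr/r = r^-4 (r dr), whence the Jacobian. *)
Lemma ge0_integral_planar_inversion (f : plane -> \bar R) :
  measurable_fun setT f -> (forall p, 0 <= f p) ->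
  \int[dA]_(p in right_half) f (p.1 / rad p ^+ 2, p.2 / rad p ^+ 2)%R =
  \int[dA]_(p in right_half) (((rad p ^+ 4)^-1)%:E * f p).
Proof.
move=> mf f0; have mrad := measurable_rad.
have minv : measurable_fun setT
    (fun p : plane => f (p.1 / rad p ^+ 2, p.2 / rad p ^+ 2)%R) by meas.
have mM : measurable_fun setT (fun p : plane => ((rad p ^+ 4)^-1)%:E * f p) by meas.
have M0 p : 0 <= ((rad p ^+ 4)^-1)%:E * f p.
  by rewrite mule_ge0// lee_fin invr_ge0 exprn_ge0// rad_ge0.
rewrite (ge0_integral_polar minv (fun=> f0 _)) (ge0_integral_polar mM M0).
apply: eq_integral => t _.
pose g (x : R) := (x ^- 2 / (1 + t ^+ 2))%:E * f (x * slope_cos t, x * slope_cos t * t)%R.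
have mg : measurable_fun [set: R] g by rewrite /g; meas.
have g0 x : 0 <= g x.
  by rewrite mule_ge0// lee_fin divr_ge0// ?addr_ge0 ?invr_ge0 ?sqr_ge0.
transitivity (\int[mu]_(x in pos) (x^-1%:E * g x^-1%R)).
  apply: eq_integral => x; rewrite inE posE => x0.
  have xn0 : x != 0%R by rewrite gt_eqF.
  rewrite /g muleA -EFinM rad_polar//=; congr (_%:E * f (_, _)).
  - by rewrite exprVn invrK; field; rewrite ?xn0 ?gt_eqF// ltr_pwDl// sqr_ge0.
  - by field.
  - by field.
rewrite (ge0_integral_inversion mg g0); apply: eq_integral => x; rewrite inE posE => x0.
have xn0 : x != 0%R by rewrite gt_eqF.
rewrite /g !muleA -!EFinM rad_polar//=; congr (_%:E * _).
by field; rewrite ?xn0 ?gt_eqF// ltr_pwDl// sqr_ge0.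
Qed.

Lemma ge0_even_integral (f : R -> \bar R) :
  measurable_fun [set: R] f -> (forall x, 0 <= f x) -> (forall x, f (- x)%R = f x) ->
  \int[mu]_x f x = 2%:E * \int[mu]_(x in pos) f x.
Proof.
move=> mf f0 ev.
rewrite -(setUv `[0%R, +oo[%classic) ge0_integral_setU//=; last 3 first.
- exact: measurableC.
- by rewrite setUv.
- exact/disj_setPCl.
rewrite setCitvr mule_natl mule2n integral_itv_obnd_cbnd; last exact: measurable_funTS.
congr +%E; rewrite integral_itv_bndo_bndc; last exact: measurable_funTS.
by rewrite ge0_integration_by_substitution0//; apply: eq_integral => x _; rewrite ev.
Qed.

Lemma integral_slope : \int[mu]_t ((1 + t ^+ 2)^-1)%:E = pi%:E :> \bar R.
Proof.
rewrite ge0_even_integral; first last.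
- by move=> x; rewrite sqrrN.
- by move=> x; rewrite lee_fin invr_ge0 addr_ge0// sqr_ge0.
- by meas.
rewrite integral_itv_obnd_cbnd; last by meas.
by rewrite (integral0y_oneDsqr R) -EFinM; congr EFin; field.
Qed.

Lemma ge0_integral_radial (f : R -> \bar R) :
  measurable_fun [set: R] f -> (forall x, 0 <= f x) ->
  \int[dA]_p f (rad p) = (2 * pi)%:E * \int[mu]_(r in pos) (r%:E * f r).
Proof.
move=> mf f0; have mrad := measurable_rad.
have mg : measurable_fun setT (fun p : plane => f (rad p)) by meas.
have g0 (p : plane) : 0 <= f (rad p) by [].
rewrite (ge0_planarE mg g0) ge0_even_integral; first last.
- by move=> x; apply: eq_integral => y _; rewrite /rad/= sqrrN.
- by move=> x; exact: integral_ge0.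
- exact: (measurable_fun_fubini_tonelli_F (m2 := mu) _ mg).
have -> : \int[mu]_(a in pos) \int[mu]_b f (rad (a, b)) =
    \int[dA]_(p in right_half) f (rad p).
  by rewrite (ge0_integral_setX (m1 := mu) (m2 := mu)).
rewrite (ge0_integral_polar mg g0) EFinM -muleA; congr (_ * _).
rewrite -integral_slope -ge0_integralZr//; last 3 first.
- by meas.
- by move=> t _; rewrite lee_fin invr_ge0 addr_ge0// sqr_ge0.
- by apply: integral_ge0 => r; rewrite posE => r0; rewrite mule_ge0// lee_fin ltW.
apply: eq_integral => t _; rewrite -ge0_integralZl//; last 3 first.
- by meas.
- by move=> r; rewrite posE => r0; rewrite mule_ge0// lee_fin ltW.
- by rewrite lee_fin invr_ge0 addr_ge0// sqr_ge0.
apply: eq_integral => r; rewrite inE posE => r0.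
by rewrite rad_polar// muleA -EFinM mulrC.
Qed.

Lemma unit_discE : @unit_disc R = [set p | (rad p < 1)%R].
Proof. by []. Qed.

Lemma measurable_unit_disc : measurable (@unit_disc R).
Proof.
rewrite unit_discE -[X in measurable X]setTI; apply: measurable_fun_ltr => //.
exact: measurable_rad.
Qed.

Lemma ge0_integral_disc_radial (f : R -> \bar R) :
  measurable_fun [set: R] f -> (forall x, 0 <= f x) ->
  \int[dA]_(p in @unit_disc R) f (rad p) =
  (2 * pi)%:E * \int[mu]_(r in `]0%R, 1%R[) (r%:E * f r).
Proof.
move=> mf f0.
pose g := f \_ (`]-oo, 1%R[%classic : set R).
have mg : measurable_fun [set: R] g.
  by apply/(measurable_restrictT _ _).1 => //; exact: measurable_funTS.
have g0 x : 0 <= g x by rewrite /g patchE; case: ifPn.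
transitivity (\int[dA]_p g (rad p)).
  rewrite integral_mkcond; apply: eq_integral => p _; rewrite !patchE.
  by congr (if _ then _ else _); apply/idP/idP; rewrite !inE/= in_itv.
rewrite ge0_integral_radial//; congr (_ * _).
rewrite [LHS]integral_mkcond [RHS]integral_mkcond; apply: eq_integral => r _.
rewrite !patchE !mem_setE !in_itv/= andbT.
case: (ltP 0%R r) => //= r0; rewrite /g patchE mem_setE in_itv/=.
by case: ifPn => // _; rewrite mule0.
Qed.

Lemma integral_id01 : \int[mu]_(r in `]0%R, 1%R[) (r%:E) = (2^-1)%:E :> \bar R.
Proof.
rewrite integral_itv_bndo_bndc; last by meas.
rewrite integral_itv_obnd_cbnd; last by meas.
rewrite (@continuous_FTC2 _ id (fun x => x ^+ 2 / 2)%R)//.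
- by rewrite -EFinD expr1n expr0n/= mul0r subr0 mul1r.
- by apply: continuous_subspaceT => x; exact: cvg_id.
- split.
  + by move=> x _; exact: ex_derive.
  + apply: cvg_at_right_filter; apply: cvgM; last exact: cvg_cst.
    exact: exprn_continuous.
  + apply: cvg_at_left_filter; apply: cvgM; last exact: cvg_cst.
    exact: exprn_continuous.
- move=> x _; rewrite derive1E.
  rewrite derive_val !scaler0 add0r /GRing.scale/=.
  by field.
Qed.

Lemma planar_measure_unit_disc : dA (@unit_disc R) = pi%:E.
Proof.
have := ge0_integral_disc_radial (measurable_cst (1 : \bar R)) (fun=> lee01).
rewrite integral_cst ?mul1e; last exact: measurable_unit_disc.
move=> ->; under eq_integral do rewrite mule1.
by rewrite integral_id01 -EFinM; congr EFin; field.
Qed.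

Lemma rad_scale k (p : plane) : (0 <= k)%R -> rad (k * p.1, k * p.2)%R = (k * rad p)%R.
Proof.
move=> k0; rewrite /rad/= !exprMn -mulrDr sqrtrM ?sqr_ge0//.
by rewrite sqrtr_sqr ger0_norm.
Qed.

(** This is w -> 1 / conj w; the conjugation is harmless because only moduli and sets symmetric
    about the real axis occur. *)
Definition inversion (p : plane) : plane := (p.1 / rad p ^+ 2, p.2 / rad p ^+ 2)%R.

Lemma rad_inversion p : (0 < p.1)%R -> rad (inversion p) = (rad p)^-1%R.
Proof.
move=> p0; have r0 := rad_gt0 p0; have rn0 : rad p != 0%R by rewrite gt_eqF.
rewrite /inversion ![(_ / _)%R]mulrC rad_scale ?invr_ge0 ?exprn_ge0 ?ltW//.
by field.
Qed.

Lemma inversionK p : (0 < p.1)%R -> inversion (inversion p) = p.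
Proof.
move=> p0; have rn0 : rad p != 0%R by rewrite gt_eqF// rad_gt0.
rewrite {1}/inversion rad_inversion//= [RHS]surjective_pairing.
by congr (_, _); field.
Qed.

(** The circle |w - 1| = 1 passes through 0, so inversion straightens it into the line Re w =
    1/2. *)
Lemma rad_inversion_subr1 p : (0 < p.1)%R ->
  (rad ((inversion p).1 - 1, (inversion p).2) < 1)%R = (1 < 2 * p.1)%R.
Proof.
move=> p0; have rn0 : rad p != 0%R by rewrite gt_eqF// rad_gt0.
rewrite -[LHS](@expr_lt1 _ 2)// ?rad_ge0// rad_sqr/=.
have -> : ((p.1 / rad p ^+ 2 - 1) ^+ 2 + (p.2 / rad p ^+ 2) ^+ 2 =
    1 + (1 - 2 * p.1) / rad p ^+ 2)%R.
  have := rad_sqr p; set s := rad p => sE.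
  have -> : ((p.2 / s ^+ 2) ^+ 2 = (s ^+ 2 - p.1 ^+ 2) / s ^+ 4)%R.
    by rewrite exprMn (_ : p.2 ^+ 2 = s ^+ 2 - p.1 ^+ 2)%R; [field|rewrite sE; ring].
  by field.
by rewrite gtrDl pmulr_llt0 ?subr_lt0// invr_gt0 exprn_gt0// rad_gt0.
Qed.

Lemma rad_inversion_subr2 p : (0 < p.1)%R ->
  rad (2 - (inversion p).1, (inversion p).2)%R = (rad (2 * p.1 - 1, 2 * p.2) / rad p)%R.
Proof.
move=> p0; have r0 := rad_gt0 p0; have rn0 : rad p != 0%R by rewrite gt_eqF.
apply/eqP; rewrite -(@eqrXn2 _ 2)// ?divr_ge0 ?rad_ge0//; apply/eqP.
rewrite exprMn exprVn !(rad_sqr (_, _))/=.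
have := rad_sqr p; set s := rad p => sE.
have -> : ((p.2 / s ^+ 2) ^+ 2 = (s ^+ 2 - p.1 ^+ 2) / s ^+ 4)%R.
  by rewrite exprMn (_ : p.2 ^+ 2 = s ^+ 2 - p.1 ^+ 2)%R; [field|rewrite sE; ring].
have -> : ((2 * p.2) ^+ 2 = 4 * (s ^+ 2 - p.1 ^+ 2))%R by rewrite sE; ring.
by rewrite -sE; field.
Qed.

(** Put w = 1 + x, v = 1 / conj w and q = 2 v - 1. Then |1 - x| / |1 + x| = |2 - w| / |w| = |q|, and
    q runs over the right half-plane. The area becomes |v|^-4 dA(v) = 4 |q + 1|^-4 dA(q), and |q +
    1|^2 = 1 + 2 c r + r^2 in polar coordinates, with c the cosine of the ray. *)
Lemma ge0_integral_log_ratio (f : R -> \bar R) :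
  measurable_fun [set: R] f -> (forall x, 0 <= f x) ->
  \int[dA]_(p in @unit_disc R)
    f (ln (rad (1 - p.1, p.2)) - ln (rad (1 + p.1, p.2)))%R =
  \int[mu]_t \int[mu]_(r in pos)
    ((4 * r / (1 + t ^+ 2) / (1 + 2 * slope_cos t * r + r ^+ 2) ^+ 2)%:E * f (ln r)).
Proof.
move=> mf f0; have mrad := measurable_rad; have mR := measurable_right_half.
pose A : set plane := [set p | (rad (p.1 - 1, p.2) < 1)%R].
have mA : measurable A.
  rewrite /A -[X in measurable X]setTI; apply: measurable_fun_ltr => //; meas.
pose F1 (p : plane) := f (ln (rad (2 - p.1, p.2)) - ln (rad p))%R.
have mF1 : measurable_fun setT F1 by rewrite /F1; meas.
transitivity (\int[dA]_(p in A) F1 p).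
  rewrite -(ge0_planar_translation 1 mA mF1); last by move=> p _; exact: f0.
  have -> : (fun p : plane => (p.1 + 1, p.2)%R) @^-1` A = @unit_disc R.
    by rewrite unit_discE; apply/seteqP; split=> p; rewrite /A/= addrK; case: p.
  apply: eq_integral => p _; rewrite /F1/=; congr (f (ln (rad (_, _)) - ln (rad (_, _)))%R).
    by ring.
  by rewrite addrC.
have HE p : right_half p = (0 < p.1)%R :> Prop.
  by apply/propext; rewrite /= in_itv/= andbT; split => [[]|].
have AH p : A p -> (0 < p.1)%R.
  rewrite /A/= -(@expr_lt1 _ 2)// ?rad_ge0// rad_sqr/=.
  have := sqr_ge0 p.1; have := sqr_ge0 p.2; rewrite !expr2 => ? ? ?; nra.
(* Since inversion is an involution on the half-plane, F1 is F2 composed with it, which is the form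
   that [ge0_integral_planar_inversion] transforms. *)
pose F2 (p : plane) := (F1 \_ A) (inversion p).
have mF1A : measurable_fun setT (F1 \_ A).
  by apply/(measurable_restrictT _ _).1 => //; exact: measurable_funTS.
have F1A0 p : 0 <= (F1 \_ A) p by rewrite patchE; case: ifPn => // _; exact: f0.
have mF2 : measurable_fun setT F2 by rewrite /F2 /inversion; meas.
pose B : set plane := [set p | (1 < 2 * p.1)%R].
have mB : measurable B.
  rewrite /B -[X in measurable X]setTI; apply: measurable_fun_ltr => //; meas.
(* Here p stands for q = 2 v - 1, so |v|^-4 = 16 |q + 1|^-4; the dilation by 2 later divides the
   constant by 4. *)
pose F3 (p : plane) := (16 * (rad (p.1 + 1, p.2) ^+ 4)^-1)%:E * f (ln (rad p)).
have mF3 : measurable_fun setT F3 by rewrite /F3; meas.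
have F30 p : 0 <= F3 p.
  by rewrite mule_ge0// lee_fin mulr_ge0// invr_ge0 exprn_ge0// rad_ge0.
pose F4 (p : plane) := F3 (p.1 - 1, p.2)%R.
have mF4 : measurable_fun setT F4 by rewrite /F4; meas.
transitivity (\int[dA]_(p in B) F4 (2 * p.1, 2 * p.2)%R).
  transitivity (\int[dA]_(p in right_half) (F1 \_ A) p).
    rewrite [LHS]integral_mkcond [RHS]integral_mkcond; apply: eq_integral => p _.
    rewrite !patchE; case: ifPn => [|pA]; rewrite ?if_same// inE => pA.
    by rewrite mem_set// HE; exact: AH.
  transitivity (\int[dA]_(p in right_half) F2 (inversion p)).
    by apply: eq_integral => p; rewrite inE HE => p0; rewrite /F2 inversionK.
  rewrite (ge0_integral_planar_inversion mF2) => [|p]; last exact: F1A0.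
  rewrite [LHS]integral_mkcond [RHS]integral_mkcond; apply: eq_integral => p _.
  rewrite [LHS]patchE [RHS]patchE.
  have BE : (0 < p.1)%R -> (inversion p \in A) = (p \in B).
    by move=> p0; apply/idP/idP; rewrite !inE /A/B/= rad_inversion_subr1.
  case: (pselect (right_half p)) => [pH|pNH]; last first.
    rewrite memNset// ifF//; apply/negP; rewrite inE /B/= => p1.
    by apply: pNH; rewrite HE; lra.
  have p0 : (0 < p.1)%R by rewrite -HE.
  rewrite (mem_set pH).
  rewrite /F2 patchE BE//; case: ifPn; rewrite ?mule0// inE /B/= => p1.
  rewrite /F4 /F3 /F1/= subrK; congr (_%:E * f _).
    by rewrite rad_scale// exprMn; field; rewrite gt_eqF// rad_gt0.
  have r0 := rad_gt0 p0.
  rewrite rad_inversion// rad_inversion_subr2// ln_div ?posrE ?lnV ?posrE//; last first.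
    by rewrite rad_gt0//= subr_gt0.
  by rewrite opprK subrK.
have q0 : (0 < 2 :> R)%R by [].
pose C : set plane := [set p | (0 < p.1 - 1)%R].
have mC : measurable C.
  rewrite /C -[X in measurable X]setTI; apply: measurable_fun_ltr => //; meas.
have := ge0_planar_dilation q0 mC mF4 (fun _ _ => F30 _).
rewrite (_ : _ @^-1` C = B); last first.
  by apply/seteqP; split=> p; rewrite /C /B/= subr_gt0.
have := ge0_planar_translation (- 1) mR mF3 (fun _ _ => F30 _).
rewrite (_ : _ @^-1` right_half = C); last first.
  by apply/seteqP; split=> p; rewrite /C/= in_itv/= andbT => // -[].
move=> -> /(congr1 (fun z => (4^-1)%:E * z)); rewrite muleA -EFinM.
have -> : (4^-1 * 2 ^+ 2 = 1 :> R)%R by field.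
rewrite mul1e => ->.
rewrite (ge0_integral_polar mF3 F30) -ge0_integralZl//; last 2 first.
- pose G (p : R * R) := (p.2 / (1 + p.1 ^+ 2))%:E *
    F3 (p.2 * slope_cos p.1, p.2 * slope_cos p.1 * p.1)%R.
  apply: (ge0_measurable_integral_on (m2 := mu) (A := setT) (B := pos) (f := G)) => //.
    by rewrite /G /slope_cos; meas.
  move=> t r _; rewrite posE => r0.
  by rewrite mule_ge0// lee_fin divr_ge0 ?(ltW r0)// addr_ge0 ?sqr_ge0.
- move=> t _; apply: integral_ge0 => r; rewrite posE => r0.
  by rewrite mule_ge0// lee_fin divr_ge0 ?(ltW r0)// addr_ge0 ?sqr_ge0.
apply: eq_integral => t _; rewrite -ge0_integralZl//; last 2 first.
- rewrite /F3; meas.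
- move=> r; rewrite posE => r0.
  by rewrite mule_ge0// lee_fin divr_ge0 ?(ltW r0)// addr_ge0 ?sqr_ge0.
apply: eq_integral => r; rewrite inE posE => r0.
rewrite /F3 !muleA -!EFinM rad_polar//; congr (_%:E * _).
rewrite -[(rad _ ^+ 4)%R]/(rad _ ^+ (2 * 2))%R exprM rad_sqr/=.
have -> : ((r * slope_cos t + 1) ^+ 2 + (r * slope_cos t * t) ^+ 2 =
    1 + 2 * slope_cos t * r + r ^+ 2)%R.
  have c2 : (slope_cos t ^+ 2 * (1 + t ^+ 2) = 1)%R.
    by rewrite slope_cos_sqr mulVf// gt_eqF// ltr_pwDl// sqr_ge0.
  transitivity (r ^+ 2 * (slope_cos t ^+ 2 * (1 + t ^+ 2)) + 2 * slope_cos t * r + 1)%R.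
    by ring.
  by rewrite c2; ring.
have c0 := slope_cos_gt0 t.
have : (1 + 2 * slope_cos t * r + r ^+ 2 != 0)%R.
  by rewrite gt_eqF// addr_gt0 ?exprn_gt0// addr_gt0// !mulr_gt0.
have : (1 + t ^+ 2 != 0)%R by rewrite gt_eqF// ltr_pwDl// sqr_ge0.
set D := (1 + t ^+ 2)%R; set E := (_ + r ^+ 2)%R => D0 E0.
by field; rewrite D0 E0.
Qed.

End radial_integrals.

(** * Positive definiteness of the ratio kernels *)

Section gamma_kernel.
Variable R : realType.
Notation mu := (@lebesgue_measure R).
Notation pos := (`]0%R, +oo[%classic : set R).
Local Open Scope ereal_scope.

Let mpos : measurable pos. Proof. by []. Qed.

Lemma integral_RintegralE d (T : measurableType d) (m : {measure set T -> \bar R})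
    (D : set T) (f : T -> R) : measurable D -> m.-integrable D (EFin \o f) ->
  \int[m]_(x in D) (f x)%:E = (\int[m]_(x in D) f x)%:E.
Proof. by move=> mD fi; rewrite fineK//; exact: integrable_fin_num. Qed.

Lemma integral_expRN : \int[mu]_(x in pos) (expR (- x))%:E = 1 :> \bar R.
Proof.
rewrite integral_itv_obnd_cbnd; last by meas.
rewrite -(@integral_exponential_pdf R 1)// integral_mkcond.
apply: eq_integral => x _; rewrite /exponential_pdf !patchE.
by case: ifPn => // _; rewrite mul1r mulN1r.
Qed.

(** Unnormalised density of the Gamma law of shape j + 1. *)
Definition gamma_weight j (x : R) : R := x ^+ j * expR (- x).

Lemma measurable_gamma_weight j : measurable_fun [set: R] (gamma_weight j).
Proof. by rewrite /gamma_weight; meas. Qed.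

Lemma gamma_weight_ge0 j x : pos x -> (0 <= gamma_weight j x)%R.
Proof.
by rewrite posE => x0; rewrite mulr_ge0 ?expR_ge0// exprn_ge0// ltW.
Qed.

(** The single term (x/2)^j / j! of the exponential series is at most exp(x/2), which leaves the
    integrable factor exp(-x/2). *)
Lemma gamma_weight_le j x : (0 < x)%R ->
  (gamma_weight j x <= (j`!%:R * 2 ^+ j) * expR (- (2^-1 * x)))%R.
Proof.
move=> x0; have x20 : (0 <= 2^-1 * x)%R by rewrite mulr_ge0// ltW.
have H : ((2^-1 * x) ^+ j <= j`!%:R * expR (2^-1 * x))%R.
  case: j => [|j]; first by rewrite expr0 fact0 mul1r (le_trans _ (expR_ge1Dx _))// lerDl.
  rewrite [leRHS]mulrC -ler_pdivrMr ?ltr0n ?fact_gt0//.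
  by apply: le_trans (expR_ge1Dxn j x20); rewrite lerDr.
have -> : gamma_weight j x = (2 ^+ j * ((2^-1 * x) ^+ j * expR (- x)))%R.
  by rewrite /gamma_weight exprMn !mulrA -exprMn divff// expr1n mul1r.
rewrite [leRHS]mulrAC [leRHS]mulrC ler_wpM2l// ?exprn_ge0//.
have -> : (- (2^-1 * x) = 2^-1 * x - x)%R by field.
by rewrite expRD mulrA ler_wpM2r// expR_ge0.
Qed.

Lemma integrable_gamma_weight j : mu.-integrable pos (EFin \o gamma_weight j).
Proof.
pose M : R := (j`!%:R * 2 ^+ j)%R.
have M0 : (0 <= M)%R by rewrite mulr_ge0// exprn_ge0.
have mg := measurable_gamma_weight j.
apply/integrableP; split; first by apply: measurable_funTS; exact: meas_EFin.
apply: (@le_lt_trans _ _ (\int[mu]_(x in pos) (M%:E * (expR (- (2^-1 * x)))%:E))).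
  apply: ge0_le_integral => //.
  - by apply: measurable_funTS; apply: meas_abse; exact: meas_EFin.
  - by meas.
  - move=> x xp /=; rewrite -EFinM lee_fin ger0_norm ?gamma_weight_ge0//.
    by apply: gamma_weight_le; rewrite -posE.
rewrite ge0_integralZl//; last by meas.
have i20 : (0 < 2^-1 :> R)%R by rewrite invr_gt0.
have H : (2^-1)%:E * \int[mu]_(x in pos) (expR (- (2^-1 * x)))%:E = 1.
  rewrite -integral_expRN -[RHS](ge0_integral_dilation_pos i20)//; by meas.
have -> : \int[mu]_(x in pos) (expR (- (2^-1 * x)))%:E = 2%:E.
  have /(congr1 (fun z => 2%:E * z)) := H.
  by rewrite mule1 muleA -EFinM divff// mul1e.
by rewrite -EFinM ltry.
Qed.

Definition gamma_mass j : R := \int[mu]_(x in pos) gamma_weight j x.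

Lemma gamma_massE j : \int[mu]_(x in pos) (gamma_weight j x)%:E = (gamma_mass j)%:E.
Proof. exact: integral_RintegralE (integrable_gamma_weight j). Qed.

Lemma gamma_mass_gt0 j : (0 < gamma_mass j)%R.
Proof.
rewrite -lte_fin -gamma_massE.
apply: (@lt_le_trans _ _ (\int[mu]_(x in `[1%R, 2%R]) (expR (- 2))%:E)).
  rewrite integral_cst//= lebesgue_measure_itv/= lte_fin ltr1n -EFinD -EFinM lte_fin.
  by rewrite mulr_gt0 ?expR_gt0//; lra.
apply: (@le_trans _ _ (\int[mu]_(x in `[1%R, 2%R]) (gamma_weight j x)%:E)).
  apply: ge0_le_integral => //.
  - by apply: measurable_funTS; apply: meas_EFin; exact: measurable_gamma_weight.
  - move=> x/=; rewrite in_itv/= => /andP[x1 x2]; rewrite lee_fin.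
    rewrite -[leLHS]mul1r ler_pM ?expR_ge0 ?exprn_ege1//.
    by rewrite ler_expR lerN2.
apply: ge0_subset_integral => //.
- by apply: measurable_funTS; apply: meas_EFin; exact: measurable_gamma_weight.
- by move=> x xp; rewrite lee_fin gamma_weight_ge0.
- by move=> x/=; rewrite !in_itv/= andbT => /andP[x1 _]; exact: lt_le_trans x1.
Qed.

(* The law of the logarithm of the ratio of two independent Gamma variables. *)
Lemma gamma_ratio j (h : R -> \bar R) :
  measurable_fun [set: R] h -> (forall x, 0 <= h x) ->
  \int[mu]_(s in pos) \int[mu]_(x in pos)
    ((gamma_weight j x * gamma_weight j s)%:E * h (ln x - ln s)%R) =
  (gamma_mass (2 * j).+1)%:E *
    \int[mu]_(r in pos) ((r ^+ j / (1 + r) ^+ (2 * j).+2)%:E * h (ln r)).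
Proof.
move=> mh h0; have mg := measurable_gamma_weight.
pose G (p : R * R) := (p.1 * (gamma_weight j (p.1 * p.2) * gamma_weight j p.1))%:E * h (ln p.2).
have mG : measurable_fun setT G.
  rewrite /G; apply: meas_mule; last by meas.
  by rewrite /gamma_weight; meas.
have G0 s r : pos s -> pos r -> 0 <= G (s, r).
  move=> ps pr; move: (ps) (pr); rewrite !posE => s0 r0.
  rewrite mule_ge0// lee_fin mulr_ge0 ?(ltW s0)// mulr_ge0 ?gamma_weight_ge0//.
  by rewrite posE mulr_gt0.
transitivity (\int[mu]_(s in pos) \int[mu]_(r in pos) G (s, r)).
  apply: eq_integral => s; rewrite inE => ps; move: (ps); rewrite posE => s0.
  rewrite -(ge0_integral_dilation_pos s0 (f := fun x =>
    (gamma_weight j x * gamma_weight j s)%:E * h (ln x - ln s)%R)); last 2 first.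
  - by rewrite /gamma_weight; meas.
  - by move=> x x0; rewrite mule_ge0// lee_fin mulr_ge0 ?gamma_weight_ge0// posE.
  rewrite -ge0_integralZl_EFin//; last 3 first.
  - move=> x; rewrite posE => x0.
    by rewrite mule_ge0// lee_fin mulr_ge0 ?gamma_weight_ge0// posE mulr_gt0.
  - by rewrite /gamma_weight; meas.
  - exact: ltW.
  apply: eq_integral => r; rewrite inE posE => r0.
  by rewrite /G/= muleA -EFinM lnM ?posrE// [(ln s + _)%R]addrC addrK.
rewrite (ge0_integral_exchange (m1 := mu) (m2 := mu) mpos mpos mG G0).
rewrite -ge0_integralZl_EFin//; last 3 first.
- move=> r; rewrite posE => r0; rewrite mule_ge0// lee_fin divr_ge0// exprn_ge0//.
    exact: ltW.
  by rewrite addr_ge0// ltW.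
- by meas.
- exact/ltW/gamma_mass_gt0.
apply: eq_integral => r; rewrite inE posE => r0.
have r10 : (0 < 1 + r)%R by rewrite addr_gt0.
(* With x = r s and the Jacobian s, the product of the two weights is r^j s^(2j+1) exp(-(1 + r) s),
   a Gamma weight of index 2j + 1 in (1 + r) s. *)
rewrite /G/=; transitivity (\int[mu]_(s in pos)
   ((r ^+ j / (1 + r) ^+ (2 * j).+1)%:E * h (ln r) * (gamma_weight (2 * j).+1 ((1 + r) * s))%:E)).
  apply: eq_integral => s; rewrite inE posE => s0; rewrite muleAC; congr (_ * _).
  rewrite -EFinM /gamma_weight; congr EFin.
  have -> : (- ((1 + r) * s) = - (s * r) + - s)%R by ring.
  rewrite expRD !exprMn mulnC muln2 -addnn !exprS !exprD.
  by field; rewrite ?gt_eqF// ?exprn_gt0.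
rewrite ge0_integralZl//; last 3 first.
- by rewrite /gamma_weight; meas.
- by move=> s; rewrite posE => s0; rewrite lee_fin gamma_weight_ge0// posE mulr_gt0.
- by rewrite mule_ge0// lee_fin divr_ge0 ?exprn_ge0 ?(ltW r0) ?(ltW r10).
have -> : \int[mu]_(s in pos) (gamma_weight (2 * j).+1 ((1 + r) * s))%:E =
    (gamma_mass (2 * j).+1 / (1 + r))%:E.
  have mg2 := mg (2 * j).+1.
  have : (1 + r)%:E * \int[mu]_(s in pos) (gamma_weight (2 * j).+1 ((1 + r) * s))%:E =
      (gamma_mass (2 * j).+1)%:E.
    rewrite -gamma_massE -[RHS](ge0_integral_dilation_pos r10)//; first by meas.
    by move=> x x0; rewrite lee_fin gamma_weight_ge0// posE.
  move=> /(congr1 (fun z => (1 + r)^-1%:E * z)).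
  by rewrite muleA -!EFinM mulVf ?gt_eqF// mul1e mulrC.
rewrite muleAC -EFinM [RHS]muleA -EFinM; congr (_%:E * _).
by rewrite [in RHS](exprS _ (2 * j).+1); field; rewrite !gt_eqF ?exprn_gt0.
Qed.

End gamma_kernel.

Section positive_definiteness.
Variable R : realType.
Notation mu := (@lebesgue_measure R).
Notation pos := (`]0%R, +oo[%classic : set R).
Local Open Scope ereal_scope.

Let mpos : measurable pos. Proof. by []. Qed.

Lemma integral_lin3 d (T : measurableType d) (m : {measure set T -> \bar R})
    (D : set T) (f1 f2 f3 : T -> R) (a b c : R) : measurable D ->
  m.-integrable D (EFin \o f1) -> m.-integrable D (EFin \o f2) ->
  m.-integrable D (EFin \o f3) ->
  \int[m]_(x in D) (a * f1 x + b * f2 x + c * f3 x)%:E =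
  (a * \int[m]_(x in D) f1 x + b * \int[m]_(x in D) f2 x + c * \int[m]_(x in D) f3 x)%:E.
Proof.
move=> mD i1 i2 i3.
have j1 : m.-integrable D (EFin \o (fun x => a * f1 x)%R) := integrableZl mD a i1.
have j2 : m.-integrable D (EFin \o (fun x => b * f2 x)%R) := integrableZl mD b i2.
have j3 : m.-integrable D (EFin \o (fun x => c * f3 x)%R) := integrableZl mD c i3.
have j12 : m.-integrable D (EFin \o (fun x => a * f1 x + b * f2 x)%R) := integrableD mD j1 j2.
have j : m.-integrable D (EFin \o (fun x => a * f1 x + b * f2 x + c * f3 x)%R) := integrableD mD j12 j3.
by rewrite integral_RintegralE// !RintegralD// !RintegralZl.
Qed.

Lemma integrable_norm_le d (T : measurableType d) (m : {measure set T -> \bar R})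
    (D : set T) (f g : T -> R) : measurable D -> measurable_fun D f ->
  (forall x, D x -> `|f x| <= `|g x|)%R ->
  m.-integrable D (EFin \o g) -> m.-integrable D (EFin \o f).
Proof.
move=> mD mf fg; apply: (le_integrable mD); first exact/measurable_EFinP.
by move=> x Dx; rewrite /= lee_fin fg.
Qed.

(** Working with 1 + cos instead of cos keeps all integrands nonnegative, so that exchanges of
    integrals and termwise summation hold in the extended reals without integrability conditions. *)
Lemma onecos_ge0 (x : R) : 0 <= (1 + cos x)%:E.
Proof. by rewrite lee_fin -lerBlDl sub0r cos_geN1. Qed.

(* The difference of the two sides is the squared modulus of the Mellin
   transform of the Gamma weight. *)
Lemma gamma_ratio_pd j t :
  \int[mu]_(r in pos) (r ^+ j / (1 + r) ^+ (2 * j).+2)%:E <=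
  \int[mu]_(r in pos) ((r ^+ j / (1 + r) ^+ (2 * j).+2)%:E * (1 + cos (t * ln r))%:E).
Proof.
have C0 := gamma_mass_gt0 R (2 * j).+1.
have mh : measurable_fun [set: R] (fun x : R => (1 + cos (t * x))%:E) by meas.
have := gamma_ratio j mh (fun x => onecos_ge0 (t * x)).
have := gamma_ratio j (measurable_cst (1 : \bar R)) (fun=> lee01).
under [X in _ = _ * X]eq_integral do rewrite mule1.
rewrite -(@lee_pmul2l _ (gamma_mass R (2 * j).+1)%:E)// => <- <-.
set g := @gamma_weight R j.
have mg : measurable_fun [set: R] g by exact: measurable_gamma_weight.
have gi : mu.-integrable pos (EFin \o g) by exact: integrable_gamma_weight.
have ci : mu.-integrable pos (EFin \o (fun x => cos (t * ln x) * g x)%R).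
  apply: integrable_norm_le gi => //; first by meas.
  by move=> x _; rewrite normrM ler_piMl// cos_max.
have si : mu.-integrable pos (EFin \o (fun x => sin (t * ln x) * g x)%R).
  apply: integrable_norm_le gi => //; first by meas.
  by move=> x _; rewrite normrM ler_piMl// sin_max.
pose G := (\int[mu]_(x in pos) g x)%R.
pose Gc := (\int[mu]_(x in pos) (cos (t * ln x) * g x))%R.
pose Gs := (\int[mu]_(x in pos) (sin (t * ln x) * g x))%R.
have -> : \int[mu]_(s in pos) \int[mu]_(x in pos) ((g x * g s)%:E * cst 1 (ln x - ln s)%R) =
    (G ^+ 2)%:E.
  transitivity (\int[mu]_(s in pos) (G * g s + 0 * g s + 0 * g s)%:E).
    apply: eq_integral => s _.
    transitivity (\int[mu]_(x in pos) (g s * g x + 0 * g x + 0 * g x)%:E).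
      by apply: eq_integral => x _; rewrite mule1; congr EFin; ring.
    by rewrite integral_lin3//; congr EFin; rewrite /G; ring.
  by rewrite integral_lin3//; congr EFin; rewrite /G; ring.
have -> : \int[mu]_(s in pos) \int[mu]_(x in pos)
      ((g x * g s)%:E * (1 + cos (t * (ln x - ln s)))%:E) =
    (G ^+ 2 + Gc ^+ 2 + Gs ^+ 2)%:E.
  transitivity (\int[mu]_(s in pos)
      (G * g s + Gc * (cos (t * ln s) * g s) + Gs * (sin (t * ln s) * g s))%:E).
    apply: eq_integral => s _.
    transitivity (\int[mu]_(x in pos)
      (g s * g x + (g s * cos (t * ln s)) * (cos (t * ln x) * g x)
       + (g s * sin (t * ln s)) * (sin (t * ln x) * g x))%:E).
      by apply: eq_integral => x _; rewrite -EFinM mulrBr cosB; congr EFin; ring.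
    by rewrite integral_lin3//; congr EFin; rewrite /G /Gc /Gs; ring.
  by rewrite integral_lin3//; congr EFin; rewrite /G /Gc /Gs; ring.
by rewrite lee_fin -addrA lerDl addr_ge0// sqr_ge0.
Qed.

Lemma nneseries_sqr_geometric (x : R) : (0 <= x <= 2^-1)%R ->
  \sum_(0 <= k <oo) (k.+1%:R * x ^+ k)%:E = ((1 - x) ^- 2)%:E.
Proof.
move=> /andP[x0 x2].
have x1 : (1 - x != 0)%R by rewrite subr_eq0; apply/eqP; lra.
have sE n : (\sum_(0 <= k < n) (k.+1%:R * x ^+ k) =
    (1 - (n.+1%:R * x ^+ n - n%:R * x ^+ n.+1)) / (1 - x) ^+ 2)%R.
  elim: n => [|n IHn].
    by rewrite big_geq// expr0 mul1r mul0r subr0 subrr mul0r.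
  rewrite big_nat_recr//= IHn -!natr1 !exprS; field; exact: x1.
(* Bernoulli's inequality gives n <= 2 (3/2)^n, so for x <= 1/2 the term n x^n is dominated by 2
   (3/4)^n and tends to 0. *)
have bern n : (1 + 2^-1 * n%:R <= (3 / 2) ^+ n :> R)%R.
  elim: n => [|n IHn]; first by rewrite mulr0 addr0 expr0.
  rewrite exprS; apply: (@le_trans _ _ (3 / 2 * (1 + 2^-1 * n%:R))%R).
    by have := ler0n R n; rewrite -[n.+1%:R]natr1; lra.
  by rewrite ler_wpM2l.
have u0 : (fun n => n%:R * x ^+ n)%R @ \oo --> (0 : R)%R.
  apply: (@squeeze_cvgr _ _ _ _ (fun=> 0%R) (geometric (2 : R)%R (3 / 4)%R)).
  - apply: nearW => n /=; rewrite mulr_ge0 ?exprn_ge0//=.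
    apply: (@le_trans _ _ (2 * (3 / 2) ^+ n * (2^-1) ^+ n)%R).
      apply: ler_pM => //; first exact: exprn_ge0.
        by have := bern n; lra.
      by rewrite lerXn2r ?nnegrE.
    rewrite -mulrA -exprMn; have -> : (3 / 2 * 2^-1 = 3 / 4 :> R)%R by field.
    by [].
  - exact: cvg_cst.
  - by apply: cvg_geometric; rewrite ger0_norm; lra.
have v0 : (fun n => x ^+ n)%R @ \oo --> (0 : R)%R.
  have : (`|x| < 1)%R by rewrite ger0_norm//; lra.
  by move=> /(cvg_geometric 1); apply: cvg_trans; apply: near_eq_cvg; apply: nearW => n /=; rewrite mul1r.
have lim0 : (fun n => n.+1%:R * x ^+ n - n%:R * x ^+ n.+1)%R @ \oo --> (0 : R)%R.
  have H : (fun n => (n%:R * x ^+ n + x ^+ n) - x * (n%:R * x ^+ n))%R @ \oo -->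
      (0 + 0 - x * 0 : R)%R.
    apply: cvgB; first exact: cvgD.
    by apply: cvgM => //; exact: cvg_cst.
  rewrite mulr0 addr0 subr0 in H.
  rewrite (_ : (fun n => _) = (fun n => (n%:R * x ^+ n + x ^+ n) - x * (n%:R * x ^+ n))%R) //.
  by apply/funext => n; rewrite -[n.+1%:R]natr1 exprS; ring.
apply: cvg_lim => //=.
under eq_cvg do rewrite sumEFin sE.
apply: cvg_EFin; first exact: nearW.
have H : (fun n => (1 - (n.+1%:R * x ^+ n - n%:R * x ^+ n.+1)) / (1 - x) ^+ 2)%R @ \oo -->
    ((1 - 0) / (1 - x) ^+ 2 : R)%R.
  by apply: cvgM; [apply: cvgB => //; exact: cvg_cst|exact: cvg_cst].
by rewrite subr0 mul1r in H.
Qed.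

Lemma ratio_weight_ge0 j l (r : R) : pos r -> (0 <= r ^+ j / (1 + r) ^+ l)%R.
Proof.
rewrite posE => /ltW r0; apply: divr_ge0; apply: exprn_ge0 => //.
exact: addr_ge0.
Qed.

(* 1 + 2 c r + r^2 = (1 + r)^2 (1 - x) with x = 2 (1 - c) r / (1 + r)^2 <= 1/2. *)
Lemma ratio_kernel_series (c : R) (f : R -> R) : (0 <= c <= 1)%R ->
  measurable_fun [set: R] f -> (forall x, 0 <= f x)%R ->
  \int[mu]_(r in pos) ((r / (1 + 2 * c * r + r ^+ 2) ^+ 2)%:E * (f r)%:E) =
  \sum_(0 <= k <oo) ((k.+1%:R * (2 * (1 - c)) ^+ k)%:E *
    \int[mu]_(r in pos) ((r ^+ k.+1 / (1 + r) ^+ (2 * k.+1).+2)%:E * (f r)%:E)).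
Proof.
move=> /andP[c0 c1] mf f0.
have a0 k : (0 <= k.+1%:R * (2 * (1 - c)) ^+ k)%R.
  by rewrite mulr_ge0// exprn_ge0// mulr_ge0// subr_ge0.
have b0 k r : pos r -> 0 <= (r ^+ k.+1 / (1 + r) ^+ (2 * k.+1).+2)%:E * (f r)%:E.
  by move=> pr; rewrite -EFinM lee_fin mulr_ge0// ratio_weight_ge0.
transitivity (\int[mu]_(r in pos) \sum_(0 <= k <oo) ((k.+1%:R * (2 * (1 - c)) ^+ k)%:E *
    ((r ^+ k.+1 / (1 + r) ^+ (2 * k.+1).+2)%:E * (f r)%:E))).
  apply: eq_integral => r; rewrite inE => pr; move: (pr); rewrite posE => r0.
  have r10 : (0 < 1 + r)%R by rewrite addr_gt0.
  pose x := (2 * (1 - c) * r / (1 + r) ^+ 2)%R.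
  have x2 : (0 <= x <= 2^-1)%R.
    rewrite /x; apply/andP; split.
      by rewrite divr_ge0 ?(ltW (exprn_gt0 _ r10))// !mulr_ge0 ?subr_ge0 ?(ltW r0).
    rewrite ler_pdivrMr ?exprn_gt0//.
    have : (0 <= c * r)%R by rewrite mulr_ge0// ltW.
    by have := sqr_ge0 (1 - r)%R; rewrite !expr2; nra.
  transitivity ((r / (1 + r) ^+ 4 * f r)%:E * \sum_(0 <= k <oo) (k.+1%:R * x ^+ k)%:E).
    rewrite nneseries_sqr_geometric// -!EFinM; congr EFin.
    have -> : (1 + 2 * c * r + r ^+ 2 = (1 + r) ^+ 2 * (1 - x))%R.
      by rewrite /x; field; rewrite gt_eqF.
    have x1 : (1 - x != 0)%R by rewrite subr_eq0; case/andP: x2 => ? ?; apply/eqP; lra.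
    by field; rewrite x1 gt_eqF.
  rewrite -nneseriesZl; last first.
    by move=> k _; rewrite lee_fin mulr_ge0// exprn_ge0//; case/andP: x2.
  apply: eq_eseriesr => k _; rewrite -!EFinM; congr EFin.
  rewrite /x !exprMn exprVn -exprM mulnS !exprS.
  by field; rewrite !gt_eqF ?exprn_gt0.
rewrite integral_nneseries//.
- apply: eq_eseriesr => k _; rewrite ge0_integralZl//.
  + by meas.
  + by move=> r; exact: b0.
  + by rewrite lee_fin.
- by move=> k; meas.
- by move=> k r pr; apply: mule_ge0; [rewrite lee_fin|exact: b0].
Qed.

(** The coefficients (k + 1) (2 (1 - c))^k of the expansion are nonnegative because c <= 1, so the
    inequality is inherited term by term from the Gamma ratios. *)
Lemma ratio_kernel_pd (c t : R) : (0 <= c <= 1)%R ->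
  \int[mu]_(r in pos) (r / (1 + 2 * c * r + r ^+ 2) ^+ 2)%:E <=
  \int[mu]_(r in pos) ((r / (1 + 2 * c * r + r ^+ 2) ^+ 2)%:E * (1 + cos (t * ln r))%:E).
Proof.
move=> c01; have /andP[c0 c1] := c01.
have mh : measurable_fun [set: R] (fun x : R => 1 + cos (t * ln x))%R by meas.
rewrite (ratio_kernel_series c01 mh (fun=> onecos_ge0 _)).
have -> : \int[mu]_(r in pos) (r / (1 + 2 * c * r + r ^+ 2) ^+ 2)%:E =
    \int[mu]_(r in pos) ((r / (1 + 2 * c * r + r ^+ 2) ^+ 2)%:E * 1%:E).
  by apply: eq_integral => r _; rewrite mule1.
rewrite (ratio_kernel_series c01 (measurable_cst (1%R : R)) (fun=> ler01)).
have a0 k : 0 <= (k.+1%:R * (2 * (1 - c)) ^+ k)%:E.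
  by rewrite lee_fin mulr_ge0// exprn_ge0// mulr_ge0// subr_ge0.
apply: lee_nneseries => k _.
  move=> _; rewrite mule_ge0//; apply: integral_ge0 => r pr.
  by rewrite mule1 lee_fin ratio_weight_ge0.
rewrite lee_wpmul2l//; apply: le_trans (gamma_ratio_pd _ _).
by under eq_integral do rewrite mule1.
Qed.

End positive_definiteness.

(** * The uniform probability on the disc *)

Section disc_probability.
Variable R : realType.
Notation mu := (@lebesgue_measure R).
Notation pos := (`]0%R, +oo[%classic : set R).
Notation plane := (plane R).
Notation dA := (@planar_measure R).
Notation disc := (@unit_disc R).
Local Open Scope ereal_scope.

Let pi0 : (0 <= (pi : R)^-1)%R.
Proof. by rewrite invr_ge0 pi_ge0. Qed.

Definition disc_prob : set plane -> \bar R :=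
  mscale (NngNum pi0) (mrestr dA (@measurable_unit_disc R)).
HB.instance Definition _ := Measure.on disc_prob.

Lemma disc_probE (A : set plane) : disc_prob A = (pi^-1)%:E * dA (A `&` disc).
Proof. by []. Qed.

Lemma disc_prob_setT : disc_prob setT = 1.
Proof.
by rewrite disc_probE setTI planar_measure_unit_disc -EFinM mulVf// gt_eqF// pi_gt0.
Qed.

HB.instance Definition _ := Measure_isProbability.Build _ _ _ disc_prob disc_prob_setT.

Lemma ge0_integral_mrestr d (T : measurableType d) (m : {measure set T -> \bar R})
    (D : set T) (mD : measurable D) (f : T -> \bar R) :
  measurable_fun setT f -> (forall x, 0 <= f x) ->
  \int[mrestr m mD]_x f x = \int[m]_(x in D) f x.
Proof.
move=> mf f0; rewrite -(setUv D) ge0_integral_setU//; last 3 first.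
- exact: measurableC.
- exact: measurable_funTS.
- exact/disj_setPCl.
rewrite [X in _ + X]null_set_integral ?adde0//; last 3 first.
- exact: measurableC.
- exact: measurable_funTS.
- by apply: etrans (measure0 m); congr (m _); exact: setICl.
apply: eq_measure_integral => /= A mA AD.
by rewrite /mrestr; congr (m _); apply/setIidPl.
Qed.

Lemma ge0_integral_disc_prob (f : plane -> \bar R) :
  measurable_fun setT f -> (forall x, 0 <= f x) ->
  \int[disc_prob]_x f x = (pi^-1)%:E * \int[dA]_(x in disc) f x.
Proof.
move=> mf f0; rewrite -(ge0_integral_mrestr dA (@measurable_unit_disc R) mf f0).
exact: (ge0_integral_mscale (mrestr dA (@measurable_unit_disc R)) measurableT
  (NngNum pi0) mf (fun x _ => f0 x)).
Qed.

(** Composition with [phi] commutes with positive and negative parts, so invariance on nonnegative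
    functions extends to all measurable ones, integrable or not. *)
Lemma integral_invariant d (T : measurableType d) (m : {measure set T -> \bar R})
    (phi : T -> T) :
  (forall g : T -> \bar R, measurable_fun setT g -> (forall x, 0 <= g x) ->
    \int[m]_x g (phi x) = \int[m]_x g x) ->
  forall f : T -> \bar R, measurable_fun setT f ->
    \int[m]_x f (phi x) = \int[m]_x f x.
Proof.
move=> H f mf; rewrite integralE [RHS]integralE; congr (_ - _).
  rewrite -(H _ (measurable_funepos mf) (fun=> funepos_ge0 _ _)).
  by apply: eq_integral => x _; rewrite !funeposE.
rewrite -(H _ (measurable_funeneg mf) (fun=> funeneg_ge0 _ _)).
by apply: eq_integral => x _; rewrite !funenegE.
Qed.

Lemma disc_prob_invariant (phi : plane -> plane) :
  measurable_fun setT phi -> (forall p, rad (phi p) = rad p) ->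
  (forall g : plane -> \bar R, measurable_fun setT g -> (forall x, 0 <= g x) ->
    \int[dA]_x g (phi x) = \int[dA]_x g x) ->
  forall f : plane -> \bar R, measurable_fun setT f ->
    \int[disc_prob]_x f (phi x) = \int[disc_prob]_x f x.
Proof.
move=> mphi radphi H; apply: integral_invariant => g mg g0.
rewrite !ge0_integral_disc_prob//; last exact: measurableT_comp.
congr (_ * _); rewrite [LHS]integral_mkcond [RHS]integral_mkcond -(H (g \_ disc)).
- apply: eq_integral => p _; rewrite !patchE; congr (if _ then _ else _).
  by apply/idP/idP; rewrite !inE !unit_discE/= radphi.
- apply/(measurable_restrictT _ _).1; first exact: measurable_unit_disc.
  exact: measurable_funTS.
- by move=> p; rewrite patchE; case: ifPn.
Qed.

Lemma integral_disc_reflection (f : plane -> \bar R) : measurable_fun setT f ->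
  \int[disc_prob]_p f (- p.1, p.2)%R = \int[disc_prob]_p f p.
Proof.
apply: (@disc_prob_invariant (fun p => (- p.1, p.2)%R)) => [|p|g mg g0].
- by meas.
- by rewrite /rad/= sqrrN.
rewrite !ge0_planarC//; last by meas.
by apply: eq_integral => b _; rewrite /fubini_G/= (ge0_integral_oppr (f := fun a => g (a, b)))//; meas.
Qed.

Lemma ge0_planar_shear1 (a : R) (g : plane -> \bar R) :
  measurable_fun setT g -> (forall x, 0 <= g x) ->
  \int[dA]_p g (p.1 + a * p.2, p.2)%R = \int[dA]_p g p.
Proof.
move=> mg g0; rewrite !ge0_planarC//; last by meas.
apply: eq_integral => b _ /=.
by rewrite (ge0_integral_translation (a * b) (f := fun a => g (a, b)))//; meas.
Qed.

Lemma ge0_planar_shear2 (a : R) (g : plane -> \bar R) :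
  measurable_fun setT g -> (forall x, 0 <= g x) ->
  \int[dA]_p g (p.1, p.2 + a * p.1)%R = \int[dA]_p g p.
Proof.
move=> mg g0; rewrite !ge0_planarE//; last by meas.
apply: eq_integral => b _ /=.
by rewrite (ge0_integral_translation (a * b) (f := fun a => g (b, a)))//; meas.
Qed.

Definition rotation (c s : R) (p : plane) : plane :=
  (c * p.1 - s * p.2, s * p.1 + c * p.2)%R.

Lemma measurable_rotation c s : measurable_fun setT (rotation c s).
Proof. by rewrite /rotation; meas. Qed.

Lemma rad_rotation c s p : (c ^+ 2 + s ^+ 2 = 1)%R -> rad (rotation c s p) = rad p.
Proof.
move=> cs; rewrite /rad/=; congr Num.sqrt.
transitivity ((c ^+ 2 + s ^+ 2) * (p.1 ^+ 2 + p.2 ^+ 2))%R; first by ring.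
by rewrite cs mul1r.
Qed.

(* A rotation other than the half-turn is a product of three shears. *)
Lemma ge0_planar_rotation (c s : R) (g : plane -> \bar R) : (c ^+ 2 + s ^+ 2 = 1)%R ->
  measurable_fun setT g -> (forall x, 0 <= g x) ->
  \int[dA]_p g (rotation c s p) = \int[dA]_p g p.
Proof.
(* The half-turn is the product of the reflections in the two axes. *)
move=> cs mg g0; have [c1|c1] := eqVneq (1 + c)%R 0%R.
  have cE : c = (- 1)%R by lra.
  have sE : s = 0%R.
    by apply/eqP; rewrite -sqrf_eq0; apply/eqP; move: cs; rewrite cE sqrrN expr1n; lra.
  have mgN : measurable_fun setT (fun p : plane => g (- p.1, - p.2)%R) by meas.
  transitivity (\int[dA]_p g (- p.1, - p.2)%R).
    apply: eq_integral => p _; rewrite /rotation cE sE; congr (g (_, _)); ring.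
  have mg1 : measurable_fun setT (fun p : plane => g (- p.1, p.2)%R) by meas.
  transitivity (\int[dA]_p g (- p.1, p.2)%R).
    rewrite (ge0_planarE mgN)// (ge0_planarE mg1)//; apply: eq_integral => a _ /=.
    by rewrite (ge0_integral_oppr (f := fun b => g (- a, b)%R))//; meas.
  rewrite (ge0_planarC mg1)// (ge0_planarC mg)//; apply: eq_integral => b _ /=.
  by rewrite (ge0_integral_oppr (f := fun a => g (a, b)%R))//; meas.
(* For an angle theta, k = - tan(theta / 2): the rotation is a horizontal shear by k, a vertical
   shear by sin theta, and the horizontal shear by k again. *)
pose k := (- (s / (1 + c)))%R.
have ks : (1 + k * s = c)%R.
  have -> : (1 + k * s = 1 - s ^+ 2 / (1 + c))%R by rewrite /k; field.
  have -> : (s ^+ 2 = 1 - c ^+ 2)%R by move: cs; lra.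
  by field.
have k2 : (k * (1 + c) = - s)%R by rewrite /k; field.
pose g1 (p : plane) := g (p.1 + k * p.2, p.2)%R.
pose g2 (p : plane) := g1 (p.1, p.2 + s * p.1)%R.
have mg1 : measurable_fun setT g1 by rewrite /g1; meas.
have mg2 : measurable_fun setT g2 by rewrite /g2; meas.
rewrite -(ge0_planar_shear1 k mg g0) -(ge0_planar_shear2 s mg1)// => [|p]; last exact: g0.
rewrite -(ge0_planar_shear1 k mg2)// => [|p]; last exact: g0.
apply: eq_integral => p _; rewrite /g2 /g1 /rotation/=; congr (g (_, _)).
  transitivity ((1 + k * s) * p.1 + (k * (1 + (1 + k * s))) * p.2)%R; last by ring.
  by rewrite ks k2; ring.
transitivity (s * p.1 + (1 + k * s) * p.2)%R; last by ring.
by rewrite ks.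
Qed.

Lemma integral_disc_rotation (c s : R) (f : plane -> \bar R) : (c ^+ 2 + s ^+ 2 = 1)%R ->
  measurable_fun setT f ->
  \int[disc_prob]_p f (rotation c s p) = \int[disc_prob]_p f p.
Proof.
move=> cs; apply: disc_prob_invariant; first exact: measurable_rotation.
  by move=> p; exact: rad_rotation.
by move=> g; exact: ge0_planar_rotation.
Qed.

Lemma ge0_integral_disc_prob_radial (f : R -> \bar R) :
  measurable_fun [set: R] f -> (forall x, 0 <= f x) ->
  \int[disc_prob]_p f (rad p) = 2%:E * \int[mu]_(r in `]0%R, 1%R[) (r%:E * f r).
Proof.
move=> mf f0; rewrite ge0_integral_disc_prob//; last first.
  by apply: measurableT_comp => //; exact: measurable_rad.
rewrite ge0_integral_disc_radial// muleA -EFinM; congr (_%:E * _).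
by rewrite mulrCA mulVf ?mulr1// gt_eqF// pi_gt0.
Qed.

Definition log_ratio (p : plane) : R := ln (rad (1 - p.1, p.2)%R) - ln (rad (1 + p.1, p.2)%R).

Lemma measurable_log_ratio : measurable_fun setT log_ratio.
Proof. by rewrite /log_ratio /rad; meas. Qed.

Lemma integrable_disc_bounded (f : plane -> R) (M : R) : measurable_fun setT f ->
  (forall p, `|f p| <= M)%R -> disc_prob.-integrable setT (EFin \o f).
Proof.
move=> mf fM; apply: measurable_bounded_integrable => //.
  by apply: (@eq_ind_r _ 1 (fun z => z < +oo) (ltry _)); exact: disc_prob_setT.
exists M; split; first exact: num_real.
by move=> x Mx p _; exact: le_trans (fM p) (ltW Mx).
Qed.

Definition cf_log_ratio (t : R) : R := \int[disc_prob]_p cos (t * log_ratio p).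

Lemma integrable_cos_disc (f : plane -> R) : measurable_fun setT f ->
  disc_prob.-integrable setT (EFin \o (fun p => cos (f p))).
Proof.
move=> mf; apply: (@integrable_disc_bounded _ 1%R) => [|p]; last exact: cos_max.
exact: measurableT_comp (@measurable_cos R) mf.
Qed.

Lemma integrable_sin_disc (f : plane -> R) : measurable_fun setT f ->
  disc_prob.-integrable setT (EFin \o (fun p => sin (f p))).
Proof.
move=> mf; apply: (@integrable_disc_bounded _ 1%R) => [|p]; last exact: sin_max.
exact: measurableT_comp (@measurable_sin R) mf.
Qed.

Lemma integral_disc_cst (c : R) : (\int[disc_prob]_p c)%R = c.
Proof.
rewrite Rintegral_cst// (_ : fine _ = 1%R) ?mulr1//.
by rewrite -[RHS]/(fine (1%:E)); congr fine; exact: disc_prob_setT.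
Qed.

Lemma slope_cos_le1 (t : R) : (slope_cos t <= 1)%R.
Proof.
rewrite -(@expr_le1 _ 2)// ?(ltW (slope_cos_gt0 t))// slope_cos_sqr invf_le1.
  by rewrite lerDl sqr_ge0.
by rewrite ltr_pwDl// sqr_ge0.
Qed.

(** The law of the log-ratio is a mixture over slopes x; for each fixed slope the inequality is
    [ratio_kernel_pd] with c = [slope_cos x], and it is then integrated in x. *)
Lemma cf_log_ratio_ge0 t : (0 <= cf_log_ratio t)%R.
Proof.
have mY := measurable_log_ratio.
have mtY : measurable_fun setT (fun p => t * log_ratio p)%R by meas.
have ic := integrable_cos_disc mtY.
have i1 : disc_prob.-integrable setT (EFin \o (fun=> 1%R : R)).
  by apply: (@integrable_disc_bounded _ 1%R) => // p; rewrite normr1.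
have E1 : \int[disc_prob]_p (1 + cos (t * log_ratio p))%:E = (1 + cf_log_ratio t)%:E.
  transitivity (\int[disc_prob]_p (1 * 1 + 1 * cos (t * log_ratio p) + 0 * 1)%:E).
    by apply: eq_integral => p _; congr EFin; ring.
  by rewrite integral_lin3// integral_disc_cst; congr EFin; rewrite /cf_log_ratio; ring.
have E2 : \int[disc_prob]_p 1%:E = 1%:E by rewrite integral_RintegralE// integral_disc_cst.
rewrite -(lerD2l 1%R) addr0 -lee_fin -E1 -E2.
have mh : measurable_fun [set: R] (fun x : R => (1 + cos (t * x))%:E) by meas.
have mhY : measurable_fun setT (fun p => (1 + cos (t * log_ratio p))%:E) by meas.
rewrite (ge0_integral_disc_prob (measurable_cst (1%:E : \bar R)) (fun=> lee01)).
rewrite (ge0_integral_disc_prob mhY (fun=> onecos_ge0 _)).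
rewrite lee_pmul2l//; last by rewrite lte_fin invr_gt0 pi_gt0.
rewrite (ge0_integral_log_ratio mh (fun x => onecos_ge0 _)).
rewrite (ge0_integral_log_ratio (measurable_cst (1%:E : \bar R)) (fun=> lee01)).
pose K (p : R * R) : R := (4 * p.2 / (1 + p.1 ^+ 2) /
  (1 + 2 * slope_cos p.1 * p.2 + p.2 ^+ 2) ^+ 2)%R.
have mK : measurable_fun setT K by rewrite /K /slope_cos; meas.
have K0 x r : pos r -> (0 <= K (x, r))%R.
  rewrite posE => r0; rewrite /K/= divr_ge0 ?sqr_ge0// divr_ge0 ?mulr_ge0 ?(ltW r0)//.
  by rewrite addr_ge0// sqr_ge0.
have mpos : measurable pos by [].
apply: ge0_le_integral => //.
- by move=> x _; apply: integral_ge0 => r pr; rewrite mule_ge0// lee_fin (K0 x).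
- apply: (ge0_measurable_integral_on (m2 := mu) (A := setT) (B := pos)
    (f := fun p => (K p)%:E * cst 1 (ln p.2))) => //; first by meas.
  by move=> x r _ pr; rewrite mule_ge0// lee_fin K0.
- apply: (ge0_measurable_integral_on (m2 := mu) (A := setT) (B := pos)
    (f := fun p => (K p)%:E * (1 + cos (t * ln p.2))%:E)) => //; first by meas.
  by move=> x r _ pr; rewrite mule_ge0 ?onecos_ge0// lee_fin K0.
move=> x _.
have x0 : (0 < 1 + x ^+ 2)%R by rewrite ltr_pwDl// sqr_ge0.
pose k (r : R) := (r / (1 + 2 * slope_cos x * r + r ^+ 2) ^+ 2)%R.
have mk : measurable_fun [set: R] k by rewrite /k; meas.
have k0 r : pos r -> (0 <= k r)%R.
  by rewrite posE => r0; rewrite /k divr_ge0 ?sqr_ge0// ltW.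
have KE r : K (x, r) = (4 / (1 + x ^+ 2) * k r)%R.
  by rewrite /K /k/=; ring.
have H (f : R -> R) : measurable_fun [set: R] f -> (forall r, 0 <= f r)%R ->
    \int[mu]_(r in pos) ((K (x, r))%:E * (f r)%:E) =
    (4 / (1 + x ^+ 2))%:E * \int[mu]_(r in pos) ((k r)%:E * (f r)%:E).
  move=> mf f0; rewrite -ge0_integralZl//; last 3 first.
  - by meas.
  - by move=> r pr; rewrite mule_ge0// lee_fin ?k0.
  - by rewrite lee_fin divr_ge0// ltW.
  by apply: eq_integral => r _; rewrite KE EFinM muleA.
rewrite (H (fun=> 1%R))// (H (fun r => 1 + cos (t * ln r))%R); last 2 first.
- by meas.
- by move=> r; rewrite -lee_fin onecos_ge0.
rewrite lee_pmul2l//; last by rewrite lte_fin divr_gt0.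
under eq_integral do rewrite mule1.
by apply: ratio_kernel_pd; rewrite ltW ?slope_cos_gt0// slope_cos_le1.
Qed.

(** The reflection x -> - conj x preserves the disc and exchanges |1 - x| with |1 + x|, so it
    changes the sign of the log-ratio. *)
Lemma sin_log_ratio0 t : (\int[disc_prob]_p sin (t * log_ratio p))%R = 0%R.
Proof.
have mY := measurable_log_ratio.
have mtY : measurable_fun setT (fun p => t * log_ratio p)%R by meas.
have si := integrable_sin_disc mtY.
have ms : measurable_fun setT (fun p => (sin (t * log_ratio p))%:E) by meas.
have := integral_disc_reflection ms.
have -> : \int[disc_prob]_p (sin (t * log_ratio (- p.1, p.2)%R))%:E =
    (- \int[disc_prob]_p sin (t * log_ratio p))%:E.
  transitivity (\int[disc_prob]_p (-1 * sin (t * log_ratio p)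
      + 0 * sin (t * log_ratio p) + 0 * sin (t * log_ratio p))%:E).
    apply: eq_integral => p _; congr EFin.
    rewrite (_ : log_ratio (- p.1, p.2)%R = - log_ratio p)%R; last first.
      by rewrite /log_ratio/= opprK opprB.
    by rewrite mulrN sinN; ring.
  by rewrite integral_lin3//; congr EFin; ring.
rewrite integral_RintegralE// => -[]; lra.
Qed.

End disc_probability.

(** * Jensen's formula *)

Section log_integrability.
Variable R : realType.
Notation mu := (@lebesgue_measure R).
Notation pos := (`]0%R, +oo[%classic : set R).
Notation plane := (plane R).
Notation P := (@disc_prob R).
Local Open Scope ereal_scope.

Let mpos : measurable pos. Proof. by []. Qed.

Lemma integral_indic_line (A : set R) : measurable A ->
  \int[mu]_x (\1_A x)%:E = mu A.
Proof. by move=> mA; rewrite integral_indic// setIT. Qed.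

(* Layer cake: [- ln x] is the length of the set of [y > 0] with
   [x < expR (- y)]. *)
Lemma integral_lnN01 : \int[mu]_(x in `]0%R, 1%R[) (- ln x)%:E = 1 :> \bar R.
Proof.
pose E : set (R * R) := [set p | (p.1 < expR (- p.2))%R].
have mE : measurable E.
  rewrite /E -[X in measurable X]setTI; apply: measurable_fun_ltr => //; meas.
have EE x y : ((x, y) \in E) = (x < expR (- y))%R by apply/idP/idP; rewrite inE.
pose F (p : R * R) : \bar R := (\1_E p)%:E.
have mF : measurable_fun setT F by apply/measurable_EFinP; exact: measurable_indic.
have F0 x y : pos x -> pos y -> 0 <= F (x, y) by rewrite lee_fin.
have := ge0_integral_exchange (m1 := mu) (m2 := mu) mpos mpos mF F0.
have -> : \int[mu]_(x in pos) \int[mu]_(y in pos) F (x, y) =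
    \int[mu]_(x in `]0%R, 1%R[) (- ln x)%:E.
  rewrite [LHS]integral_mkcond [RHS]integral_mkcond; apply: eq_integral => x _.
  rewrite !patchE !mem_setE !in_itv/= andbT; case: (ltP 0%R x) => //= x0.
  transitivity (mu (`]0%R, (- ln x)%R[%classic)).
    rewrite -integral_indic_line// integral_mkcond; apply: eq_integral => y _.
    rewrite /F !patchE !indicE EE !mem_setE !in_itv/= andbT.
    case: (ltP 0%R y) => //= y0; rewrite ltrNr -[in RHS](expRK (- (y : R))%R).
    by rewrite ltr_ln ?posrE ?expR_gt0.
  rewrite lebesgue_measure_itv/= lte_fin oppr_gt0 -EFinD oppr0 addr0.
  have -> : (ln x < 0)%R = (x < 1)%R by rewrite -[X in (_ < X)%R]ln1 ltr_ln ?posrE.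
  by [].
move=> ->; rewrite -integral_expRN; apply: eq_integral => y; rewrite inE posE => y0.
transitivity (mu (`]0%R, (expR (- y))%R[%classic)).
  rewrite -integral_indic_line// integral_mkcond; apply: eq_integral => x _.
  rewrite /F !patchE !indicE EE !mem_setE !in_itv/= andbT.
  by case: (ltP 0%R x).
by rewrite lebesgue_measure_itv/= lte_fin expR_gt0 -EFinD oppr0 addr0.
Qed.

Definition neglog (x : R) : R := if (`|x| < 1)%R then (- ln `|x|)%R else 0%R.

Lemma measurable_neglog : measurable_fun [set: R] neglog.
Proof.
rewrite /neglog; apply: measurable_fun_ifT; last by meas.
- by apply: measurable_fun_ltr; meas.
- by meas.
Qed.

Lemma neglog_ge0 x : (0 <= neglog x)%R.
Proof.
by rewrite /neglog; case: ifPn => // x1; rewrite oppr_ge0 ln_le0// ltW.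
Qed.

Lemma integral_neglog : \int[mu]_x (neglog x)%:E = 2%:E.
Proof.
have mn := measurable_neglog.
rewrite ge0_even_integral; first last.
- by move=> x; rewrite /neglog normrN.
- by move=> x; rewrite lee_fin neglog_ge0.
- by meas.
rewrite -[RHS]mule1 -integral_lnN01; congr (_ * _).
rewrite [LHS]integral_mkcond [RHS]integral_mkcond; apply: eq_integral => x _.
rewrite !patchE !mem_setE !in_itv/= andbT /neglog; case: (ltP 0%R x) => //= x0.
by rewrite gtr0_norm//; case: ifPn.
Qed.

Lemma disc_prob_ae_neq (r : R) : {ae P, forall p, rad p != r}.
Proof.
have mN : measurable [set p : plane | rad p == r].
  rewrite -[X in measurable X]setTI; apply: measurable_fun_eqr => //.
  exact: measurable_rad.
exists [set p : plane | rad p == r]; split => //; last first.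
  by move=> p/= /negP; rewrite negbK.
rewrite -[X in P X]setIT -integral_indic//.
pose f (x : R) : \bar R := (\1_[set r] x)%:E.
have mf : measurable_fun [set: R] f by apply/measurable_EFinP; exact: measurable_indic.
have f0 x : 0 <= f x by rewrite lee_fin.
transitivity (\int[P]_p f (rad p)).
  apply: eq_integral => p _; rewrite /f !indicE; congr ((nat_of_bool _)%:R%:E).
  by apply/idP/idP; rewrite !inE /= => /eqP.
rewrite ge0_integral_disc_prob_radial//.
apply/eqP; rewrite eq_le mule_ge0 ?andbT//; last first.
  by apply: integral_ge0 => x; rewrite /= in_itv/= => /andP[x0 _]; apply: mule_ge0; [rewrite lee_fin ltW|exact: f0].
rewrite -(mule0 2%:E) lee_pmul2l//.
apply: (@le_trans _ _ (\int[mu]_(x in `]0%R, 1%R[) f x)).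
  apply: ge0_le_integral => //.
  - by move=> x; rewrite /= in_itv/= => /andP[x0 _]; apply: mule_ge0; [rewrite lee_fin ltW|exact: f0].
  - by meas.
  - exact: measurable_funTS.
  - move=> x; rewrite /= in_itv/= => /andP[x0 x1].
    by rewrite gee_pMl// ?lee_fin// ltW.
rewrite /f integral_indic//.
apply: (@le_trans _ _ (mu [set r])).
  by apply: le_measure; rewrite ?inE//; exact: measurableI.
exact: (eq_ind_r (fun z => z <= 0) (lexx 0) (lebesgue_measure_set1 r)).
Qed.

Lemma disc_prob_ae_lt1 : {ae P, forall p, (rad p < 1)%R}.
Proof.
exists (~` @unit_disc R); split.
- apply: measurableC; exact: measurable_unit_disc.
- by rewrite /= disc_probE setICl measure0 mule0.
- by move=> p /= h; rewrite /= unit_discE.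
Qed.

(** In polar coordinates the integrand is r |ln r|, and ln(1/r) <= 1/r - 1 bounds it by 1. *)
Lemma integrable_ln_rad : P.-integrable setT (EFin \o (fun p => ln (rad p))).
Proof.
have mrad := @measurable_rad R.
apply/integrableP; split; first by apply: meas_EFin; meas.
have -> : \int[P]_p `|(EFin \o (fun p => ln (rad p))) p| =
    \int[P]_p (fun r : R => `|ln r|%:E) (rad p).
  by apply: eq_integral => p _.
rewrite (ge0_integral_disc_prob_radial (f := fun r : R => `|ln r|%:E)); last 2 first.
- by meas.
- by [].
apply: (@le_lt_trans _ _ (2%:E * \int[mu]_(r in `]0%R, 1%R[) 1%:E)).
  rewrite lee_pmul2l//; apply: ge0_le_integral => //.
  - by move=> x; rewrite /= in_itv/= => /andP[x0 _]; rewrite mule_ge0// lee_fin ltW.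
  - by meas.
  move=> x; rewrite /= in_itv/= => /andP[x0 x1].
  rewrite -EFinM lee_fin ler0_norm; last by rewrite ln_le0// ltW.
  rewrite -lnV ?posrE// -[leRHS](divff (lt0r_neq0 x0)) ler_wpM2l ?(ltW x0)//.
  have := @le_ln1Dx R (x^-1 - 1)%R.
  have -> : (1 + (x^-1 - 1) = x^-1)%R by rewrite addrC subrK.
  have xV : (1 < x^-1)%R by rewrite invf_gt1.
  by move=> H; apply: (le_trans (H _)); lra.
by rewrite integral_cst//= lebesgue_measure_itv/= lte_fin ltr01 -!EFinM ltry.
Qed.

(** A majorant, uniform in k, for the dominated convergence in Jensen's formula: the first term
    controls the singularity on the circle a |u| = 1, the second the growth. *)
Definition log_bound (a : R) (p : plane) : R := (neglog (1 - a * rad p) + a * rad p)%R.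

Lemma measurable_log_bound a : measurable_fun setT (log_bound a).
Proof.
have mn := measurable_neglog; have mr := @measurable_rad R.
by rewrite /log_bound; meas.
Qed.

Lemma integrable_log_bound a : (0 < a)%R -> P.-integrable setT (EFin \o log_bound a).
Proof.
move=> a0; have ml := measurable_log_bound a; have mn := measurable_neglog.
have mrad := @measurable_rad R.
apply/integrableP; split; first exact: meas_EFin.
pose f (r : R) : \bar R := (neglog (1 - a * r) + a * `|r|)%:E.
have mf : measurable_fun [set: R] f by rewrite /f; meas.
have f0 x : 0 <= f x by rewrite lee_fin addr_ge0 ?neglog_ge0// mulr_ge0// ltW.
have -> : \int[P]_p `|(EFin \o log_bound a) p| = \int[P]_p f (rad p).
  apply: eq_integral => p _; rewrite /f /= ger0_norm; first by rewrite ger0_norm// rad_ge0.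
  by rewrite addr_ge0 ?neglog_ge0// mulr_ge0 ?rad_ge0// ltW.
rewrite (ge0_integral_disc_prob_radial mf f0).
have H : \int[mu]_(r in `]0%R, 1%R[) (r%:E * f r) <=
    \int[mu]_(r in `]0%R, 1%R[) (neglog (1 - a * r))%:E + \int[mu]_(r in `]0%R, 1%R[) a%:E.
  rewrite -ge0_integralD//; last 3 first.
  - by move=> r _; rewrite lee_fin neglog_ge0.
  - by meas.
  - by move=> r _; rewrite lee_fin ltW.
  apply: ge0_le_integral => //.
  - by move=> x; rewrite /= in_itv/= => /andP[x0 _]; apply: mule_ge0; [rewrite lee_fin ltW|exact: f0].
  - by meas.
  - by apply: meas_adde; meas.
  move=> x; rewrite /= in_itv/= => /andP[x0 x1]; rewrite -EFinM -EFinD lee_fin gtr0_norm//.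
  have n0 := neglog_ge0 (1 - a * x); set n := neglog _ in n0 *.
  have -> : (x * (n + a * x) = x * n + a * (x * x))%R by ring.
  apply: lerD; first by rewrite ler_piMl// ltW.
  by rewrite ler_piMr ?(ltW a0)// mulr_ile1// ltW.
(* After enlarging the domain to the whole line, the substitution of 1 - a r for r gives exactly 2 /
   a. *)
have H2 : \int[mu]_(r in `]0%R, 1%R[) (neglog (1 - a * r))%:E <= (2 / a)%:E.
  apply: (@le_trans _ _ (\int[mu]_r (neglog (1 - a * r))%:E)).
    apply: ge0_subset_integral => //; first by meas.
    by move=> r _; rewrite lee_fin neglog_ge0.
  have mg : measurable_fun [set: R] (fun r => (neglog (1 - r))%:E) by meas.
  have : a%:E * \int[mu]_r (neglog (1 - a * r))%:E = 2%:E.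
    rewrite (ge0_integral_dilation a0 mg); last by move=> r; rewrite lee_fin neglog_ge0.
    rewrite -integral_neglog.
    transitivity (\int[mu]_r (neglog (r + 1))%:E).
      rewrite -[RHS]ge0_integral_oppr; last 2 first.
      - by meas.
      - by move=> r; rewrite lee_fin neglog_ge0.
      by apply: eq_integral => r _; rewrite addrC.
    rewrite (ge0_integral_translation 1 (f := fun r => (neglog r)%:E))//.
    - by meas.
    - by move=> r; rewrite lee_fin neglog_ge0.
  move=> /(congr1 (fun z => a^-1%:E * z)); rewrite muleA -!EFinM mulVf ?gt_eqF// mul1e mulrC.
  by move=> ->.
apply: (@le_lt_trans _ _ (2%:E * ((2 / a)%:E + a%:E))).
  rewrite lee_pmul2l//; apply: (le_trans H); apply: leeD => //.
  by rewrite integral_cst//= lebesgue_measure_itv/= lte_fin ltr01 -EFinD subr0 mule1.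
by rewrite -EFinD -EFinM ltry.
Qed.

End log_integrability.

Section complex_measurability.
Context (R : realType) d (T : measurableType d).
Implicit Types f g : T -> R[i].

Definition measurable_complex f :=
  measurable_fun setT (fun x => complex.Re (f x)) /\
  measurable_fun setT (fun x => complex.Im (f x)).

Lemma measurable_complex_cst (c : R[i]) : measurable_complex (fun=> c).
Proof. by split; exact: measurable_cst. Qed.

Lemma measurable_complexD f g : measurable_complex f -> measurable_complex g ->
  measurable_complex (fun x => f x + g x).
Proof.
move=> [f1 f2] [g1 g2]; split.
  rewrite (_ : (fun x => _) = (fun x => complex.Re (f x) + complex.Re (g x))).
    exact: meas_add.
  by apply/funext => x; case: (f x) (g x) => [? ?] [? ?].
rewrite (_ : (fun x => _) = (fun x => complex.Im (f x) + complex.Im (g x))).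
  exact: meas_add.
by apply/funext => x; case: (f x) (g x) => [? ?] [? ?].
Qed.

Lemma measurable_complexM f g : measurable_complex f -> measurable_complex g ->
  measurable_complex (fun x => f x * g x).
Proof.
move=> [f1 f2] [g1 g2]; split.
  rewrite (_ : (fun x => _) = (fun x => complex.Re (f x) * complex.Re (g x)
      - complex.Im (f x) * complex.Im (g x))).
    by apply: meas_add; [|apply: meas_opp]; exact: meas_mul.
  by apply/funext => x; case: (f x) (g x) => [? ?] [? ?].
rewrite (_ : (fun x => _) = (fun x => complex.Re (f x) * complex.Im (g x)
    + complex.Im (f x) * complex.Re (g x))).
  by apply: meas_add; exact: meas_mul.
by apply/funext => x; case: (f x) (g x) => [? ?] [? ?].
Qed.

Lemma measurable_complexN f : measurable_complex f -> measurable_complex (fun x => - f x).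
Proof.
move=> mf; rewrite (_ : (fun x => _) = (fun x => (- 1) * f x)).
  by apply: measurable_complexM => //; exact: measurable_complex_cst.
by apply/funext => x; rewrite mulN1r.
Qed.

Lemma measurable_complexX f n : measurable_complex f ->
  measurable_complex (fun x => f x ^+ n).
Proof.
move=> mf; elim: n => [|n IHn].
  by rewrite (_ : (fun x => _) = fun=> 1); [exact: measurable_complex_cst|exact/funext].
rewrite (_ : (fun x => _) = (fun x => f x * f x ^+ n)); first exact: measurable_complexM.
by apply/funext => x; rewrite exprS.
Qed.

Lemma measurable_modulus f : measurable_complex f ->
  measurable_fun setT (fun x => modulus (f x)).
Proof.
move=> [f1 f2]; rewrite (_ : (fun x => _) =
    (fun x => Num.sqrt (complex.Re (f x) ^+ 2 + complex.Im (f x) ^+ 2))).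
  by apply: meas_sqrt; apply: meas_add; exact: meas_exp.
by apply/funext => x; case: (f x).
Qed.

End complex_measurability.

Section jensen.
Variable R : realType.
Notation mu := (@lebesgue_measure R).
Notation plane := (plane R).
Notation P := (@disc_prob R).
Notation cp := (@complex_of_plane R).
Notation N := (@modulus R).
Notation C := (R[i]).

Lemma modulus_cp p : N (cp p) = rad p. Proof. by []. Qed.

Lemma modulusM (x y : C) : N (x * y) = N x * N y.
Proof. exact: ComplexField.Normc.normcM. Qed.

Lemma modulusN (x : C) : N (- x) = N x.
Proof. by case: x => a b; rewrite /modulus/= !sqrrN. Qed.

Lemma modulusX (x : C) n : N (x ^+ n) = N x ^+ n.
Proof.
elim: n => [|n IHn]; first by rewrite !expr0 /modulus ComplexField.Normc.normc1.
by rewrite !exprS modulusM IHn.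
Qed.

Lemma modulus_ge0 (x : C) : 0 <= N x.
Proof. by case: x => a b; rewrite /modulus/= sqrtr_ge0. Qed.

Lemma modulus1 : N 1 = 1.
Proof. exact: ComplexField.Normc.normc1. Qed.

Lemma modulus0 : N 0 = 0.
Proof. by rewrite /modulus/= expr0n/= addr0 sqrtr0. Qed.

Lemma modulus_gt0 (x : C) : x != 0 -> 0 < N x.
Proof.
move=> x0; rewrite lt_neqAle modulus_ge0 andbT eq_sym.
by apply: contra x0 => /eqP/ComplexField.Normc.eq0_normc ->.
Qed.

Lemma modulusD (x y : C) : N (x + y) <= N x + N y.
Proof. exact: (@complex.le_normcD R x y). Qed.

Lemma modulusB1_le (x : C) : N (1 - x) <= 1 + N x.
Proof. by have := modulusD 1 (- x); rewrite modulusN modulus1. Qed.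

Lemma modulusB1_ge (x : C) : `|1 - N x| <= N (1 - x).
Proof.
rewrite ler_norml; apply/andP; split.
  have := modulusD (x - 1) 1; rewrite subrK modulus1 -opprB modulusN; lra.
have := modulusD (1 - x) x; rewrite subrK modulus1; lra.
Qed.

(** Multiplying w by this number changes the sign of w^(2^k), which turns the factor 1 - w^(2^k)
    into 1 + w^(2^k). *)
Fixpoint half_turn_root (k : nat) : C :=
  if k is k'.+1 then sqrtc (half_turn_root k') else - 1.

Lemma half_turn_rootX k : half_turn_root k ^+ (2 ^ k) = - 1.
Proof.
elim: k => [|k IHk]; first by rewrite expn0 expr1.
by rewrite expnS exprM /= sqr_sqrtc IHk.
Qed.

Lemma modulus_half_turn_root k : N (half_turn_root k) = 1.
Proof.
apply/eqP; rewrite -(@pexpr_eq1 _ _ (2 ^ k)%N) ?modulus_ge0 ?expn_gt0//.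
by rewrite -modulusX half_turn_rootX modulusN modulus1.
Qed.

Lemma cp_rotation (z : C) p :
  cp (rotation (complex.Re z) (complex.Im z) p) = z * cp p.
Proof.
case: z p => [a b] [x y]; apply/eqP; rewrite eq_complex/=.
by apply/andP; split; apply/eqP; rewrite // addrC.
Qed.

Lemma Re_Im_modulus1 (z : C) : N z = 1 -> complex.Re z ^+ 2 + complex.Im z ^+ 2 = 1.
Proof.
case: z => a b; rewrite /modulus/= => /(congr1 (fun x => x ^+ 2)).
by rewrite sqr_sqrtr ?expr1n// addr_ge0// sqr_ge0.
Qed.

(* Since |1 - w^(2^(k+1))| = |1 - w^(2^k)| |1 + w^(2^k)| and the disc is invariant
   under rotations, the mean does not depend on [k]; letting [k] tend to infinity
   gives Jensen's formula, the limit being max (0, log |w|).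
   The value on the circle [N (c * cp p) = 1] is irrelevant to integrals; with
   the convention [0] the identities below hold everywhere. *)
Definition log_dyadic (c : C) (k : nat) (p : plane) : R :=
  if N (c * cp p) == 1 then 0
  else 2 ^- k * ln (N (1 - (c * cp p) ^+ (2 ^ k))).

Lemma measurable_log_dyadic c k : measurable_fun setT (log_dyadic c k).
Proof.
have mz : measurable_complex (fun p : plane => c * cp p).
  apply: measurable_complexM; first exact: measurable_complex_cst.
  by split; [exact: measurable_fst|exact: measurable_snd].
rewrite /log_dyadic; apply: measurable_fun_ifT.
- apply: measurable_fun_eqr; last exact: measurable_cst.
  exact: measurable_modulus.
- exact: measurable_cst.
- apply: meas_mul; first exact: measurable_cst.
  apply: meas_ln; apply: measurable_modulus; apply: measurable_complexD.
    exact: measurable_complex_cst.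
  by apply: measurable_complexN; exact: measurable_complexX.
Qed.

Lemma log_dyadic_mean c k p :
  log_dyadic c k p + log_dyadic c k
    (rotation (complex.Re (half_turn_root k)) (complex.Im (half_turn_root k)) p) =
  2 * log_dyadic c k.+1 p.
Proof.
rewrite /log_dyadic cp_rotation mulrCA (modulusM (half_turn_root k)).
rewrite modulus_half_turn_root mul1r.
case: ifPn => [_|z1]; first by rewrite addr0 mulr0.
rewrite (exprMn _ (half_turn_root k)) half_turn_rootX mulN1r opprK.
set z := c * cp p in z1 *; set w := z ^+ (2 ^ k).
have Nw : N w != 1 by rewrite modulusX pexpr_eq1 ?modulus_ge0 ?expn_gt0.
have w1 : 1 - w != 0.
  by apply: contra Nw => /eqP/subr0_eq <-; rewrite modulus1.
have w2 : 1 + w != 0.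
  by apply: contra Nw; rewrite addrC addr_eq0 => /eqP ->; rewrite modulusN modulus1.
rewrite -mulrDr -lnM ?posrE ?modulus_gt0// -modulusM.
have -> : (1 - w) * (1 + w) = 1 - z ^+ (2 ^ k.+1).
  by rewrite expnS mulnC exprM -/w; ring.
by rewrite exprS invfM !mulrA divff ?mul1r.
Qed.

(** With n = 2^k, the lower bound comes from |1 - z^n| >= |1 - |z|^n| >= |1 - |z||. The upper bound
    comes from |1 - z^n| <= (1 + |z|)^n and ln(1 + |z|) <= |z|, the prefactor 1/n absorbing the
    exponent. *)
Lemma norm_log_dyadic_le c k p : `|log_dyadic c k p| <= log_bound (N c) p.
Proof.
rewrite /log_dyadic /log_bound -modulus_cp -modulusM; set z := c * cp p.
have z0 := modulus_ge0 z.
case: ifPn => [_|z1]; first by rewrite normr0 addr_ge0// neglog_ge0.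
set n := (2 ^ k)%N; have n0 : (0 < n)%N by rewrite expn_gt0.
have n1 : 1 <= n%:R :> R by rewrite ler1n.
have nE : 2 ^- k = n%:R^-1 :> R by rewrite /n natrX.
have k1 : 0 < (2 ^- k : R) <= 1 by rewrite nE invr_gt0 ltr0n n0 invf_le1// ltr0n.
have h1 : `|1 - N z| <= `|1 - N z ^+ n|.
  rewrite -[n]prednK//; have [z1'|z1'] := leP (N z) 1.
    have zn := exprn_ile1 n.-1 z0 z1'; rewrite !ger0_norm ?subr_ge0//; last first.
      by rewrite exprn_ile1.
    by rewrite lerD2l lerN2 exprS ler_piMr.
  have zn := exprn_ege1 n.-1 (ltW z1').
  rewrite !ler0_norm ?subr_le0 ?exprn_ege1 ?(ltW z1')//.
  by rewrite !opprB lerD2r exprS ler_peMr.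
have zn1 : 0 < `|1 - N z| by rewrite normr_gt0 subr_eq0 eq_sym.
have lb : `|1 - N z| <= N (1 - z ^+ n).
  by apply: (le_trans h1); rewrite -modulusX; exact: modulusB1_ge.
have p0 : 0 < N (1 - z ^+ n) by exact: lt_le_trans lb.
rewrite ler_norml; apply/andP; split.
  rewrite lerNl -mulrN; have [l0|l0] := leP 0 (ln (N (1 - z ^+ n))).
    apply: (@le_trans _ _ 0); last by rewrite addr_ge0// neglog_ge0.
    by rewrite mulr_ge0_le0 ?oppr_le0// ltW//; case/andP: k1.
  apply: (@le_trans _ _ (- ln (N (1 - z ^+ n)))).
    by rewrite ler_piMl ?oppr_ge0 ?(ltW l0)//; case/andP: k1.
  have z2 : `|1 - N z| < 1.
    by apply: (le_lt_trans lb); rewrite ltNge; apply/negP => /ln_ge0; rewrite leNgt l0.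
  rewrite /neglog z2; apply: (@le_trans _ _ (- ln `|1 - N z|)); last by rewrite lerDl.
  by rewrite lerN2 ler_ln ?posrE.
apply: (@le_trans _ _ (N z)); last by rewrite lerDr neglog_ge0.
rewrite nE ler_pdivrMl ?ltr0n//.
apply: (@le_trans _ _ (ln ((1 + N z) ^+ n))).
  rewrite ler_ln ?posrE ?exprn_gt0//; last by rewrite ltr_pwDl.
  apply: (le_trans (modulusB1_le _)); rewrite modulusX.
  rewrite -[n]prednK// !exprS.
  have b : N z ^+ n.-1 <= (1 + N z) ^+ n.-1 by rewrite lerXn2r ?nnegrE ?addr_ge0// lerDr.
  have b1 : 1 <= (1 + N z) ^+ n.-1 by rewrite exprn_ege1// lerDl.
  by rewrite mulrDl mul1r lerD// ler_wpM2l.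
rewrite lnXn ?ltr_pwDl// -[leLHS]mulr_natl ler_wpM2l//.
by apply: le_ln1Dx; rewrite (lt_le_trans _ z0)// oppr_lt0.
Qed.

Lemma log_dyadic_cvg c p : (fun k => log_dyadic c k p) @ \oo -->
  (Num.max 0 (ln (N (c * cp p))) : R).
Proof.
rewrite /log_dyadic; set z := c * cp p; have z0 := modulus_ge0 z.
have half0 : (fun k => 2^-1 ^+ k : R) @ \oo --> (0 : R).
  have : `|2^-1 : R| < 1 by rewrite ger0_norm//; lra.
  move=> /(cvg_geometric 1); rewrite (_ : geometric _ _ = (fun k => 2^-1 ^+ k))//.
  by apply/funext => k /=; rewrite mul1r.
(* inside the disc the modulus stays between two positive constants *)
have small (w : C) : N w < 1 -> (fun k => 2 ^- k * ln (N (1 - w ^+ (2 ^ k)))) @ \oo --> (0 : R).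
  move=> w1; have w0 := modulus_ge0 w.
  pose M := Num.max (- ln (1 - N w)) (ln 2).
  apply/norm_cvg0P.
  apply: (@squeeze_cvgr _ _ _ _ (fun=> 0) (fun k => 2^-1 ^+ k * M)).
  - apply: nearW => k /=; rewrite normr_ge0 /= normrM -exprVn ger0_norm ?exprn_ge0//.
    rewrite ler_wpM2l ?exprn_ge0//.
    have wk : N (w ^+ (2 ^ k)) <= N w.
      by rewrite modulusX -[leRHS]expr1 ler_wiXn2l ?(ltW w1)// expn_gt0.
    have lo : 1 - N w <= N (1 - w ^+ (2 ^ k)).
      apply: le_trans (modulusB1_ge _); apply: le_trans (ler_norm _).
      by rewrite lerD2l lerN2.
    have hi : N (1 - w ^+ (2 ^ k)) <= 2.
      by apply: (le_trans (modulusB1_le _)); lra.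
    have lo0 : 0 < 1 - N w by rewrite subr_gt0.
    have p0 := lt_le_trans lo0 lo.
    rewrite ler_norml; apply/andP; split; last first.
      by rewrite /M le_max; apply/orP; right; rewrite ler_ln ?posrE.
    by rewrite lerNl /M le_max; apply/orP; left; rewrite lerN2 ler_ln ?posrE.
  - exact: cvg_cst.
  - by rewrite -(mul0r M); apply: cvgM => //; exact: cvg_cst.
case: (boolP (N z == 1)) => [/eqP ->|z1]; first by rewrite ln1 maxxx; exact: cvg_cst.
have [z2|z2] := ltP (N z) 1.
  rewrite (_ : Num.max _ _ = 0); first exact: small.
  by apply/max_idPl; rewrite ln_le0// ltW.
have z3 : 1 < N z by rewrite lt_neqAle eq_sym z1.
have zn0 : z != 0 by apply: contraTneq z3 => ->; rewrite modulus0 ltr10.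
have Nz0 : 0 < N z by exact: lt_trans z3.
have zV : N z^-1 < 1.
  by rewrite [N _]ComplexField.Normc.normcV invf_lt1.
(* Outside the disc, -z^(2^k) is factored out: after scaling it contributes exactly ln |z|, and the
   remaining factor is the inner case for 1/z. *)
rewrite (_ : Num.max _ _ = ln (N z) + 0); last first.
  by rewrite addr0; apply/max_idPr; rewrite ln_ge0// ltW.
rewrite (_ : (fun k => _) = (fun k => ln (N z) + 2 ^- k * ln (N (1 - z^-1 ^+ (2 ^ k))))).
  have zs := small _ zV.
  by apply: (cvgD _ zs); exact: cvg_cst.
apply/funext => k.
have e : 1 - z ^+ (2 ^ k) = - (z ^+ (2 ^ k)) * (1 - z^-1 ^+ (2 ^ k)).
  by rewrite exprVn; field; rewrite expf_neq0.
have v1 : 1 - z^-1 ^+ (2 ^ k) != 0.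
  rewrite subr_eq0; apply: contraTneq zV => /(congr1 N).
  rewrite modulus1 modulusX => /esym/eqP.
  by rewrite pexpr_eq1 ?modulus_ge0 ?expn_gt0// => /eqP ->; rewrite ltxx.
rewrite e modulusM modulusN modulusX lnM ?posrE ?exprn_gt0 ?modulus_gt0//.
rewrite lnXn ?modulus_gt0// mulrDr; congr (_ + _).
by rewrite -[X in _ * X]mulr_natl natrX mulrA mulVf ?mul1r// expf_neq0.
Qed.

Lemma integrable_log_dyadic c k : c != 0 -> P.-integrable setT (EFin \o log_dyadic c k).
Proof.
move=> c0; apply: integrable_norm_le (integrable_log_bound (modulus_gt0 c0)) => //.
  exact: measurable_log_dyadic.
by move=> p _; apply: le_trans (norm_log_dyadic_le _ _ _) _; exact: ler_norm.
Qed.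

Lemma integral_rotation_mean (a b : R) (f g : plane -> R) : a ^+ 2 + b ^+ 2 = 1 ->
  measurable_fun setT f -> P.-integrable setT (EFin \o f) ->
  P.-integrable setT (EFin \o g) ->
  (forall p, f p + f (rotation a b p) = 2 * g p) ->
  (\int[P]_p (g p)%:E = \int[P]_p (f p)%:E)%E.
Proof.
move=> ab mf fi gi fg.
have E := integral_disc_rotation ab (meas_EFin mf).
pose h p := f (rotation a b p).
(* Integrability of the rotated function is read off from h = 2 g - f. *)
have hi : P.-integrable setT (EFin \o h).
  apply: (@eq_integrable _ _ _ P setT measurableT (fun p => 2%:E * (g p)%:E + (-1)%:E * (f p)%:E)%E).
    move=> p _; rewrite -!EFinM -EFinD; congr EFin.
    by rewrite -fg /h; ring.
  apply: integrableD => //; exact: integrableZl.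
have F : (\int[P]_p h p = \int[P]_p f p)%R.
  apply: EFin_inj.
  by rewrite -(integral_RintegralE measurableT hi) -(integral_RintegralE measurableT fi).
have G : 2 * (\int[P]_p g p)%R + 0 * (\int[P]_p f p)%R + 0 * (\int[P]_p f p)%R =
    1 * (\int[P]_p f p)%R + 1 * (\int[P]_p h p)%R + 0 * (\int[P]_p f p)%R.
  apply: EFin_inj; rewrite -(integral_lin3 2 0 0 measurableT gi fi fi).
  rewrite -(integral_lin3 1 1 0 measurableT fi hi fi).
  by apply: eq_integral => p _; rewrite -fg /h; congr EFin; ring.
rewrite (integral_RintegralE measurableT fi) (integral_RintegralE measurableT gi).
congr EFin; move: G; rewrite F; lra.
Qed.

Lemma integral_log_dyadic c k : c != 0 ->
  (\int[P]_p (log_dyadic c k p)%:E = \int[P]_p (log_dyadic c 0 p)%:E)%E.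
Proof.
move=> c0; elim: k => [//|k <-].
apply: (integral_rotation_mean _ _ _ _ (log_dyadic_mean c k)).
- by apply: Re_Im_modulus1; exact: modulus_half_turn_root.
- exact: measurable_log_dyadic.
- exact: integrable_log_dyadic.
- exact: integrable_log_dyadic.
Qed.

Lemma integral_log_dyadic0 c : c != 0 ->
  (\int[P]_p (log_dyadic c 0 p)%:E = \int[P]_p (Num.max 0 (ln (N (c * cp p))))%:E)%E.
Proof.
move=> c0.
have mcp : measurable_complex (fun p : plane => c * cp p).
  apply: measurable_complexM; first exact: measurable_complex_cst.
  by split; [exact: measurable_fst|exact: measurable_snd].
have [] := @dominated_convergence _ _ _ P setT measurableT
  (fun k p => (log_dyadic c k p)%:E) (fun p => (Num.max 0 (ln (N (c * cp p))))%:E)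
  (EFin \o log_bound (N c)).
- by move=> k; apply: meas_EFin; exact: measurable_log_dyadic.
- apply: meas_EFin; apply: meas_max; first exact: measurable_cst.
  by apply: meas_ln; exact: measurable_modulus.
- apply: aeW => p _; apply: cvg_EFin; first exact: nearW.
  exact: log_dyadic_cvg.
- exact: integrable_log_bound (modulus_gt0 c0).
- by apply: aeW => p k _ /=; rewrite lee_fin norm_log_dyadic_le.
move=> _ _ H.
have : (fun k => \int[P]_p (log_dyadic c k p)%:E)%E @ \oo -->
    (\int[P]_p (log_dyadic c 0 p)%:E)%E.
  rewrite (_ : (fun k => _) = (fun=> \int[P]_p (log_dyadic c 0 p)%:E)%E).
    exact: cvg_cst.
  by apply/funext => k; exact: integral_log_dyadic.
by move/cvg_unique : H => H /H ->.
Qed.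

End jensen.

(** * Mean logarithms of affine forms on the disc *)

Section affine_logarithms.
Variable R : realType.
Notation mu := (@lebesgue_measure R).
Notation plane := (plane R).
Notation P := (@disc_prob R).
Notation cp := (@complex_of_plane R).
Notation N := (@modulus R).
Notation C := (R[i]).

Lemma ae_integrable (f g : plane -> R) : measurable_fun setT f ->
  P.-integrable setT (EFin \o g) -> {ae P, forall p, f p = g p} ->
  P.-integrable setT (EFin \o f).
Proof.
move=> mf gi fg; apply/integrableP; split; first exact: meas_EFin.
have /integrableP[mg] := gi; congr (_ < _)%E.
apply: ae_eq_integral => //.
- by apply: measurableT_comp.
- by apply: measurableT_comp => //; exact: meas_EFin.
by apply: filterS fg => p /= -> _.
Qed.

Lemma ae_Rintegral (f g : plane -> R) : measurable_fun setT f -> measurable_fun setT g ->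
  {ae P, forall p, f p = g p} -> (\int[P]_p f p = \int[P]_p g p)%R.
Proof.
move=> mf mg fg; congr fine; apply: ae_eq_integral => //.
- exact: meas_EFin.
- exact: meas_EFin.
by apply: filterS fg => p /= -> _.
Qed.

Lemma integrable_disc_cst (c : R) : P.-integrable setT (EFin \o (fun=> c)).
Proof. by apply: (@integrable_disc_bounded _ _ `|c|). Qed.

Definition mean_log_rad : R := (\int[P]_p ln (rad p))%R.

Definition mean_dist_log_rad (v : R) : R := (\int[P]_p `|v + ln (rad p)|)%R.

Lemma integrable_dist_log_rad v : P.-integrable setT (EFin \o (fun p => `|v + ln (rad p)|)).
Proof.
have i1 := integrable_disc_cst v; have i2 := integrable_ln_rad R.
have := integrable_abse (integrableD measurableT i1 i2).
by apply: eq_integrable => // p _.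
Qed.

Lemma measurable_complex_cp : measurable_complex (fun p : plane => cp p).
Proof. by split; [exact: measurable_fst|exact: measurable_snd]. Qed.

Lemma Rintegral_log_dyadic0 c : c != 0 ->
  (\int[P]_p log_dyadic c 0 p = \int[P]_p Num.max 0 (ln (N (c * cp p))))%R.
Proof. by move=> c0; congr fine; exact: integral_log_dyadic0. Qed.

(** Here max(0, w) = (w + |w|) / 2 with w = ln |c| + ln |u|; the logarithm of the product splits off
    the null set u = 0. *)
Lemma Rintegral_log_dyadic c : c != 0 ->
  (\int[P]_p log_dyadic c 0 p =
   2^-1 * (ln (N c) + mean_log_rad) + 2^-1 * mean_dist_log_rad (ln (N c)))%R.
Proof.
move=> c0; rewrite Rintegral_log_dyadic0//.
have mcp := measurable_complexM (measurable_complex_cst plane c) measurable_complex_cp.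
have mrad := @measurable_rad R.
pose f p := (2^-1 * ln (N c) * 1 + 2^-1 * ln (rad p) + 2^-1 * `|ln (N c) + ln (rad p)|)%R.
rewrite (@ae_Rintegral _ f); last 3 first.
- apply: meas_max; first exact: measurable_cst.
  by apply: meas_ln; exact: measurable_modulus.
- by rewrite /f; meas.
- apply: filterS (disc_prob_ae_neq (0 : R)) => p p0.
  rewrite modulusM modulus_cp lnM ?posrE ?modulus_gt0//; last first.
    by rewrite lt_neqAle eq_sym p0 rad_ge0.
  rewrite /f; set w := ln (N c) + _ => /=; rewrite mulr1 -mulrDr -/w -mulrDr.
  by have [w0|w0] := leP 0 w; [rewrite ger0_norm//|rewrite ltr0_norm//]; lra.
apply: EFin_inj; rewrite -integral_RintegralE//.
  rewrite integral_lin3//.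
  - by rewrite integral_disc_cst mulr1 -/mean_log_rad mulrDr.
  - exact: integrable_disc_cst.
  - exact: integrable_ln_rad.
  - exact: integrable_dist_log_rad.
have i1 := integrableZl measurableT (2^-1 * ln (N c)) (integrable_disc_cst 1).
have i2 := integrableZl measurableT (2^-1) (integrable_ln_rad R).
have i3 := integrableZl measurableT (2^-1) (integrable_dist_log_rad (ln (N c))).
by apply: eq_integrable (integrableD measurableT (integrableD measurableT i1 i2) i3).
Qed.

(** Writing a + u b = a (1 - c u) with c = - b / a reduces to Jensen's formula. Off the null circle
    |u| = 1/|c| the form does not vanish, so [lne] takes the finite value [ln] there and
    [log_dyadic] is not at its default value. *)
Lemma integral_lne_affine (a b : C) (K : R) : a != 0 -> b != 0 ->
  (\int[P]_p (K%:E - lne (N (a + cp p * b))%:E) =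
  (K - 2^-1 * (ln (N a) + ln (N b) + mean_log_rad)
     - 2^-1 * mean_dist_log_rad (ln (N b) - ln (N a)))%:E)%E.
Proof.
move=> a0 b0; pose c := - (b / a).
have c0 : c != 0 by rewrite oppr_eq0 mulf_neq0// invr_eq0.
have Na := modulus_gt0 a0; have Nb := modulus_gt0 b0; have Nc := modulus_gt0 c0.
have ml := measurable_log_dyadic c 0.
have il := integrable_log_dyadic 0 c0.
have NcE : ln (N c) = ln (N b) - ln (N a).
  rewrite /c modulusN modulusM [N a^-1]ComplexField.Normc.normcV.
  by rewrite ln_div ?posrE.
transitivity (\int[P]_p (((K - ln (N a)) * 1 + (-1) * log_dyadic c 0 p + 0 * 1)%R)%:E)%E.
  apply: ae_eq_integral => //.
  - apply: meas_adde; first exact: measurable_cst.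
    apply: meas_oppe; apply: meas_lne; apply: measurable_modulus.
    apply: measurable_complexD; first exact: measurable_complex_cst.
    apply: measurable_complexM; first exact: measurable_complex_cp.
    exact: measurable_complex_cst.
  - by meas.
  apply: filterS (disc_prob_ae_neq ((N c)^-1)) => p p1 _.
  have z1 : N (c * cp p) != 1.
    by apply: contra p1; rewrite modulusM modulus_cp => /eqP H;
      rewrite -[X in _ == X]mul1r -H mulrAC divff ?mul1r// gt_eqF.
  have w0 : 1 - c * cp p != 0.
    by rewrite subr_eq0; apply: contra z1 => /eqP <-; rewrite modulus1.
  have -> : a + cp p * b = a * (1 - c * cp p) by rewrite /c; field.
  rewrite modulusM lne_EFin ?mulr_gt0 ?modulus_gt0// lnM ?posrE ?modulus_gt0//.
  rewrite /log_dyadic (negbTE z1) expn0 !expr1 -EFinB; congr EFin.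
  by rewrite expr0 invr1; ring.
rewrite (integral_lin3 _ _ _ measurableT (integrable_disc_cst 1) il (integrable_disc_cst 1)).
congr EFin; rewrite Rintegral_log_dyadic// integral_disc_cst NcE; lra.
Qed.

Lemma modulus1Dcp p : N (1 + cp p) = rad (1 + p.1, p.2).
Proof. by case: p => x y; rewrite /modulus/rad/= add0r. Qed.

Lemma modulus1Bcp p : N (1 - cp p) = rad (1 - p.1, p.2).
Proof. by case: p => x y; rewrite /modulus/rad/= add0r sqrrN. Qed.

(** By Jensen the mean is that of max(0, ln |u|), which vanishes on the disc. The cases s = 1 and s
    = -1 make the logarithms of 1 - x and 1 + x average to zero. *)
Lemma integral_log_unimodular (s : C) : N s = 1 ->
  P.-integrable setT (EFin \o (fun p => ln (N (1 - s * cp p)))) /\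
  (\int[P]_p ln (N (1 - s * cp p)) = 0)%R.
Proof.
move=> s1; have s0 : s != 0.
  by apply/eqP => s0; move: s1; rewrite s0 modulus0 => /esym/eqP; rewrite oner_eq0.
have mf : measurable_fun setT (fun p => ln (N (1 - s * cp p))).
  apply: meas_ln; apply: measurable_modulus; apply: measurable_complexD.
    exact: measurable_complex_cst.
  apply: measurable_complexN; apply: measurable_complexM.
    exact: measurable_complex_cst.
  exact: measurable_complex_cp.
have e : {ae P, forall p, ln (N (1 - s * cp p)) = log_dyadic s 0 p}.
  apply: filterS (disc_prob_ae_neq (1 : R)) => p p1.
  rewrite /log_dyadic modulusM s1 mul1r modulus_cp (negbTE p1).
  by rewrite expn0 !expr1 expr0 invr1 mul1r.
split; first exact: ae_integrable mf (integrable_log_dyadic 0 s0) e.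
rewrite (ae_Rintegral mf (measurable_log_dyadic s 0) e) Rintegral_log_dyadic0//.
rewrite (@ae_Rintegral _ (fun=> 0)) ?integral_disc_cst//.
- apply: meas_max; first exact: measurable_cst.
  apply: meas_ln; apply: measurable_modulus; apply: measurable_complexM.
    exact: measurable_complex_cst.
  exact: measurable_complex_cp.
- apply: filterS (disc_prob_ae_lt1 R) => p p1.
  by apply/max_idPl; rewrite modulusM s1 mul1r modulus_cp ln_le0// ltW.
Qed.

Lemma integrable_log_1D : P.-integrable setT (EFin \o (fun p => ln (rad (1 + p.1, p.2)))).
Proof.
have N1 : N (- 1) = 1 by rewrite modulusN modulus1.
have [+ _] := integral_log_unimodular N1.
apply: eq_integrable => // p _.
have e : N (1 - -1 * cp p) = rad (1 + p.1, p.2) by rewrite mulN1r opprK modulus1Dcp.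
exact: (congr1 (fun x => (ln x)%:E) e).
Qed.

Lemma integral_log_1D : (\int[P]_p ln (rad (1 + p.1, p.2)) = 0)%R.
Proof.
have N1 : N (- 1) = 1 by rewrite modulusN modulus1.
have [_ <-] := integral_log_unimodular N1.
by apply: eq_Rintegral => p _; rewrite mulN1r opprK modulus1Dcp.
Qed.

Lemma integrable_log_1B : P.-integrable setT (EFin \o (fun p => ln (rad (1 - p.1, p.2)))).
Proof.
have [+ _] := integral_log_unimodular (modulus1 R).
apply: eq_integrable => // p _.
have e : N (1 - 1 * cp p) = rad (1 - p.1, p.2) by rewrite mul1r modulus1Bcp.
exact: (congr1 (fun x => (ln x)%:E) e).
Qed.

Lemma integral_log_1B : (\int[P]_p ln (rad (1 - p.1, p.2)) = 0)%R.
Proof.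
have [_ <-] := integral_log_unimodular (modulus1 R).
by apply: eq_Rintegral => p _; rewrite mul1r modulus1Bcp.
Qed.

Lemma integrable_log_ratio : P.-integrable setT (EFin \o @log_ratio R).
Proof.
by apply: eq_integrable (integrableB measurableT integrable_log_1B integrable_log_1D).
Qed.

End affine_logarithms.

(** * Fourier representation of the absolute value *)

Section fourier_modulus.
Variable R : realType.
Notation mu := (@lebesgue_measure R).
Notation pos := (`]0%R, +oo[%classic : set R).
Local Open Scope ereal_scope.

Let mpos : measurable pos. Proof. by []. Qed.

Lemma normr_sin_le (x : R) : (`|sin x| <= `|x|)%R.
Proof.
wlog x0 : x / (0 <= x)%R.
  by move=> H; have [/H//|/ltW x0] := leP 0%R x; rewrite -normrN -sinN -(normrN x) H// oppr_ge0.
have d y : y \in `]0%R, x[ -> is_derive y 1%R sin (cos y) by move=> _; exact: is_derive_sin.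
have cs : {within `[0%R, x], continuous (@sin R)}%classic.
  by apply: continuous_subspaceT => y; exact: continuous_sin.
have [c _] := MVT_segment x0 d cs.
by rewrite sin0 !subr0 => ->; rewrite normrM ler_piMl// cos_max.
Qed.

Lemma onesubcos_le_sqr (x : R) : (1 - cos x <= x ^+ 2 / 2)%R.
Proof.
have -> : (cos x = cos ((x / 2) *+ 2))%R by congr cos; rewrite -mulr_natr; field.
rewrite cos_mulr2n.
have := normr_sin_le (x / 2)%R; rewrite -ler_sqr ?nnegrE// !real_normK ?num_real// sin2cos2.
rewrite exprMn => H.
have -> : (cos (x / 2) ^+ 2 *+ 2 = 2 * cos (x / 2) ^+ 2)%R by rewrite mulr_natl.
by move: H; rewrite [(2^-1 ^+ 2)%R](_ : _ = 4^-1)%R; [lra|rewrite exprVn -natrX].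
Qed.

Lemma onesubcos_ge0 (x : R) : (0 <= 1 - cos x)%R.
Proof. by rewrite subr_ge0 cos_le1. Qed.

Lemma onesubcos_le2 (x : R) : (1 - cos x <= 2)%R.
Proof. by have := cos_geN1 x; lra. Qed.

(** The quadratic bound x^2 / 2 suffices for |x| <= 2, and the trivial bound 2 beyond. *)
Lemma onesubcos_le_norm (x : R) : (1 - cos x <= `|x|)%R.
Proof.
have [x2|x2] := leP 2%R `|x|%R; first exact: le_trans (onesubcos_le2 x) x2.
apply: (le_trans (onesubcos_le_sqr x)); rewrite -real_normK ?num_real//.
have := normr_ge0 x; set y := `|x|%R in x2 *; rewrite expr2 => y0; nra.
Qed.

(** A vanishing integral would force f = 0 almost everywhere on an interval of positive length. *)
Lemma integral_gt0_itv (D : set R) (f : R -> \bar R) (a b : R) : (a < b)%R ->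
  measurable D -> `]a, b[%classic `<=` D -> measurable_fun [set: R] f ->
  (forall x, D x -> 0 <= f x) -> (forall x, (a < x < b)%R -> 0 < f x) ->
  0 < \int[mu]_(x in D) f x.
Proof.
move=> ab mD sD mf f0 fgt0; rewrite lt_neqAle integral_ge0// andbT eq_sym.
apply/eqP => I0.
have J0 : \int[mu]_(x in `]a, b[) `|f x| = 0.
  apply/eqP; rewrite eq_le; apply/andP; split; last exact: integral_ge0.
  rewrite -I0 [leLHS](_ : _ = \int[mu]_(x in `]a, b[) f x); last first.
    apply: eq_integral => x; rewrite inE/= in_itv/= => xab.
    by rewrite gee0_abs// ltW// fgt0.
  by apply: ge0_subset_integral => //; exact: measurable_funTS.
have mab : measurable_fun (`]a, b[%classic : set R) f by exact: measurable_funTS.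
have [N [mN N0 sN]] := (ae_eq_integral_abs mu (measurable_itv `]a, b[) mab).1 J0.
have : mu `]a, b[%classic <= mu N.
  apply: le_measure; rewrite ?inE//; apply: subset_trans sN => x/= xab.
  move=> /(_ xab) fx0; have := fgt0 x; rewrite fx0 ltxx; move: xab; rewrite in_itv/= => xab.
  by move=> /(_ xab).
have -> : mu N = 0 by exact: N0.
have -> : mu `]a, b[%classic = (b - a)%:E.
  by apply: etrans (lebesgue_measure_itv _) _; rewrite /= lte_fin ab -EFinB.
by rewrite lee_fin subr_le0 leNgt ab.
Qed.

Lemma integrable_onesubcos : mu.-integrable pos (EFin \o (fun t => (1 - cos t) / t ^+ 2)%R).
Proof.
have i0 : mu.-integrable pos (EFin \o (fun t => (1 + t ^+ 2)^-1)%R).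
  apply: (@integrableS _ _ _ mu setT) => //.
  apply/integrableP; split; first by apply: meas_EFin; meas.
  rewrite (_ : \int[mu]_x _ = pi%:E) ?ltry// -integral_slope.
  by apply: eq_integral => t _; rewrite abse_EFin ger0_norm// invr_ge0 addr_ge0// sqr_ge0.
(* The constant is 1/2 + 2: adding 1 - cos t <= t^2 / 2 and (1 - cos t) t^2 <= 2 t^2 gives (1 - cos
   t) (1 + t^2) <= (5/2) t^2. *)
have i1 : mu.-integrable pos (EFin \o (fun t => 5 / 2 * (1 + t ^+ 2)^-1)%R).
  apply: (@eq_integrable _ _ _ mu pos mpos (fun t => (5 / 2)%:E * ((1 + t ^+ 2)^-1)%:E)).
    by move=> t _; rewrite -EFinM.
  exact: integrableZl i0.
apply: integrable_norm_le i1 => //; first by meas.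
move=> t; rewrite posE => t0.
have T0 : (0 < t ^+ 2)%R by rewrite exprn_gt0.
rewrite !ger0_norm; last 2 first.
- by rewrite mulr_ge0// invr_ge0 addr_ge0// ltW.
- by rewrite divr_ge0 ?onesubcos_ge0// ltW.
rewrite ler_pdivrMr// mulrAC ler_pdivlMr; last by rewrite addr_gt0.
have := onesubcos_le_sqr t; have := onesubcos_le2 t; have := onesubcos_ge0 t.
set c := (1 - cos t)%R; set T := (t ^+ 2)%R in T0 * => c0 c2 cT; nra.
Qed.

Definition fourier_cst : R := (\int[mu]_(t in pos) ((1 - cos t) / t ^+ 2))%R.

Lemma fourier_cstE :
  \int[mu]_(t in pos) ((1 - cos t) / t ^+ 2)%:E = fourier_cst%:E.
Proof. by rewrite /fourier_cst -integral_RintegralE//; exact: integrable_onesubcos. Qed.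

Lemma cos_lt1 (x : R) : (0 < x <= 2)%R -> (cos x < 1)%R.
Proof.
move=> /andP[x0 x2]; rewrite -(@cos0 R).
by rewrite ltr_cos ?in_itv/= ?lexx ?pi_ge0 ?(ltW x0) ?(le_trans x2 (pi_ge2 R)).
Qed.

Lemma fourier_cst_gt0 : (0 < fourier_cst)%R.
Proof.
rewrite -lte_fin -fourier_cstE; apply: (@integral_gt0_itv _ _ 0%R 1%R) => //.
- by move=> x /=; rewrite !in_itv/= andbT => /andP[].
- by meas.
- by move=> x; rewrite posE => x0; rewrite lee_fin divr_ge0 ?sqr_ge0 ?onesubcos_ge0.
- move=> x /andP[x0 x1]; rewrite lte_fin divr_gt0 ?exprn_gt0// subr_gt0 cos_lt1// x0/=.
  by rewrite (le_trans (ltW x1))// ler1n.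
Qed.

(** The dilation of t by |v| brings out one factor |v|: two from 1/t^2, less one from dt. The sign
    of v disappears as cos is even. *)
Lemma fourier_abs (v : R) :
  \int[mu]_(t in pos) ((1 - cos (t * v)) / t ^+ 2)%:E = (fourier_cst * `|v|)%:E.
Proof.
have [->|v0] := eqVneq v 0%R.
  rewrite normr0 mulr0 integral0_eq// => t _.
  by rewrite mulr0 cos0 subrr mul0r.
have k0 : (0 < `|v|)%R by rewrite normr_gt0.
have mf : measurable_fun [set: R] (fun t : R => ((1 - cos t) / t ^+ 2)%:E) by meas.
have f0 (t : R) : (0 < t)%R -> 0 <= ((1 - cos t) / t ^+ 2)%:E.
  by move=> t0; rewrite lee_fin divr_ge0 ?sqr_ge0 ?onesubcos_ge0.
rewrite EFinM -fourier_cstE muleC -(ge0_integral_dilation_pos k0 mf f0) muleA -EFinM.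
rewrite -ge0_integralZl//; last 2 first.
- by meas.
- by move=> t; rewrite posE => t0; apply: f0; rewrite mulr_gt0.
apply: eq_integral => t; rewrite inE posE => t0; rewrite -EFinM; congr EFin.
have -> : cos (t * v) = cos (`|v| * t).
  by rewrite -cos_norm normrM (gtr0_norm t0) mulrC.
by field; rewrite !gt_eqF.
Qed.

End fourier_modulus.

(** * Averages of phases over the disc and the averaged distance *)

Section phase_means.
Variable R : realType.
Notation mu := (@lebesgue_measure R).
Notation pos := (`]0%R, +oo[%classic : set R).
Notation plane := (plane R).
Notation P := (@disc_prob R).
Notation psi := (@cf_log_ratio R).
Notation Y := (@log_ratio R).
Local Open Scope ereal_scope.

Let mpos : measurable pos. Proof. by []. Qed.
Let mrad : measurable_fun setT (@rad R). Proof. exact: measurable_rad. Qed.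
Let mY : measurable_fun setT Y. Proof. exact: measurable_log_ratio. Qed.

(** Adding 1 makes the bounded integrand nonnegative, so that the measurability of partial integrals
    in Tonelli's theorem applies. *)
Lemma measurable_disc_mean (F : R * plane -> R) : measurable_fun setT F ->
  (forall z, `|F z| <= 1)%R ->
  measurable_fun [set: R] (fun t => \int[P]_p F (t, p))%R.
Proof.
move=> mF F1.
have F0 z : 0 <= (1 + F z)%:E.
  by rewrite lee_fin -lerBlDl sub0r; have := F1 z; rewrite ler_norml => /andP[].
have mG : measurable_fun setT (fun z => (1 + F z)%:E) by meas.
have mH := measurable_fun_fubini_tonelli_F (m2 := P) (fun z => (1 + F z)%:E) mG F0.
rewrite (_ : (fun t => _) = (fun t => fine (\int[P]_p (1 + F (t, p))%:E) - 1)%R).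
  by apply: meas_add; [exact: (measurableT_comp (fine_measurable measurableT) mH)|exact: meas_cst].
apply/funext => t.
have mFt : measurable_fun setT (fun p => F (t, p)) by meas.
have iF : P.-integrable setT (EFin \o (fun p => F (t, p))).
  exact: (@integrable_disc_bounded _ _ 1%R).
have i1 := integrable_disc_cst (1%R : R).
have := @RintegralD _ _ _ P setT (fun=> 1%R) (fun p => F (t, p)) measurableT i1 iF.
rewrite integral_disc_cst -[X in (fine X)]/(\int[P]_p (1 + F (t, p))%:E).
by rewrite /Rintegral => ->; rewrite addrAC subrr add0r.
Qed.

Lemma measurable_psi : measurable_fun [set: R] psi.
Proof.
apply: (measurable_disc_mean (F := fun z => cos (z.1 * Y z.2)%R)).
  by meas.
by move=> z; exact: cos_max.
Qed.

Definition cf_log_rad (t : R) : R := (\int[P]_p cos (t * ln (rad p)))%R.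
(** Since log |u| is not symmetric, this sine transform enters [phase t v] for general v; it drops
    out at v = 0. *)
Definition sf_log_rad (t : R) : R := (\int[P]_p sin (t * ln (rad p)))%R.

Lemma measurable_cf_log_rad : measurable_fun [set: R] cf_log_rad.
Proof.
apply: (measurable_disc_mean (F := fun z => cos (z.1 * ln (rad z.2))%R)).
  by meas.
by move=> z; exact: cos_max.
Qed.

Lemma measurable_sf_log_rad : measurable_fun [set: R] sf_log_rad.
Proof.
apply: (measurable_disc_mean (F := fun z => sin (z.1 * ln (rad z.2))%R)).
  by meas.
by move=> z; exact: sin_max.
Qed.

Lemma integrable_cos_rad t v : P.-integrable setT (EFin \o (fun p => cos (t * (v + ln (rad p)))%R)).
Proof. by apply: integrable_cos_disc; meas. Qed.

Lemma normr_disc_mean_le1 (f : plane -> R) : measurable_fun setT f ->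
  (forall p, `|f p| <= 1)%R -> (`|\int[P]_p f p| <= 1)%R.
Proof.
move=> mf f1; have fi := @integrable_disc_bounded R f 1%R mf f1.
apply: (le_trans (le_normr_Rintegral measurableT fi)).
rewrite -[leRHS](@integral_disc_cst R 1%R); apply: le_Rintegral => //.
- exact: integrable_abse fi.
- exact: integrable_disc_cst.
Qed.

Definition phase (t v : R) : R := (\int[P]_p cos (t * (v + ln (rad p))))%R.

Lemma phaseE t v : phase t v = (cf_log_rad t * cos (t * v) - sf_log_rad t * sin (t * v))%R.
Proof.
apply: EFin_inj; rewrite -integral_RintegralE//; last exact: integrable_cos_rad.
have mt : measurable_fun setT (fun p : plane => t * ln (rad p))%R by meas.
have ic := integrable_cos_disc mt; have si := integrable_sin_disc mt.
transitivity (\int[P]_p (cos (t * v) * cos (t * ln (rad p)) +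
    (- sin (t * v)) * sin (t * ln (rad p)) + 0 * cos (t * ln (rad p)))%:E).
  by apply: eq_integral => p _; rewrite mulrDr cosD; congr EFin; ring.
rewrite (integral_lin3 _ _ _ measurableT ic si ic); congr EFin.
by rewrite -/(cf_log_rad t) -/(sf_log_rad t); ring.
Qed.

Lemma normr_phase_le1 t v : (`|phase t v| <= 1)%R.
Proof.
by apply: normr_disc_mean_le1 => [|p]; [meas|exact: cos_max].
Qed.

(** Averaging over p kills the sine term, Y being symmetric, so each shift by an independent copy of
    Y multiplies [phase t v] by [psi t]. *)
Lemma phase_shift t v p : phase t (v + Y p)%R = (phase t v * cos (t * Y p) +
  (- (cf_log_rad t * sin (t * v) + sf_log_rad t * cos (t * v))) * sin (t * Y p))%R.
Proof. by rewrite !phaseE mulrDr cosD sinD; ring. Qed.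

Lemma psi_le1 t : (psi t <= 1)%R.
Proof.
apply: le_trans (ler_norm _) _; apply: normr_disc_mean_le1 => [|p]; first by meas.
exact: cos_max.
Qed.

Lemma psiX_phase_le1 n t v : (psi t ^+ n * phase t v <= 1)%R.
Proof.
have := normr_phase_le1 t v; rewrite ler_norml => /andP[_ f1].
apply: (@le_trans _ _ (psi t ^+ n * 1)%R).
  by rewrite ler_wpM2l// exprn_ge0// cf_log_ratio_ge0.
by rewrite mulr1 exprn_ile1// ?cf_log_ratio_ge0// psi_le1.
Qed.

(* [phase_dist n v] is [fourier_cst] times E |v + Y_1 + ... + Y_n + log |u||. *)
Definition phase_dist (n : nat) (v : R) : \bar R :=
  \int[mu]_(t in pos) ((1 - psi t ^+ n * phase t v) / t ^+ 2)%:E.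

Lemma phase_dist_integrand_ge0 n v t : pos t -> 0 <= ((1 - psi t ^+ n * phase t v) / t ^+ 2)%:E.
Proof. by move=> _; rewrite lee_fin divr_ge0 ?sqr_ge0// subr_ge0 psiX_phase_le1. Qed.

Lemma measurable_phase_shift n v : measurable_fun setT
  (fun z : plane * R => ((1 - psi z.2 ^+ n * phase z.2 (v + Y z.1)%R) / z.2 ^+ 2)%:E).
Proof.
have m1 := measurable_psi; have m2 := measurable_cf_log_rad; have m3 := measurable_sf_log_rad.
rewrite (_ : (fun z => _) = (fun z : plane * R => ((1 - psi z.2 ^+ n *
   (cf_log_rad z.2 * cos (z.2 * (v + Y z.1)) - sf_log_rad z.2 * sin (z.2 * (v + Y z.1))))
   / z.2 ^+ 2)%:E)); last by apply/funext => z; rewrite phaseE.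
by meas.
Qed.

Lemma phase_dist0 v :
  phase_dist 0 v = (fourier_cst R * mean_dist_log_rad v)%:E.
Proof.
pose F (z : R * plane) : \bar R := ((1 - cos (z.1 * (v + ln (rad z.2)))) / z.1 ^+ 2)%:E.
have mF : measurable_fun setT F by rewrite /F; meas.
have F0 t p : pos t -> setT p -> 0 <= F (t, p).
  by move=> _ _; rewrite lee_fin divr_ge0 ?sqr_ge0 ?onesubcos_ge0.
transitivity (\int[mu]_(t in pos) \int[P]_p F (t, p)).
  apply: eq_integral => t; rewrite inE posE => t0.
  have i1 := integrable_disc_cst (1%R : R); have ic := integrable_cos_rad t v.
  transitivity (\int[P]_p (t ^- 2 * 1 + (- t ^- 2) * cos (t * (v + ln (rad p)))
      + 0 * 1)%:E).
    rewrite (integral_lin3 _ _ _ measurableT i1 ic i1) integral_disc_cst; congr EFin.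
    by rewrite -/(phase t v) expr0; ring.
  by apply: eq_integral => p _; rewrite /F/=; congr EFin; ring.
rewrite (ge0_integral_exchange (m1 := mu) (m2 := P) mpos measurableT mF F0).
transitivity (\int[P]_p ((fourier_cst R)%:E * `|v + ln (rad p)|%:E)).
  by apply: eq_integral => p _; rewrite /F/= -EFinM -fourier_abs.
rewrite ge0_integralZl//.
- by rewrite (integral_RintegralE measurableT (integrable_dist_log_rad v)).
- by meas.
- by rewrite lee_fin ltW// fourier_cst_gt0.
Qed.

Lemma phase_distS n v : \int[P]_p phase_dist n (v + Y p)%R = phase_dist n.+1 v.
Proof.
have mF := measurable_phase_shift n v.
rewrite /phase_dist.
rewrite (ge0_integral_exchange (m1 := P) (m2 := mu) measurableT mpos mF); last first.
  by move=> p t _ pt; exact: phase_dist_integrand_ge0.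
apply: eq_integral => t _ /=.
have mt : measurable_fun setT (fun p : plane => t * Y p)%R by meas.
have ic := integrable_cos_disc mt; have si := integrable_sin_disc mt.
have i1 := integrable_disc_cst (1%R : R).
set s := (- (cf_log_rad t * sin (t * v) + sf_log_rad t * cos (t * v)))%R.
transitivity (\int[P]_p (t ^- 2 * 1 + (- (psi t ^+ n * phase t v / t ^+ 2)) * cos (t * Y p)
      + (- (psi t ^+ n * s / t ^+ 2)) * sin (t * Y p))%:E).
  apply: eq_integral => p _; rewrite phase_shift -/s; congr EFin.
  by move: (psi t ^+ n)%R (phase t v) (t ^- 2)%R s (cos (t * Y p)%R) (sin (t * Y p)%R) => a b c d e f; ring.
rewrite (integral_lin3 _ _ _ measurableT i1 ic si) integral_disc_cst sin_log_ratio0.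
rewrite -/(psi t) (exprS (psi t) n); congr EFin.
by move: (psi t) (psi t ^+ n)%R (phase t v) (t ^- 2)%R s => a b c d e; ring.
Qed.

Lemma phase_dist_ge0 n v : 0 <= phase_dist n v.
Proof. by apply: integral_ge0 => t; exact: phase_dist_integrand_ge0. Qed.

(** Linear growth in v is stable under averaging over Y, since E |Y| is finite; each step only
    enlarges the constant. It makes [phase_dist] finite, so that taking [fine] loses nothing. *)
Lemma phase_dist_bound n : exists c : R, forall v,
  phase_dist n v <= (fourier_cst R * `|v| + c)%:E.
Proof.
have k0 := fourier_cst_gt0 R.
elim: n => [|n [c IHn]].
  exists (fourier_cst R * \int[P]_p `|ln (rad p)|)%R => v.
  rewrite phase_dist0 lee_fin -mulrDr ler_wpM2l ?(ltW k0)//.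
  have i1 := integrable_disc_cst (`|v|%R : R).
  have i2 := integrable_abse (integrable_ln_rad R).
  rewrite -(integral_disc_cst `|v|%R) -RintegralD//; apply: le_Rintegral => //.
  - exact: integrable_dist_log_rad.
  - have := integrableD measurableT i1 i2; exact: eq_integrable.
  - by move=> p _; exact: ler_normD.
exists (fourier_cst R * \int[P]_p `|Y p| + c)%R => v.
rewrite -phase_distS.
have iY := integrable_abse (integrable_log_ratio R).
apply: (@le_trans _ _ (\int[P]_p (fourier_cst R * `|Y p| + (fourier_cst R * `|v| + c) * 1 + 0 * 1)%:E)).
  apply: ge0_le_integral => //.
  - by move=> p _; exact: phase_dist_ge0.
  - apply: (ge0_measurable_integral_on (m2 := mu) (A := setT) (B := pos)
      (f := fun z : plane * R => ((1 - psi z.2 ^+ n * phase z.2 (v + Y z.1)%R) / z.2 ^+ 2)%:E)) => //.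
      exact: measurable_phase_shift.
    by move=> p t _ pt; exact: phase_dist_integrand_ge0.
  - by meas.
  - move=> p _; apply: (le_trans (IHn _)); rewrite lee_fin.
    by have := ler_wpM2l (ltW k0) (ler_normD v (Y p)); rewrite mulrDr; lra.
rewrite (integral_lin3 _ _ _ measurableT iY (integrable_disc_cst 1%R) (integrable_disc_cst 1%R)).
by rewrite lee_fin integral_disc_cst; lra.
Qed.

Lemma phase_dist_fin n v : phase_dist n v \is a fin_num.
Proof.
have [c H] := phase_dist_bound n.
by rewrite ge0_fin_numE ?phase_dist_ge0// (le_lt_trans (H v))// ltry.
Qed.

Lemma onesub_psiE t : (1 - psi t)%:E = \int[P]_p (1 - cos (t * Y p))%:E.
Proof.
have mt : measurable_fun setT (fun p : plane => t * Y p)%R by meas.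
have ic := integrable_cos_disc mt; have i1 := integrable_disc_cst (1%R : R).
transitivity (\int[P]_p (1 * 1 + (-1) * cos (t * Y p) + 0 * 1)%:E).
  rewrite (integral_lin3 _ _ _ measurableT i1 ic i1) integral_disc_cst.
  by rewrite -/(psi t); congr EFin; ring.
by apply: eq_integral => p _; congr EFin; ring.
Qed.

Lemma onesub_psi_le t : (0 < t)%R -> (1 - psi t <= t * \int[P]_p `|Y p|)%R.
Proof.
move=> t0; rewrite -lee_fin onesub_psiE.
have iY := integrable_abse (integrable_log_ratio R).
rewrite EFinM -integral_RintegralE// -ge0_integralZl//; last 2 first.
- by meas.
- by rewrite lee_fin ltW.
apply: ge0_le_integral => //.
- by meas.
- by meas.
move=> p _; rewrite -EFinM lee_fin.
by have := onesubcos_le_norm (t * Y p)%R; rewrite normrM (gtr0_norm t0).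
Qed.

(** The density of the log-ratio is positive everywhere, so it is enough that 1 - cos(t ln r) is
    positive on one interval of r. For 1 < r < e and t <= 2 the argument lies in ]0, 2], where cos <
    1. *)
Lemma psi_lt1 t : (0 < t <= 2)%R -> (psi t < 1)%R.
Proof.
move=> /andP[t0 t2]; rewrite -subr_gt0 -lte_fin onesub_psiE.
have mh : measurable_fun [set: R] (fun x : R => (1 - cos (t * x))%:E) by meas.
have mhY : measurable_fun setT (fun p => (1 - cos (t * Y p))%:E) by meas.
rewrite (ge0_integral_disc_prob mhY); last first.
  by move=> p; rewrite lee_fin onesubcos_ge0.
rewrite (ge0_integral_log_ratio mh); last by move=> x; rewrite lee_fin onesubcos_ge0.
rewrite mule_gt0// ?lte_fin ?invr_gt0 ?pi_gt0//.
pose G (z : R * R) : \bar R := (4 * z.2 / (1 + z.1 ^+ 2) /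
  (1 + 2 * slope_cos z.1 * z.2 + z.2 ^+ 2) ^+ 2)%:E * (1 - cos (t * ln z.2))%:E.
have mG : measurable_fun setT G by rewrite /G /slope_cos; meas.
have K0 x r : pos r -> (0 < 4 * r / (1 + x ^+ 2) / (1 + 2 * slope_cos x * r + r ^+ 2) ^+ 2)%R.
  rewrite posE => r0; have c0 := slope_cos_gt0 x.
  have d1 : (0 < 1 + x ^+ 2)%R by rewrite ltr_pwDl// sqr_ge0.
  have d2 : (0 < 1 + 2 * slope_cos x * r + r ^+ 2)%R.
    by rewrite addr_gt0 ?exprn_gt0// addr_gt0// !mulr_gt0.
  by rewrite divr_gt0 ?exprn_gt0// divr_gt0// mulr_gt0.
have G0 x r : setT x -> pos r -> 0 <= G (x, r).
  by move=> _ pr; rewrite /G -EFinM lee_fin mulr_ge0 ?onesubcos_ge0// ltW// K0.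
have mI := ge0_measurable_integral_on (m2 := mu) measurableT mpos mG G0.
apply: (@integral_gt0_itv _ _ _ 0%R 1%R) => //.
- by move=> x _; apply: integral_ge0 => r pr; exact: (G0 x r).
move=> x _; apply: (@integral_gt0_itv _ _ _ 1%R (expR 1)%R) => //.
- by rewrite expR_gt1.
- by move=> r/=; rewrite !in_itv/= andbT => /andP[r1 _]; exact: lt_trans r1.
- by rewrite /slope_cos; meas.
- by move=> r pr; exact: (G0 x r).
move=> r /andP[r1 re]; have r0 : (0 < r)%R by exact: lt_trans r1.
rewrite -EFinM lte_fin mulr_gt0//.
  by apply: K0; rewrite posE.
rewrite subr_gt0 cos_lt1//; apply/andP; split; first by rewrite mulr_gt0// ln_gt0.
have : (ln r <= 1)%R by rewrite -(expRK 1%R) ler_ln ?posrE ?expR_gt0// ltW.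
by have := ln_gt0 r1; nra.
Qed.

Lemma phase0 t : phase t 0%R = cf_log_rad t.
Proof. by rewrite phaseE mulr0 cos0 sin0 mulr1 mulr0 subr0. Qed.

Lemma mulr_bounded_cvg0 (g : R -> R) (M : R) : (forall x, `|g x| <= M)%R ->
  (x * g x @[x --> 0^'+] --> 0)%R.
Proof.
move=> gM.
have M0 : (0 <= M)%R by apply: le_trans (normr_ge0 _) (gM 0%R).
apply: norm_cvg0.
apply: (@squeeze_cvgr _ _ _ _ (cst 0%R) (fun x => x * M)%R).
- near=> x; rewrite normr_ge0 normrM (ger0_norm (_ : 0 <= x)%R)//= ler_wpM2l//.
- exact: cvg_cst.
- rewrite -[X in _ --> X](mul0r M); apply: cvgM; last exact: cvg_cst.
  exact: cvg_at_right_filter.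
Unshelve. all: by end_near.
Qed.

Lemma integral_mul_onecos_ln (t : R) :
  \int[mu]_(x in `[0%R, 1%R]) (x * (1 + cos (t * ln x)))%:E = (1 / 2 + 2 / (4 + t ^+ 2))%:E.
Proof.
have t4 : (4 + t ^+ 2 != 0)%R by rewrite gt_eqF// ltr_pwDl// sqr_ge0.
(* The antiderivative of x cos(t ln x) is the real part of x^(2 + it) / (2 + it), that is x^2 (2
   cos(t ln x) + t sin(t ln x)) / (4 + t^2). *)
pose H (x : R) : R := (2^-1 + (2 * cos (t * ln x) + t * sin (t * ln x)) / (4 + t ^+ 2))%R.
(* At 0 the factor [H] oscillates but stays bounded; grouping one x with it gives the limit 0 needed
   at the left endpoint. *)
pose F (x : R) : R := (x * (x * H x))%R.
pose M : R := (2 + `|t|)%R.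
have dln (x : R) : (0 < x)%R -> is_derive x 1%R (fun y => t * ln y)%R (t / x)%R.
  by move=> x0; have := is_derive1_ln x0 => ?; apply: is_derive_eq; rewrite /GRing.scale/=.
have dF (x : R) : (0 < x)%R -> is_derive x 1%R F (x * (1 + cos (t * ln x)))%R.
  move=> x0; have := dln x x0 => ?.
  have ? : is_derive x 1%R (fun y => cos (t * ln y))%R (- sin (t * ln x) * (t / x))%R.
    exact: is_derive1_comp.
  have ? : is_derive x 1%R (fun y => sin (t * ln y))%R (cos (t * ln x) * (t / x))%R.
    exact: is_derive1_comp.
  rewrite /F /H; apply: is_derive_eq; rewrite /GRing.scale/=.
  have x00 : (x != 0)%R by rewrite gt_eqF.
  by field; rewrite t4.
have b1 (x : R) : (`|1 + cos (t * ln x)| <= 2)%R.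
  by rewrite (le_trans (ler_normD _ _))// normr1 -[leRHS]/(1 + 1)%R lerD2l cos_max.
have b2 (x : R) : (`|H x| <= 2^-1 + M / (4 + t ^+ 2))%R.
  rewrite (le_trans (ler_normD _ _))// (ger0_norm (_ : 0 <= 2^-1)%R)// lerD2l normrM.
  rewrite normfV (gtr0_norm (_ : 0 < 4 + t ^+ 2)%R) ?ltr_pwDl ?sqr_ge0//.
  rewrite ler_wpM2r ?invr_ge0 ?addr_ge0 ?sqr_ge0// (le_trans (ler_normD _ _))// !normrM.
  by rewrite (gtr0_norm (_ : 0 < 2)%R)// lerD ?ler_piMr ?cos_max ?sin_max.
have cF (x : R) : (0 < x)%R -> {for x, continuous F}.
  move=> x0; apply: differentiable_continuous; apply/derivable1_diffP.
  by have := dF x x0 => ?; exact: ex_derive.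
have cf (x : R) : (0 < x)%R -> {for x, continuous (fun x : R => x * (1 + cos (t * ln x)) : R)%R}.
  move=> x0; apply: cvgM; first exact: cvg_id.
  apply: cvgD; first exact: cvg_cst.
  apply: continuous_comp; last exact: continuous_cos.
  by apply: cvgM; [exact: cvg_cst|exact: continuous_ln].
have F0 : (F 0 = 0)%R by rewrite /F mul0r.
have F1 : (F 1 = 1 / 2 + 2 / (4 + t ^+ 2))%R.
  by rewrite /F /H ln1 mulr0 cos0 sin0; field.
rewrite (@continuous_FTC2 _ _ F)//.
- by rewrite F0 F1 sube0.
- apply/continuous_within_itvP => //; split.
  + by move=> x; rewrite in_itv/= => /andP[x0 _]; exact: cf.
  + by rewrite mul0r; exact: mulr_bounded_cvg0 b1.
  + by apply: cvg_at_left_filter; exact: cf.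
- split.
  + by move=> x; rewrite in_itv/= => /andP[x0 _]; have := dF x x0 => ?; exact: ex_derive.
  + rewrite F0 -[X in _ --> X](mul0r 0%R); apply: cvgM; last exact: mulr_bounded_cvg0 b2.
    by apply: cvg_at_right_filter; exact: cvg_id.
  + by apply: cvg_at_left_filter; exact: cF.
- move=> x; rewrite in_itv/= => /andP[x0 _]; have := dF x x0 => ?.
  by rewrite derive1E derive_val.
Qed.

Lemma cf_log_radE t : cf_log_rad t = (4 / (4 + t ^+ 2))%R.
Proof.
have t4 : (4 + t ^+ 2 != 0)%R by rewrite gt_eqF// ltr_pwDl// sqr_ge0.
have c0 (x : R) : (0 <= 1 + cos (t * ln x))%R by rewrite -lerBlDl sub0r cos_geN1.
have mf : measurable_fun [set: R] (fun r => (1 + cos (t * ln r))%:E) by meas.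
have := ge0_integral_disc_prob_radial mf (fun x => c0 x).
rewrite (_ : \int[mu]_(r in _) _ = \int[mu]_(x in `[0%R, 1%R]) (x * (1 + cos (t * ln x)))%:E); last first.
  by rewrite integral_itv_bndo_bndc ?integral_itv_obnd_cbnd//; apply: measurable_funTS; meas.
rewrite integral_mul_onecos_ln -EFinM.
have mt : measurable_fun setT (fun p : plane => t * ln (rad p))%R by meas.
have ic := integrable_cos_disc mt; have i1 := integrable_disc_cst (1%R : R).
rewrite (_ : \int[P]_p _ = \int[P]_p (1 * 1 + 1 * cos (t * ln (rad p)) + 0 * 1)%:E); last first.
  by apply: eq_integral => p _; congr EFin; ring.
rewrite (integral_lin3 _ _ _ measurableT i1 ic i1) integral_disc_cst -/(cf_log_rad t).
move=> [h]; have -> : cf_log_rad t = (1 * 1 + 1 * cf_log_rad t + 0 * 1 - 1)%R by ring.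
by rewrite h; field.
Qed.

Lemma cf_log_rad_gt0 t : (0 < cf_log_rad t)%R.
Proof. by rewrite cf_log_radE divr_gt0// ltr_pwDl// sqr_ge0. Qed.

End phase_means.

(** * Peeling the variables of the polydisc *)

Section polydisc_integral.
Variable R : realType.
Notation plane := (plane R).
Notation dA := (@planar_measure R).
Notation disc := (@unit_disc R).
Notation N := (@modulus R).
Notation cp := (@complex_of_plane R).
Notation P := (@disc_prob R).
Notation psi := (@cf_log_ratio R).
Notation Y := (@log_ratio R).
Notation pdisc n := (@polydisc R n).
Local Open Scope ereal_scope.

Lemma measurable_complex_prod d (T : measurableType d) I (r : seq I) (F : I -> T -> R[i]) :
  (forall i, measurable_complex (F i)) -> measurable_complex (fun x => \prod_(i <- r) F i x)%R.
Proof.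
move=> mF; elim: r => [|i r IHr].
  rewrite (_ : (fun x => _) = fun=> 1%R); first exact: measurable_complex_cst.
  by apply/funext => x; rewrite big_nil.
rewrite (_ : (fun x => _) = (fun x => F i x * \prod_(i <- r) F i x)%R).
  exact: measurable_complexM.
by apply/funext => x; rewrite big_cons.
Qed.

Lemma measurable_polydisc n : measurable (pdisc n).
Proof.
rewrite (_ : pdisc n = \bigcap_(i in setT) ((@tnth _ plane ^~ i) @^-1` disc)).
  apply: fin_bigcap_measurable => // i _.
  rewrite -[X in measurable X]setTI; apply: measurable_tnth => //.
  exact: measurable_unit_disc.
by apply/seteqP; split=> t /= At i; [move=> _|]; exact: At.
Qed.

Lemma polydisc_cons n :
  @tuple_cons _ plane n @^-1` pdisc n.+1 = disc `*` pdisc n.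
Proof.
apply/seteqP; split=> [[x t] /= Axt|[x t] /= [A0 At] i].
  split; first exact: (Axt ord0).
  by move=> i; have := Axt (lift ord0 i); rewrite tnthS.
by case: (unliftP ord0 i) => [j ->|->//]; rewrite tnthS; exact: At.
Qed.

Lemma ge0_integral_polydiscS n (f : n.+1.-tuple plane -> \bar R) :
  measurable_fun setT f -> (forall z, pdisc n.+1 z -> 0 <= f z) ->
  \int[tuple_measure dA n.+1]_(z in pdisc n.+1) f z =
  \int[dA]_(x in disc) \int[tuple_measure dA n]_(t in pdisc n) f (tuple_cons (x, t)).
Proof.
move=> mf f0; have mcons := @measurable_tuple_cons _ plane n.
have mD := @measurable_polydisc n.
have f0' x t : disc x -> pdisc n t -> 0 <= f (tuple_cons (x, t)).
  move=> dx dt; apply: f0.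
  by have : (disc `*` pdisc n) (x, t) by []; rewrite -polydisc_cons.
have mft : measurable_fun setT (f \o @tuple_cons _ plane n) by exact: measurableT_comp.
rewrite -(ge0_integral_setX (m1 := dA) (m2 := tuple_measure dA n) (@measurable_unit_disc R) mD mft f0').
rewrite -polydisc_cons -ge0_integral_pushforward//.
- exact: measurable_polydisc.
- exact: measurable_funTS.
- by move=> z; rewrite inE => /f0.
Qed.

Lemma integral_polydisc0 (f : 0.-tuple plane -> \bar R) : measurable_fun setT f ->
  \int[tuple_measure dA 0]_(t in pdisc 0) f t = f [tuple].
Proof.
move=> mf; rewrite (_ : pdisc 0 = setT); last by apply/seteqP; split => // t _ [].
by rewrite integral_dirac// diracT mul1e.
Qed.

(** Off the disc f may be negative; it is replaced by its positive part, which agrees with it almost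
    everywhere for the disc probability. *)
Lemma integral_disc_probE (f : plane -> \bar R) : measurable_fun setT f ->
  (forall x, disc x -> 0 <= f x) ->
  \int[dA]_(x in disc) f x = pi%:E * \int[P]_x f x.
Proof.
move=> mf f0; pose g x := maxe 0 (f x).
have mg : measurable_fun setT g by exact: measurable_maxe.
have g0 x : 0 <= g x by rewrite le_max lexx.
transitivity (\int[dA]_(x in disc) g x).
  by apply: eq_integral => x; rewrite inE => dx; rewrite /g max_r// f0.
transitivity (pi%:E * \int[P]_x g x).
  by rewrite ge0_integral_disc_prob// muleA -EFinM divff ?mul1e// gt_eqF// pi_gt0.
congr (_ * _); apply: ae_eq_integral => //.
apply: filterS (disc_prob_ae_lt1 R) => p p1 _.
by rewrite /g max_r// f0.
Qed.

End polydisc_integral.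

Section mahler_integral.
Variable R : realType.
Notation mu := (@lebesgue_measure R).
Notation pos := (`]0%R, +oo[%classic : set R).
Notation C := R[i].
Notation plane := (plane R).
Notation dA := (@planar_measure R).
Notation disc := (@unit_disc R).
Notation N := (@modulus R).
Notation cp := (@complex_of_plane R).
Notation P := (@disc_prob R).
Notation Y := (@log_ratio R).
Notation pdisc n := (@polydisc R n).
Notation kappa := (@fourier_cst R).
Local Open Scope ereal_scope.

Let mpos : measurable pos. Proof. by []. Qed.

Lemma measurable_phase_dist_shift n v :
  measurable_fun setT (fun p : plane => phase_dist n (v + Y p)%R).
Proof.
apply: (ge0_measurable_integral_on (m2 := mu) (A := setT) (B := pos)
  (f := fun z : plane * R => ((1 - cf_log_ratio z.2 ^+ n * phase z.2 (v + Y z.1)%R) / z.2 ^+ 2)%:E)) => //.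
  exact: measurable_phase_shift.
by move=> p t _ pt; exact: phase_dist_integrand_ge0.
Qed.

Lemma integral_phase_dist_shift n v :
  P.-integrable setT (EFin \o (fun p => fine (phase_dist n (v + Y p)%R))) /\
  (\int[P]_p fine (phase_dist n (v + Y p)) = fine (phase_dist n.+1 v))%R.
Proof.
have E p : (fine (phase_dist n (v + Y p)%R))%:E = phase_dist n (v + Y p)%R.
  by rewrite fineK// phase_dist_fin.
have I : \int[P]_p (fine (phase_dist n (v + Y p)%R))%:E = phase_dist n.+1 v.
  by rewrite -phase_distS; apply: eq_integral => p _; exact: E.
split; last by rewrite /Rintegral I.
apply/integrableP; split.
  by apply: eq_measurable_fun (measurable_phase_dist_shift n v) => p _; rewrite /= E.
rewrite (_ : \int[P]_x _ = phase_dist n.+1 v); last first.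
  rewrite -I; apply: eq_integral => p _ /=.
  by rewrite ger0_norm// fine_ge0// phase_dist_ge0.
by have := phase_dist_fin n.+1 v; rewrite ge0_fin_numE// phase_dist_ge0.
Qed.

(* [P_poly] with general coefficients [a] and [b], which absorb the variables
   peeled off the polydisc. *)
Definition pencil n (a b : C) (t : n.+1.-tuple plane) : C :=
  (a * \prod_(j < n) (1 + cp (tnth t (widen_ord (leqnSn n) j))) +
   cp (tnth t ord_max) * (b * \prod_(j < n) (1 - cp (tnth t (widen_ord (leqnSn n) j)))))%R.

Lemma pencil_cons n a b (x : plane) (t : n.+1.-tuple plane) :
  pencil a b (tuple_cons (x, t)) = pencil (a * (1 + cp x))%R (b * (1 - cp x))%R t.
Proof.
have E j : tnth (tuple_cons (x, t)) (widen_ord (leqnSn n.+1) (lift ord0 j)) =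
    tnth t (widen_ord (leqnSn n) j).
  by rewrite -[RHS](tnthS x); congr tnth; exact: val_inj.
have E0 : tnth (tuple_cons (x, t)) (widen_ord (leqnSn n.+1) ord0) = x by [].
have Em : tnth (tuple_cons (x, t)) ord_max = tnth t ord_max.
  by rewrite -[RHS](tnthS x); congr tnth; exact: val_inj.
rewrite /pencil !big_ord_recl E0 Em !mulrA.
by congr (_ + _)%R; congr (_ * _)%R; apply: eq_bigr => j _; rewrite E.
Qed.

Lemma measurable_pencil n a b :
  measurable_fun setT (fun t : n.+1.-tuple plane => lne (N (pencil a b t))%:E).
Proof.
have mt i : measurable_complex (fun t : n.+1.-tuple plane => cp (tnth t i)).
  have mi := @measurable_tnth _ plane n.+1 i.
  by split; [apply: (measurableT_comp measurable_fst)|apply: (measurableT_comp measurable_snd)].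
apply: meas_lne; apply: measurable_modulus.
apply: measurable_complexD; apply: measurable_complexM => //.
- apply: measurable_complex_prod => j; apply: measurable_complexD => //.
- apply: measurable_complexM; first exact: measurable_complex_cst.
  apply: measurable_complex_prod => j; apply: measurable_complexD.
    exact: measurable_complex_cst.
  exact: measurable_complexN.
Qed.

Lemma modulus_disc (x : plane) : disc x -> (N (cp x) < 1)%R.
Proof. by []. Qed.

Lemma modulus_1D_le2 (x : plane) : disc x -> (N (1 + cp x) <= 2)%R /\ (N (1 - cp x) <= 2)%R.
Proof.
move=> /modulus_disc/ltW x1; have := modulusD 1%R (cp x); have := modulusB1_le (cp x).
by rewrite modulus1; split; lra.
Qed.

Lemma modulus_prod_le n (F : 'I_n -> C) (c : R) :
  (forall i, N (F i) <= c)%R -> (N (\prod_(i < n) F i) <= c ^+ n)%R.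
Proof.
elim: n F => [|n IHn] F Fc; first by rewrite big_ord0 modulus1.
by rewrite big_ord_recl modulusM exprS ler_pM ?modulus_ge0 ?IHn.
Qed.

Lemma modulus_pencil n a b (t : n.+1.-tuple plane) : pdisc n.+1 t ->
  (N (pencil a b t) <= 2 ^+ n * (N a + N b))%R.
Proof.
move=> dt; have t1 j := (modulus_1D_le2 (dt j)).1; have t2 j := (modulus_1D_le2 (dt j)).2.
have p1 := modulus_prod_le (fun j => t1 (widen_ord (leqnSn n) j)).
have p2 := modulus_prod_le (fun j => t2 (widen_ord (leqnSn n) j)).
rewrite /pencil (le_trans (modulusD _ _))// mulrDr !modulusM lerD//.
  by rewrite mulrC ler_wpM2r ?modulus_ge0.
rewrite -[leRHS]mul1r ler_pM ?mulr_ge0 ?modulus_ge0//; first exact: ltW (modulus_disc (dt _)).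
by rewrite mulrC ler_wpM2r ?modulus_ge0.
Qed.

Lemma one_pm_neq0 (x : plane) : disc x -> (1 + cp x != 0)%R /\ (1 - cp x != 0)%R.
Proof.
move=> /modulus_disc x1; split; apply/eqP => h.
  have : cp x = (- 1)%R by apply/eqP; rewrite -addr_eq0 addrC h.
  by move=> h'; move: x1; rewrite h' modulusN modulus1 ltxx.
have : cp x = 1%R by apply/eqP; rewrite eq_sym -subr_eq0 h.
by move=> h'; move: x1; rewrite h' modulus1 ltxx.
Qed.
End mahler_integral.

Section pencil_mahler.
Variable R : realType.
Notation C := R[i].
Notation plane := (plane R).
Notation dA := (@planar_measure R).
Notation disc := (@unit_disc R).
Notation N := (@modulus R).
Notation cp := (@complex_of_plane R).
Notation P := (@disc_prob R).
Notation Y := (@log_ratio R).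
Notation pdisc n := (@polydisc R n).
Notation kappa := (@fourier_cst R).
Notation mlr := (@mean_log_rad R).
Local Open Scope ereal_scope.

(** At x = 0 the difference is +oo, so zeros of the polynomial do not disturb the sign. *)
Lemma subr_lne_ge0 (K x : R) : (0 <= x)%R -> (x <= expR K)%R -> 0 <= K%:E - lne x%:E.
Proof.
rewrite le_eqVlt => /predU1P[<- _|x0 xK]; first by rewrite le0_lneNy//= leey.
rewrite lne_EFin// -EFinB lee_fin subr_ge0 -[leRHS]expRK.
by rewrite ler_ln// posrE expR_gt0.
Qed.

(* Subtracting from [K] makes the integrand nonnegative, as Tonelli requires. *)
Lemma integral_pencil n (a b : C) (K : R) : a != 0%R -> b != 0%R ->
  (2 ^+ n * (N a + N b) <= expR K)%R ->
  \int[tuple_measure dA n.+1]_(z in pdisc n.+1) (K%:E - lne (N (pencil a b z))%:E) =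
  (pi ^+ n.+1 * (K - 2^-1 * (ln (N a) + ln (N b) + mlr)
     - (2 * kappa)^-1 * fine (phase_dist n (ln (N b) - ln (N a))%R)))%:E.
Proof.
have k0 : (kappa != 0)%R by rewrite gt_eqF// fourier_cst_gt0.
have mK m c d : measurable_fun setT
    (fun z : m.+1.-tuple plane => K%:E - lne (N (pencil c d z))%:E).
  by apply: meas_adde; [exact: measurable_cst|apply: meas_oppe; exact: measurable_pencil].
have pos m c d : (2 ^+ m * (N c + N d) <= expR K)%R ->
    forall z : m.+1.-tuple plane, pdisc m.+1 z -> 0 <= K%:E - lne (N (pencil c d z))%:E.
  move=> H z dz; apply: subr_lne_ge0; first exact: modulus_ge0.
  by apply: le_trans H; exact: modulus_pencil.
elim: n a b => [|n IHn] a b a0 b0 hK.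
  rewrite (ge0_integral_polydiscS (mK 0%N a b) (pos 0%N a b hK)).
  transitivity (\int[dA]_(x in disc) (K%:E - lne (N (a + cp x * b))%:E)).
    apply: eq_integral => x _; rewrite integral_polydisc0.
      by rewrite /pencil !big_ord0 !mulr1.
    apply: (measurableT_comp (mK 0%N a b)); apply: (measurableT_comp (@measurable_tuple_cons _ plane 0)).
    exact: pair1_measurable.
  rewrite integral_disc_probE.
  - rewrite integral_lne_affine// phase_dist0 -EFinM expr1; congr (EFin (_ * _)%R).
    rewrite /=; congr (_ - _)%R; move: (kappa) k0 (mean_dist_log_rad _) => k k0 w.
    by field.
  - apply: meas_adde; first exact: measurable_cst.
    apply: meas_oppe; apply: meas_lne; apply: measurable_modulus.
    apply: measurable_complexD; first exact: measurable_complex_cst.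
    apply: measurable_complexM; first exact: measurable_complex_cp.
    exact: measurable_complex_cst.
  - move=> x dx; have := pos 0%N a b hK (@tuple_cons _ plane 0 (x, [tuple])).
    rewrite /pencil !big_ord0 !mulr1; apply.
    by have : (disc `*` pdisc 0) (x, [tuple]) by [split => // -[]]; rewrite -polydisc_cons.
have [iD iS] := integral_phase_dist_shift n (ln (N b) - ln (N a))%R.
(* [l] is what the new coefficients add to log |a| + log |b|; its mean is zero. [D] is the distance
   term, shifted by Y. *)
pose l (x : plane) : R := (ln (rad (1 + x.1, x.2)) + ln (rad (1 - x.1, x.2)))%R.
pose D (x : plane) : R := fine (phase_dist n (ln (N b) - ln (N a) + Y x)%R).
have il : P.-integrable setT (EFin \o l).
  by have := integrableD measurableT (integrable_log_1D R) (integrable_log_1B R); exact: eq_integrable.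
have Il : (\int[P]_x l x = 0)%R.
  rewrite /l RintegralD//; [|exact: integrable_log_1D|exact: integrable_log_1B].
  by rewrite integral_log_1D integral_log_1B addr0.
pose q : R := (pi ^+ n.+1)%R.
pose G (x : plane) : \bar R := (q * (K - 2^-1 * (ln (N a) + ln (N b) + mlr)) * 1 +
  (- (2^-1 * q)) * l x + (- ((2 * kappa)^-1 * q)) * D x)%:E.
have GE (x : plane) : disc x ->
    \int[tuple_measure dA n.+1]_(t in pdisc n.+1)
      (K%:E - lne (N (pencil a b (tuple_cons (x, t))))%:E) = G x.
  move=> dx; have [d1 d2] := one_pm_neq0 dx.
  under eq_integral do rewrite pencil_cons.
  have Na := modulus_gt0 a0; have Nb := modulus_gt0 b0.
  have r1 := modulus_gt0 d1; have r2 := modulus_gt0 d2.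
  rewrite IHn ?mulf_neq0//; last first.
    apply: le_trans hK; rewrite exprSr -mulrA ler_wpM2l ?exprn_ge0//.
    have [h1 h2] := modulus_1D_le2 dx.
    by rewrite !modulusM; nra.
  rewrite !modulusM !lnM ?posrE// modulus1Dcp modulus1Bcp /G /D /l /log_ratio.
  rewrite -/q; congr EFin.
  have -> : (ln (N b) + ln (rad (1 - x.1, x.2)) - (ln (N a) + ln (rad (1 + x.1, x.2))) =
    ln (N b) - ln (N a) + (ln (rad (1 - x.1, x.2)) - ln (rad (1 + x.1, x.2))))%R by ring.
  by move: (fine _) (kappa) (q) => w k q'; ring.
rewrite (ge0_integral_polydiscS (mK _ a b) (pos _ a b hK)).
transitivity (\int[dA]_(x in disc) G x).
  by apply: eq_integral => x; rewrite inE; exact: GE.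
rewrite integral_disc_probE; last 2 first.
- have mD := measurable_int _ iD; have ml := measurable_int _ il.
  by rewrite /G; meas; [exact/measurable_EFinP|exact/measurable_EFinP].
- move=> x dx; rewrite -GE//; apply: integral_ge0 => t dt; apply: (pos _ a b hK).
  by have : (disc `*` pdisc n.+1) (x, t) by []; rewrite -polydisc_cons.
rewrite (integral_lin3 _ _ _ measurableT (integrable_disc_cst 1%R) il iD).
rewrite integral_disc_cst Il iS -EFinM exprS -/q; congr EFin.
by move: (fine _) (kappa) (pi) (q) => w k p q'; ring.
Qed.

End pencil_mahler.

(** * The areal Mahler measure as a Fourier integral *)

Section mahler_measure_formula.
Variable R : realType.
Notation plane := (plane R).
Notation dA := (@planar_measure R).
Notation disc := (@unit_disc R).
Notation N := (@modulus R).
Notation cp := (@complex_of_plane R).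
Notation pdisc n := (@polydisc R n).
Notation kappa := (@fourier_cst R).
Notation mlr := (@mean_log_rad R).
Local Open Scope ereal_scope.

Lemma meval_P_poly m (z : m.+1.-tuple plane) :
  mpoly.meval (fun i => cp (tnth z i)) (P_poly R m) = pencil 1%R 1%R z.
Proof.
rewrite /P_poly /pencil mpoly.mevalD mpoly.mevalM /uvar /mvar mpoly.mevalXU !mul1r.
rewrite !rmorph_prod; congr (_ + _ * _)%R; apply: eq_bigr => j _.
  by rewrite rmorphD rmorph1 /xvar /mvar/= mpoly.mevalXU.
by rewrite rmorphB rmorph1 /xvar /mvar/= mpoly.mevalXU.
Qed.

Lemma tuple_measure_polydisc n : tuple_measure dA n (pdisc n) = (pi ^+ n)%:E.
Proof.
rewrite (@tuple_measureE _ _ _ dA n (fun=> disc)); last by move=> _; exact: measurable_unit_disc.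
elim: n => [|n IHn]; first by rewrite big_ord0.
by rewrite big_ord_recl IHn exprS EFinM; congr (_ * _); exact: planar_measure_unit_disc.
Qed.

Lemma M_seqE m :
  M_seq R m = (2^-1 * mlr + (2 * kappa)^-1 * fine (phase_dist m (0 : R)))%R.
Proof.
(* Each factor of the two products has modulus at most 2 and |u| < 1, so |P_m| <= 2^m + 2^m on the
   polydisc. *)
pose K : R := ln (2 ^+ m * 2)%R.
have hK : (2 ^+ m * (N 1 + N 1) <= expR K)%R.
  by rewrite modulus1 /K lnK// posrE mulr_gt0// exprn_gt0.
have := integral_pencil (oner_neq0 _) (oner_neq0 _) hK.
rewrite modulus1 ln1 addr0 subr0 add0r.
set w := (K - _ - _)%R => I.
have mD := @measurable_polydisc R m.+1.
pose h (z : m.+1.-tuple plane) := K%:E - lne (N (pencil 1%R 1%R z))%:E.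
have h0 z : pdisc m.+1 z -> 0 <= h z.
  move=> dz; apply: subr_lne_ge0; first exact: modulus_ge0.
  by apply: le_trans hK; exact: modulus_pencil.
have mh : measurable_fun (pdisc m.+1) h.
  apply: measurable_funTS; apply: meas_adde; first exact: measurable_cst.
  by apply: meas_oppe; exact: measurable_pencil.
have ih : (tuple_measure dA m.+1).-integrable (pdisc m.+1) h.
  apply/integrableP; split => //.
  under eq_integral => z do [rewrite inE => dz; rewrite gee0_abs ?h0//].
  by rewrite I ltry.
have Ic (c : R) : \int[tuple_measure dA m.+1]_(z in pdisc m.+1) (cst c%:E) z = (c * pi ^+ m.+1)%:E.
  apply: etrans (integral_cst _ mD _) _; rewrite EFinM; congr (_ * _).
  exact: tuple_measure_polydisc.
have iK : (tuple_measure dA m.+1).-integrable (pdisc m.+1) (cst K%:E).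
  apply/integrableP; split; first exact: measurable_cst.
  by rewrite (Ic `|K|%R) ltry.
(* Both K and K - log are integrable on the polydisc, so the shift by K can now be undone. *)
have J : \int[tuple_measure dA m.+1]_(z in pdisc m.+1) lne (N (pencil 1%R 1%R z))%:E =
    (pi ^+ m.+1 * (K - w))%:E.
  transitivity (\int[tuple_measure dA m.+1]_(z in pdisc m.+1) (cst K%:E \- h) z).
    apply: eq_integral => z _; rewrite /h/=.
    (* At a zero of the pencil both sides are -oo. *)
    have := modulus_ge0 (pencil 1%R 1%R z); rewrite le_eqVlt => /predU1P[<-|x0].
      by rewrite lexx.
    by rewrite leNgt x0 -!EFinB; congr EFin; ring.
  rewrite integralB// I Ic -EFinB.
  by congr EFin; move: (pi ^+ m.+1)%R => q; ring.
rewrite /M_seq /areal_mahler; under eq_integral do rewrite meval_P_poly.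
rewrite J /=.
have q0 : (pi ^+ m.+1 != 0 :> R)%R by rewrite expf_neq0// gt_eqF// pi_gt0.
rewrite /w; move: (pi ^+ m.+1)%R q0 (kappa) (fine _) => q q0 k p.
by rewrite mulKf//; ring.
Qed.

End mahler_measure_formula.

(** * Iterated differences *)

Section iterated_differences.
Variable R : realType.
Notation mu := (@lebesgue_measure R).
Notation pos := (`]0%R, +oo[%classic : set R).
Notation P := (@disc_prob R).
Notation psi := (@cf_log_ratio R).
Notation kappa := (@fourier_cst R).

Let mpos : measurable pos. Proof. by []. Qed.

Lemma iter_DeltaS (u : nat -> R) r m :
  iter r.+1 (@Delta R) u m = iter r (@Delta R) u m.+1 - iter r (@Delta R) u m.
Proof. by []. Qed.

(** The exponent is [r.+1] because the constant a disappears only after one difference. *)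
Lemma iter_Delta_affine (a b : R) (u : nat -> R) r m :
  iter r.+1 (@Delta R) (fun n => a + b * u n) m = b * iter r.+1 (@Delta R) u m.
Proof.
elim: r m => [|r IHr] m; first by rewrite !iter_DeltaS /=; ring.
by rewrite iter_DeltaS !IHr -mulrBr -iter_DeltaS.
Qed.

(** Each difference multiplies x^n by x - 1 = - (1 - x); the [r.+1] signs so obtained and the one in
    front of x^n make up the exponent [r.+2]. *)
Lemma iter_Delta_geometric (x c d : R) r m :
  iter r.+1 (@Delta R) (fun n => (1 - x ^+ n * c) / d) m =
  (-1) ^+ r.+2 * ((1 - x) ^+ r.+1 * x ^+ m * c / d).
Proof.
elim: r m => [|r IHr] m; first by rewrite iter_DeltaS /= exprS; ring.
by rewrite iter_DeltaS !IHr !exprS; ring.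
Qed.

Lemma iter_Delta_Rintegral (g : nat -> R -> R) :
  (forall n, mu.-integrable pos (EFin \o g n)) -> forall r m,
  mu.-integrable pos (EFin \o (fun t => iter r (@Delta R) (g ^~ t) m)) /\
  iter r (@Delta R) (fun n => \int[mu]_(t in pos) g n t) m =
  \int[mu]_(t in pos) iter r (@Delta R) (g ^~ t) m.
Proof.
move=> ig; elim=> [|r IHr] m; first by split; [exact: ig|].
have [i1 e1] := IHr m; have [i2 e2] := IHr m.+1.
split; first by have := @integrableB _ _ _ mu pos mpos _ _ i2 i1; exact: eq_integrable.
by rewrite iter_DeltaS e1 e2 -RintegralB.
Qed.

Lemma integrable_phase_dist n :
  mu.-integrable pos (EFin \o (fun t => (1 - psi t ^+ n * cf_log_rad t) / t ^+ 2)).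
Proof.
have m1 := @measurable_psi R; have m2 := @measurable_cf_log_rad R.
apply/integrableP; split; first by apply: measurable_funTS; apply: meas_EFin; meas.
have := phase_dist_fin n (0 : R); rewrite ge0_fin_numE ?phase_dist_ge0//.
apply: le_lt_trans; rewrite le_eqVlt; apply/orP; left; apply/eqP.
apply: eq_integral => t; rewrite inE => pt.
by rewrite gee0_abs /= -?phase0//; exact: phase_dist_integrand_ge0.
Qed.

Lemma phase_dist0E n : fine (phase_dist n (0 : R)) =
  \int[mu]_(t in pos) ((1 - psi t ^+ n * cf_log_rad t) / t ^+ 2).
Proof.
by congr fine; apply: eq_integral => t _; rewrite phase0.
Qed.

(** Nonnegativity of psi alone would leave the possibility that psi^m vanishes on the interval where
    the integrand has to be positive. The bound 1 - psi(t) <= t E |Y| excludes this near 0. *)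
Lemma cf_log_ratio_gt0_near0 : exists2 e : R, 0 < e <= 2 &
  forall t, 0 < t < e -> 0 < psi t.
Proof.
pose c := \int[P]_p `|@log_ratio R p|.
have c0 : 0 <= c by apply: Rintegral_ge0.
(* Using c + 1 in place of c keeps the denominator positive and the inverse at most 1, within the
   range ]0, 2] on which [psi_lt1] is proved. *)
exists (c + 1)^-1 => [|t /andP[t0 tc]].
  by rewrite invr_gt0 ltr_wpDl//= invf_ple ?posrE ?ltr_wpDl//; lra.
have := onesub_psi_le t0; rewrite -/c => h.
suff : t * c < 1 by lra.
have : t * (c + 1) < 1 by rewrite -ltr_pdivlMr ?ltr_wpDl// mul1r.
by lra.
Qed.

(** Differences in n commute with the integral in t, as every integrand is integrable; after the
    signs cancel the integrand [f] is nonnegative on the half-line and positive on ]0, e[, where 0 <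
    psi < 1. *)
Lemma sign_iter_Delta_phase_dist r m :
  0 < (-1) ^+ r.+2 * iter r.+1 (@Delta R) (fun n => fine (phase_dist n (0 : R))) m.
Proof.
rewrite (_ : (fun n => _) = (fun n => \int[mu]_(t in pos)
  ((1 - psi t ^+ n * cf_log_rad t) / t ^+ 2))); last by apply/funext => n; exact: phase_dist0E.
have [i1 ->] := iter_Delta_Rintegral integrable_phase_dist r.+1 m.
pose f t := (1 - psi t) ^+ r.+1 * psi t ^+ m * cf_log_rad t / t ^+ 2.
have E t : iter r.+1 (@Delta R) (fun n => (1 - psi t ^+ n * cf_log_rad t) / t ^+ 2) m =
  (-1) ^+ r.+2 * f t by exact: iter_Delta_geometric.
have s2 : (-1) ^+ r.+2 * (-1) ^+ r.+2 = 1 :> R by rewrite -exprD addnn -signr_odd odd_double.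
have [e /andP[e0 e2] pe] := cf_log_ratio_gt0_near0.
rewrite -RintegralZl// (_ : \int[mu]_(t in pos) _ = \int[mu]_(t in pos) f t); last first.
  by apply: eq_Rintegral => t _; rewrite E mulrA s2 mul1r.
have if_ : mu.-integrable pos (EFin \o f).
  have := @integrableZl _ _ _ mu pos mpos ((-1) ^+ r.+2) _ i1; apply: eq_integrable => // t _.
  by rewrite /comp E -EFinM mulrA s2 mul1r.
rewrite -lte_fin -integral_RintegralE//.
have m1 := @measurable_psi R; have m2 := @measurable_cf_log_rad R.
have mf : measurable_fun [set: R] (EFin \o f) by apply: meas_EFin; rewrite /f; meas.
apply: (@integral_gt0_itv _ _ _ 0 e) => //.
- by move=> t; rewrite /= !in_itv/= andbT => /andP[].
- move=> t _; rewrite lee_fin !mulr_ge0 ?invr_ge0 ?sqr_ge0 ?exprn_ge0 ?subr_ge0 ?psi_le1 ?cf_log_ratio_ge0//.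
  exact: ltW (cf_log_rad_gt0 _).
- move=> t te; have /andP[t0 t1] := te.
  rewrite lte_fin !mulr_gt0 ?invr_gt0 ?exprn_gt0 ?cf_log_rad_gt0 ?pe// subr_gt0 psi_lt1// t0/=.
  by apply: ltW; exact: lt_le_trans t1 e2.
Qed.

End iterated_differences.

Theorem corollary5p2 (R : realType) (m r : nat)
    (hm : (1 <= m)%N) (hr : (1 <= r)%N) :
  0 < (-1) ^+ r.+1 * iter r (@Delta R) (M_seq R) m.
Proof.
case: r hr => // r _.
rewrite (_ : M_seq R = (fun n => 2^-1 * @mean_log_rad R +
  (2 * @fourier_cst R)^-1 * fine (phase_dist n (0 : R)))); last by apply/funext => n; exact: M_seqE.
rewrite iter_Delta_affine mulrCA mulr_gt0 ?sign_iter_Delta_phase_dist//.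
by rewrite invr_gt0 mulr_gt0// fourier_cst_gt0.
Qed.
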